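(* Let $T$ be an edge-to-edge tiling of the plane by unit-area pentagons, with perimeter ratio less than or equal to half the perimeter of a unit-area Prismatic pentagon, i.e. at most $\sqrt{2+\sqrt3}$. For $R>0$ let $C_1=C_1(R)$, $N_1=N_1(R)$ and $N_2=N_2(R)$ be the fractions of the pentagons completely inside the disk of radius $R$ about the origin which are efficient, non-convex Type 1, and non-convex Type 2, respectively. Then $$\liminf_{R\to\infty}\,(C_1-2.6N_1-13.4N_2)\ge 0.$$
   Context: Edge-to-edge means adjacent tiles meet only along entire edges or at vertices. The perimeter ratio of a planar tiling is the limit supremum, as $R\to\infty$, of the perimeter (total edge length of the tiling) inside the disk of radius $R$ about the origin, divided by $\pi R^2$. A Cairo (respectively Prismatic) pentagon is a pentagon with three angles of $2\pi/3$ and two right angles which are nonadjacent (respectively adjacent), circumscribed about a circle; at unit area both have perimeter $2\sqrt{2+\sqrt3}\approx 3.86$. A unit-area pentagon is efficient if its perimeter is less than or equal to that of a unit-area Cairo pentagon. A non-convex pentagon is Type 1 if it has exactly one interior angle larger than $\pi$ and Type 2 if it has two interior angles larger than $\pi$. *)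

(* Defs.v *)
From HB Require Import structures.
From mathcomp Require Import all_boot all_order all_algebra.
From mathcomp Require Import finmap.
From mathcomp Require Import all_classical all_reals all_analysis.
Set Implicit Arguments.
Unset Strict Implicit.
Unset Printing Implicit Defensive.
Import Order.TTheory GRing.Theory Num.Theory.
Import numFieldNormedType.Exports.
Local Open Scope classical_set_scope.
Local Open Scope ring_scope.

(* The canonical norm of R * R is the max norm, hence an explicit Euclidean
   distance. *)
Definition dist (R : realType) (x y : R * R) : R :=
  Num.sqrt ((x.1 - y.1) ^+ 2 + (x.2 - y.2) ^+ 2).

Definition disk (R : realType) (c : R * R) (r : R) : set (R * R) :=
  [set x | dist c x <= r].

Definition segment (R : realType) (a b : R * R) : set (R * R) :=
  [set ((1 - t) * a.1 + t * b.1, (1 - t) * a.2 + t * b.2) | t in `[0, 1]].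

Definition polygon_edge (R : realType) (v : 'I_5 -> R * R) (i : 'I_5) :
    set (R * R) :=
  segment (v i) (v (ordS i)).

Definition dot (R : realType) (u w : R * R) : R := u.1 * w.1 + u.2 * w.2.

Definition cross (R : realType) (u w : R * R) : R := u.1 * w.2 - u.2 * w.1.

(* A pentagon is the compact region bounded by a simple closed polygon with
   five vertices, listed in cyclic order (in either direction), none of which
   has a straight angle.  By the Jordan curve theorem, the last three fields
   determine [region]: it is the union of the curve and the bounded component
   of its complement.  Indices 2 apart are exactly the nonadjacent ones. *)
Record pentagon (R : realType) := Pentagon {
  vertex : 'I_5 -> R * R ;
  region : set (R * R) ;
  adjacent_edges : forall i,
    polygon_edge vertex i `&` polygon_edge vertex (ordS i)
      = [set vertex (ordS i)] ;
  nonadjacent_edges : forall i,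
    polygon_edge vertex i `&` polygon_edge vertex (ordS (ordS i)) = set0 ;
  no_straight_angle : forall i,
    cross (vertex (ordS i) - vertex i)
          (vertex (ordS (ordS i)) - vertex (ordS i)) != 0 ;
  region_compact : compact region ;
  region_regular : closure (interior region) = region ;
  region_boundary :
    region `\` interior region = \bigcup_i polygon_edge vertex i }.

HB.instance Definition _ (R : realType) := gen_eqMixin (pentagon R).
HB.instance Definition _ (R : realType) := gen_choiceMixin (pentagon R).

Definition edge (R : realType) (P : pentagon R) (i : 'I_5) : set (R * R) :=
  polygon_edge (vertex P) i.

Definition area (R : realType) (P : pentagon R) : \bar R :=
  ((@lebesgue_measure R) \x (@lebesgue_measure R))%E (region P).

Definition perimeter (R : realType) (P : pentagon R) : R :=
  \sum_(i < 5) dist (vertex P i) (vertex P (ordS i)).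

(* Near the vertex, the region is a circular sector of opening [th]. *)
Definition interior_angle (R : realType) (P : pentagon R) (i : 'I_5) (th : R) :
    Prop :=
  0 < th < 2 * pi /\
  exists alpha eps : R, 0 < eps /\
    forall x, dist (vertex P i) x < eps ->
      (region P x <->
       exists rho phi : R,
         [/\ 0 <= rho, alpha <= phi <= alpha + th
           & x = ((vertex P i).1 + rho * cos phi,
                  (vertex P i).2 + rho * sin phi)]).

(* Each side is tangent to the circle, at a point of the side itself. *)
Definition circumscribed (R : realType) (P : pentagon R) : Prop :=
  exists (c : R * R) (r : R), 0 < r /\
    forall i, exists p, [/\ edge P i p, dist c p = r
      & dot (p - c) (vertex P (ordS i) - vertex P i) = 0].

Definition adjacent (i j : 'I_5) : bool := (j == ordS i) || (i == ordS j).

Definition right_angles_at (R : realType) (P : pentagon R) (i j : 'I_5) : Prop :=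
  [/\ i != j, interior_angle P i (pi / 2), interior_angle P j (pi / 2)
    & forall k, k != i -> k != j -> interior_angle P k (2 * pi / 3)].

Definition cairo (R : realType) (P : pentagon R) : Prop :=
  (exists i j, ~~ adjacent i j /\ right_angles_at P i j) /\ circumscribed P.

Definition prismatic (R : realType) (P : pentagon R) : Prop :=
  (exists i j, adjacent i j /\ right_angles_at P i j) /\ circumscribed P.

Definition efficient (R : realType) (P : pentagon R) : Prop :=
  exists Q : pentagon R,
    [/\ cairo Q, area Q = 1%E & perimeter P <= perimeter Q].

Definition nonconvex (R : realType) (P : pentagon R) : Prop :=
  ~ (forall a b, region P a -> region P b -> segment a b `<=` region P).

Definition reflex (R : realType) (P : pentagon R) (i : 'I_5) : Prop :=
  exists th, interior_angle P i th /\ pi < th.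

Definition type1 (R : realType) (P : pentagon R) : Prop :=
  nonconvex P /\ #|[pred i | `[< reflex P i >]]| = 1%N.

Definition type2 (R : realType) (P : pentagon R) : Prop :=
  nonconvex P /\ #|[pred i | `[< reflex P i >]]| = 2%N.

Definition tiling (R : realType) (T : set (pentagon R)) : Prop :=
  \bigcup_(P in T) region P = setT /\
  forall P Q, T P -> T Q -> P <> Q ->
    interior (region P) `&` interior (region Q) = set0.

Definition edge_to_edge (R : realType) (T : set (pentagon R)) : Prop :=
  forall P Q, T P -> T Q -> P <> Q ->
    forall x, region P x -> region Q x ->
      (exists i j, edge P i = edge Q j /\ edge P i x) \/
      (exists i j, vertex P i = x /\ vertex Q j = x).

(* As sets of points, so that an edge shared by two tiles counts once. *)
Definition edges (R : realType) (T : set (pentagon R)) : set (set (R * R)) :=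
  [set S | exists P i, T P /\ S = edge P i].

(* The length of a possibly empty segment; [sup set0 = 0].  A disk cuts an
   edge in such a segment. *)
Definition segment_length (R : realType) (S : set (R * R)) : R :=
  sup [set d | exists x y, [/\ S x, S y & d = dist x y]].

Definition perimeter_inside (R : realType) (T : set (pentagon R)) (r : R) :
    \bar R :=
  (\esum_(S in edges T) (segment_length (S `&` disk 0 r))%:E)%E.

Definition perimeter_ratio (R : realType) (T : set (pentagon R)) : \bar R :=
  limf_esup (fun r : R => perimeter_inside T r * ((pi * r ^+ 2)^-1)%:E)%E +oo.

Definition tiles_inside (R : realType) (T : set (pentagon R)) (r : R) :
    set (pentagon R) :=
  [set P | T P /\ region P `<=` disk 0 r].

(* For tiles of unit area [tiles_inside T r] is finite, so [fset_set] does not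
   take its default value. *)
Definition fraction (R : realType) (T : set (pentagon R))
    (A : pentagon R -> Prop) (r : R) : R :=
  #|` fset_set (tiles_inside T r `&` [set P | A P]) |%:R
    / #|` fset_set (tiles_inside T r) |%:R.

(* Main.v *)
(* Let c be the common perimeter of the unit-area Cairo and Prismatic pentagons.
   Every unit-area pentagon P satisfies c - perimeter P <= (7 / 135) w(P), where
   w(P) is the sum of 1 if P is efficient, of - 2.6 if P is of type 1 and of - 13.4
   if P is of type 2.  Indeed no unit-area pentagon has a smaller perimeter than the
   regular one; and as a reflex vertex lies in the convex hull of the other
   vertices, a tile of type 1 (respectively 2) is contained in the hull of four
   (respectively three) of its vertices, so that its perimeter is at least that
   of the unit square (respectively unit equilateral triangle).  For the
   pentagonal isoperimetric inequality, among the closed pentagons of bounded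
   length and of area bounded below, one that minimizes the sum of the squared
   sides is equilateral, and the discrete Wirtinger inequality applies to it.

   An edge belongs to at most two tiles, so the perimeters of the tiles inside the
   disk of radius r sum to at most twice the edge length in that disk.  Together
   with the tiles that meet the disk of radius r - 8 but leave that of radius r,
   they cover the smaller disk, and each of these crossing tiles has edge length
   at least 8 > c in the larger one.  Hence the mean of the perimeter is
   asymptotically at most c, and that of w asymptotically at least 0. *)
Require Import Defs.
From mathcomp Require Import all_boot all_order all_algebra.
From mathcomp Require Import finmap.
From mathcomp Require Import all_classical all_reals all_analysis measurable_realfun.
From mathcomp Require Import ring lra.
Import Order.TTheory GRing.Theory Num.Theory.
Import numFieldNormedType.Exports.
Local Open Scope classical_set_scope.
Local Open Scope ring_scope.
Set Implicit Arguments.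
Unset Strict Implicit.
Unset Printing Implicit Defensive.

(** * Plane Lebesgue measure *)

(** The area of a tile is the Lebesgue measure of its region, and about the region little is given:
    it is compact, regular, and its boundary is the polygon. Most geometric facts are therefore
    drawn from one device, that a segment leaving a compact set meets its boundary, and areas of
    tiles are bounded above by covering the region with triangles.

    The isoperimetric inequality splits on whether some vertex lies in the hull of the other four.
    If so, the perimeter is at least 4, which is more than enough. If not, simplicity of the curve
    forces a common orientation on the vertex triples, the fan of triangles at one vertex adds up to
    the shoelace formula, and the variational argument applies to that formula.

    The Cairo and Prismatic perimeters enter through [efficient] and the hypothesis on the ratio.
    Using either requires an actual pentagon with its region, angles, incircle and exact area, which
    is why convex pentagons are also built as intersections of half-planes. *)

Notation mu2 R := ((@lebesgue_measure R) \x (@lebesgue_measure R))%E.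

(** The measurable structure is a product, so an open set is written as a countable union of boxes
    with rational centres and radii [n.+1%:R^-1]. *)
Lemma open_measurable2 (R : realType) (U : set (R * R)) :
  open U -> measurable (U : set (measurableTypeR R * measurableTypeR R)).
Proof.
move=> oU.
pose box (q : rat) (r : rat) (n : nat) : set (R * R) :=
  ball (ratr q : R) n.+1%:R^-1 `*` ball (ratr r : R) n.+1%:R^-1.
have -> : U = \bigcup_q \bigcup_r \bigcup_(n in [set n | box q r n `<=` U]) box q r n.
  rewrite eqEsubset; split => [x Ux|x [q _] [r _] [n] + bx]; last exact.
  have /nbhs_ballP[e /= e0 eU] : nbhs x U by exact: open_nbhs_nbhs.
  have [n ne] : exists n, (n.+1%:R^-1 : R) < e / 2.
    exists (Num.truncn (e / 2)^-1).
    rewrite -[ltRHS]invrK ltf_pV2 ?posrE ?invr_gt0 ?divr_gt0//.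
    exact: truncnS_gt.
  have n0 : 0 < (n.+1%:R^-1 : R) by rewrite invr_gt0.
  have near_rat (y : R) : exists q : rat, ball (ratr q : R) n.+1%:R^-1 y.
    have [|q] := @rat_in_itvoo R (y - n.+1%:R^-1) (y + n.+1%:R^-1).
      by rewrite -subr_gt0 opprD opprK addrACA subrr add0r addr_gt0.
    rewrite in_itv/= => /andP[h1 h2]; exists q; by rewrite /ball/= ltr_distl h1.
  have [q xq] := near_rat x.1; have [r xr] := near_rat x.2.
  exists q => //; exists r => //; exists n => //= y [yq yr]; apply: eU; split.
    have := ball_triangle (ball_sym xq) yq.
    by apply: le_ball; rewrite [leRHS]splitr; apply/ltW/ltrD.
  have := ball_triangle (ball_sym xr) yr.
  by apply: le_ball; rewrite [leRHS]splitr; apply/ltW/ltrD.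
apply: bigcupT_measurable_rat => q; apply: bigcupT_measurable_rat => r.
apply: bigcup_measurable => n _.
by apply: measurableX; exact: measurable_ball.
Qed.

Lemma closed_measurable2 (R : realType) (U : set (R * R)) :
  closed U -> measurable (U : set (measurableTypeR R * measurableTypeR R)).
Proof.
by move=> cU; rewrite -[U]setCK; apply: measurableC; apply: open_measurable2; exact: closed_openC.
Qed.

Lemma compact_measurable2 (R : realType) (U : set (R * R)) :
  compact U -> measurable (U : set (measurableTypeR R * measurableTypeR R)).
Proof.
move=> cU; apply: closed_measurable2; exact: compact_closed.
Qed.

(** The product measure integrates the section lengths [g x - f x]; the fundamental theorem
    evaluates this by the antiderivative [F] that the caller supplies. *)
Lemma measure_between (R : realType) (p q : R) (f g F : R -> R) :
  p < q -> continuous f -> continuous g ->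
  (forall x, p <= x <= q -> f x <= g x) ->
  (forall x, p <= x <= q -> is_derive x 1 F (g x - f x)) ->
  mu2 R [set z | p <= z.1 <= q /\ f z.1 <= z.2 <= g z.1] = (F q - F p)%:E.
Proof.
move=> pq cf cg fg dF.
have cF x : p <= x <= q -> {for x, continuous F}.
  move=> /dF [dFx _]; apply: differentiable_continuous.
  exact/derivable1_diffP.
have F' : {in `]p, q[, F^`()%classic =1 g \- f}.
  move=> x; rewrite in_itv/= => /andP[px xq].
  have [|_ Fx] := dF x; first by rewrite !ltW.
  by rewrite derive1E Fx.
have LR : derivable_oo_LRcontinuous F p q.
  split; last 2 first.
  - by apply: cvg_at_right_filter; apply: cF; rewrite lexx ltW.
  - by apply: cvg_at_left_filter; apply: cF; rewrite lexx ltW.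
  by move=> x; rewrite in_itv/= => /andP[px xq]; have [|+ _] := dF x; first by rewrite !ltW.
rewrite /product_measure1 /=.
rewrite EFinB -(@continuous_FTC2 _ (g \- f)) //; last first.
  by apply: continuous_subspaceT => x; apply: cvgB; [exact: cg|exact: cf].
rewrite [RHS]integral_mkcond; apply: eq_integral => x _ /=.
rewrite patchE; case: ifPn => [|xpq].
  rewrite inE/= in_itv/= => xpq.
  have -> : xsection [set z : R * R | p <= z.1 <= q /\ f z.1 <= z.2 <= g z.1] x = `[f x, g x]%classic.
    apply/seteqP; split => y; rewrite /xsection/= in_itv/= inE/=; first by case.
    by split.
  rewrite lebesgue_measure_itv/= lte_fin.
  case: ltP => // h; have := fg _ xpq => h'.
  by congr (_%:E); lra.
have -> : xsection [set z : R * R | p <= z.1 <= q /\ f z.1 <= z.2 <= g z.1] x = set0.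
  rewrite -subset0 => y; rewrite /xsection/= inE/= => -[h _].
  by move: xpq; rewrite notin_setE/= in_itv/= h.
by rewrite measure0.
Qed.

Section ContinuousReal.
Context {R : realType} {T : topologicalType}.
Implicit Types f g : T -> R.

Lemma continuous_cst (k : R) : continuous (fun _ : T => k).
Proof. by move=> x; exact: cvg_cst. Qed.

Lemma continuous_add f g :
  continuous f -> continuous g -> continuous (fun x => f x + g x).
Proof. by move=> cf cg x; exact: (cvgD (cf x) (cg x)). Qed.

Lemma continuous_sub f g :
  continuous f -> continuous g -> continuous (fun x => f x - g x).
Proof. by move=> cf cg x; exact: (cvgB (cf x) (cg x)). Qed.

Lemma continuous_mul f g :
  continuous f -> continuous g -> continuous (fun x => f x * g x).
Proof. by move=> cf cg x; exact: (cvgM (cf x) (cg x)). Qed.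

Lemma continuous_dist (p q : T -> R * R) :
  continuous (fun x => (p x).1) -> continuous (fun x => (p x).2) ->
  continuous (fun x => (q x).1) -> continuous (fun x => (q x).2) ->
  continuous (fun x => dist (p x) (q x)).
Proof.
move=> p1 p2 q1 q2 x.
apply: (@continuous_comp _ _ _
  (fun x => ((p x).1 - (q x).1) ^+ 2 + ((p x).2 - (q x).2) ^+ 2) (@Num.sqrt R));
  last exact: sqrt_continuous.
have b1 := continuous_sub p1 q1; have b2 := continuous_sub p2 q2.
exact: (continuous_add (continuous_mul b1 b1) (continuous_mul b2 b2)).
Qed.

Lemma continuous_pair f g :
  continuous f -> continuous g -> continuous (fun z => (f z, g z)).
Proof.
move=> cf cg z.
exact: (@cvg_pair _ _ _ (nbhs z) (nbhs (f z)) (nbhs (g z)) _ _ _ f g (cf z) (cg z)).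
Qed.

Lemma closed_le_fun f g :
  continuous f -> continuous g -> closed [set z | f z <= g z].
Proof.
move=> cf cg.
have -> : [set z | f z <= g z] = (fun z => g z - f z) @^-1` [set y | 0 <= y].
  by apply/seteqP; split => z /=; rewrite subr_ge0.
have /continuous_closedP/(_ [set y | 0 <= y]) := continuous_sub cg cf.
by apply; exact: closed_ge.
Qed.

End ContinuousReal.

Lemma continuous_fst (R : realType) : continuous (fst : R * R -> R).
Proof. by move=> z; exact: cvg_fst. Qed.

Lemma continuous_snd (R : realType) : continuous (snd : R * R -> R).
Proof. by move=> z; exact: cvg_snd. Qed.

Lemma dist_continuous (R : realType) (c : R * R) : continuous (dist c).
Proof.
by apply: continuous_dist; [exact: continuous_cst|exact: continuous_cst|
  exact: continuous_fst|exact: continuous_snd].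
Qed.

Lemma disk_closed (R : realType) (c : R * R) (r : R) : closed (disk c r).
Proof.
have /continuous_closedP/(_ [set y | y <= r]) := @dist_continuous R c.
exact; exact: closed_le.
Qed.

Lemma between_closed (R : realType) (p q : R) (f g : R -> R) :
  continuous f -> continuous g ->
  closed [set z : R * R | p <= z.1 <= q /\ f z.1 <= z.2 <= g z.1].
Proof.
move=> cf cg.
have -> : [set z : R * R | p <= z.1 <= q /\ f z.1 <= z.2 <= g z.1] =
  ([set z | p <= z.1] `&` [set z | z.1 <= q]) `&`
  ([set z | f z.1 <= z.2] `&` [set z | z.2 <= g z.1]).
  apply/seteqP; split => z /=; first by move=> [/andP[? ?] /andP[? ?]].
  by move=> [[-> ->] [-> ->]].
have c1 : continuous (fst : R * R -> R) by move=> z; exact: cvg_fst.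
have c2 : continuous (snd : R * R -> R) by move=> z; exact: cvg_snd.
have cc (h : R -> R) : continuous h -> continuous (fun z : R * R => h z.1).
  by move=> ch z; apply: continuous_comp; [exact: c1|exact: ch].
by do 2 apply: closedI; apply: closed_le_fun => // z; try exact: cvg_cst; exact: cc.
Qed.

(** The slab of the disk over [|x| <= r sin u] has area at least [2 u r^2], and [u] tends to
    [pi / 2]. Stopping short of the ends keeps the square root and [asin] differentiable. *)
Lemma disk_measure_ge (R : realType) (r : R) : 0 < r ->
  ((pi * r ^+ 2)%:E <= mu2 R (disk (0 : R * R)%R r))%E.
Proof.
move=> r0.
have mD : measurable (disk (0 : R * R) r : set (measurableTypeR R * measurableTypeR R)).
  by apply: closed_measurable2; exact: disk_closed.
suff main (u : R) : 0 < u < pi / 2 -> ((2 * u * r ^+ 2)%:E <= mu2 R (disk (0 : R * R)%R r))%E.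
  have : (0 <= mu2 R (disk (0 : R * R)%R r))%E by exact: measure_ge0.
  case: (mu2 R (disk (0 : R * R)%R r)) main => [m main _|_ _|//]; last by rewrite leey.
  rewrite lee_fin; apply/ler_addgt0Pl => e e0.
  have pi0 := pi_gt0 R.
  have r20 : 0 < r ^+ 2 by rewrite exprn_gt0.
  pose d := Num.min (pi / 4) (e / (2 * r ^+ 2)).
  have d0 : 0 < d by rewrite lt_min !divr_gt0// mulr_gt0.
  have d1 : d <= pi / 4 by rewrite ge_min lexx.
  have d2 : d * (2 * r ^+ 2) <= e.
    by rewrite -ler_pdivlMr ?mulr_gt0// ge_min lexx orbT.
  have := main (pi / 2 - d); rewrite lee_fin => h.
  have {h} : 2 * (pi / 2 - d) * r ^+ 2 <= m by apply: h; apply/andP; split; lra.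
  nra.
move=> /andP[u0 u1].
have pi0 := pi_gt0 R.
have su : sin u < 1.
  have := cos2Dsin2 u; have : 0 < cos u by rewrite cos_gt0_pihalf//; apply/andP; split; lra.
  move: (cos u) (sin u) => c s; nra.
have su0 : 0 < sin u by rewrite sin_gt0_pi//; apply/andP; split; lra.
have cu0 : 0 < cos u by rewrite cos_gt0_pihalf//; apply/andP; split; lra.
pose g (x : R) := Num.sqrt (r ^+ 2 - x ^+ 2).
pose F (x : R) := x * g x + r ^+ 2 * asin (x / r).
have cg : continuous g.
  move=> x; apply: continuous_comp; last exact: sqrt_continuous.
  by apply: cvgB; [exact: cvg_cst|exact: (cvgM cvg_id cvg_id)].
have rsu : r * sin u < r by rewrite -[ltRHS]mulr1 ltr_pM2l.
have rsu0 : 0 < r * sin u by rewrite mulr_gt0.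
have dF (x : R) : - (r * sin u) <= x <= r * sin u -> is_derive x 1 F (g x - - g x).
  move=> /andP[x1 x2].
  have xr : -1 < x / r < 1.
    rewrite ltr_pdivlMr// ltr_pdivrMr// mulN1r mul1r (le_lt_trans x2)// andbT.
    by rewrite (lt_le_trans _ x1)// ltrN2.
  have rx : 0 < r ^+ 2 - x ^+ 2 by nra.
  have gx0 : 0 < g x by rewrite sqrtr_gt0.
  have gx2 : g x ^+ 2 = r ^+ 2 - x ^+ 2 by rewrite sqr_sqrtr// ltW.
  have dg : is_derive x 1 g ((2 * g x)^-1 * (- (2 * x))).
    have d1 : is_derive x 1 (fun x : R => r ^+ 2 - x ^+ 2) (- (2 * x)).
      have -> : (fun x : R => r ^+ 2 - x ^+ 2) = cst (r ^+ 2) - (@id R) ^+ 2 by [].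
      by apply: is_derive_eq; rewrite sub0r /GRing.scale/= mulr1 expr1.
    have d2 := is_derive1_sqrt rx.
    exact: is_derive1_comp.
  have da : is_derive x 1 (fun x => asin (x / r)) ((Num.sqrt (1 - (x / r) ^+ 2))^-1 * r^-1).
    have d1 : is_derive x 1 (fun x : R => x / r) r^-1.
      have -> : (fun x : R => x / r) = (@id R) * cst (r^-1) by [].
      by apply: is_derive_eq; rewrite scaler0 add0r /GRing.scale/= mulr1.
    have d2 := is_derive1_asin xr.
    exact: is_derive1_comp.
  have -> : g x - - g x = (x * ((2 * g x)^-1 * (- (2 * x))) + g x * 1) +
     r ^+ 2 * ((Num.sqrt (1 - (x / r) ^+ 2))^-1 * r^-1).
    have -> : Num.sqrt (1 - (x / r) ^+ 2) = g x / r.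
      have -> : 1 - (x / r) ^+ 2 = (r ^+ 2 - x ^+ 2) / r ^+ 2.
        by field; rewrite gt_eqF.
      by rewrite sqrtrM ?ltW// sqrtrV ?sqr_ge0// sqrtr_sqr gtr0_norm.
    have -> : r ^+ 2 * ((g x / r)^-1 * r^-1) = r ^+ 2 / g x.
      by field; rewrite !gt_eqF.
    have -> : r ^+ 2 = g x ^+ 2 + x ^+ 2 by rewrite gx2; ring.
    by field; rewrite gt_eqF.
  have -> : F = (@id R) * g + cst (r ^+ 2) * (fun x => asin (x / r)) by [].
  apply: (is_derive_eq (is_deriveD (is_deriveM (is_derive_id x (1 : R)) dg)
    (is_deriveM (is_derive_cst (r ^+ 2) x (1 : R)) da))).
  by rewrite scaler0 addr0 /GRing.scale/= !mulr1.
have := @measure_between R (- (r * sin u)) (r * sin u) (fun x => - g x) g F _ _ cg _ dF.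
move=> H; apply: (@le_trans _ _ (F (r * sin u) - F (- (r * sin u)))%:E).
  have ge0 : 0 <= g (r * sin u) by rewrite sqrtr_ge0.
  have gN : g (- (r * sin u)) = g (r * sin u) by rewrite /g sqrrN.
  have a1 : asin (r * sin u / r) = u.
    by rewrite mulrAC divff ?gt_eqF// mul1r sinK// in_itv/=; apply/andP; split; lra.
  have a2 : asin (- (r * sin u) / r) = - u.
    rewrite -mulrN mulrAC divff ?gt_eqF// mul1r -sinN sinK// in_itv/=.
    by apply/andP; split; lra.
  rewrite lee_fin /F a1 a2 gN.
  have := mulr_ge0 (ltW rsu0) ge0; lra.
rewrite -H.
- apply: le_measure; rewrite ?inE//.
    have cNg : continuous (fun x => - g x) by move=> x; apply: cvgN; exact: cg.
    exact: (closed_measurable2 (@between_closed _ _ _ _ _ cNg cg)).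
  move=> [x y] /= [/andP[x1 x2] /andP[y1 y2]]; rewrite /disk/=.
  have x0 : 0 <= r ^+ 2 - x ^+ 2 by nra.
  rewrite /dist/= -[leRHS]gtr0_norm// -sqrtr_sqr ler_wsqrtr//.
  have : g x ^+ 2 = r ^+ 2 - x ^+ 2 by rewrite sqr_sqrtr.
  rewrite !sub0r !sqrrN; nra.
- by lra.
- by move=> x; apply: cvgN; exact: cg.
- by move=> x _; have := sqrtr_ge0 (r ^+ 2 - x ^+ 2); rewrite -/(g x); lra.
Qed.

Notation measurable2 A :=
  (measurable (A : set (measurableTypeR _ * measurableTypeR _))).

Lemma le_mu2 (R : realType) (A B : set (R * R)) :
  measurable2 A -> measurable2 B -> A `<=` B -> (mu2 R A <= mu2 R B)%E.
Proof. by move=> mA mB AB; apply: le_measure; rewrite ?inE. Qed.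

Lemma mu2U (R : realType) (A B : set (R * R)) :
  measurable2 A -> measurable2 B -> (mu2 R (A `|` B) <= mu2 R A + mu2 R B)%E.
Proof. exact: measureU2. Qed.

(** * Areas of triangles and trapezoids *)

Definition triangle (R : realType) (a b c : R * R) : set (R * R) :=
  [set x | exists s t, [/\ 0 <= s, 0 <= t, s + t <= 1 &
    x = (a.1 + s * (b.1 - a.1) + t * (c.1 - a.1),
         a.2 + s * (b.2 - a.2) + t * (c.2 - a.2))]].

Lemma triangle_compact (R : realType) (a b c : R * R) :
  compact (triangle a b c).
Proof.
pose D := [set p : R * R | 0 <= p.1 <= 1 - p.2 /\ 0 <= p.2].
pose f (p : R * R) := (a.1 + p.1 * (b.1 - a.1) + p.2 * (c.1 - a.1),
         a.2 + p.1 * (b.2 - a.2) + p.2 * (c.2 - a.2)).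
have -> : triangle a b c = f @` D.
  apply/seteqP; split => [x [s [t [s0 t0 st ->]]]|x [[s t] /= [/andP[s0 st] t0] <-]].
    by exists (s, t) => //=; split => //; rewrite s0 lerBrDr.
  by exists s, t; split => //; rewrite -lerBrDr.
have c1 : continuous (fst : R * R -> R) by move=> z; exact: cvg_fst.
have c2 : continuous (snd : R * R -> R) by move=> z; exact: cvg_snd.
apply: continuous_compact.
  apply: continuous_subspaceT; apply: continuous_pair => p;
    (apply: cvgD; [apply: cvgD; [exact: cvg_cst|]|]); apply: cvgM; try exact: cvg_cst;
    by [exact: c1|exact: c2].
have cD : closed D.
  have -> : D = ([set p | 0 <= p.1] `&` [set p | p.1 <= 1 - p.2]) `&` [set p | 0 <= p.2].
    by apply/seteqP; rewrite /D; split => p /=; [case=> /andP[]|case=> -[-> ->]].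
  apply: closedI; first apply: closedI.
  - by apply: closed_le_fun => // z; exact: cvg_cst.
  - by apply: closed_le_fun => // z; apply: cvgB; [exact: cvg_cst|exact: c2].
  - by apply: closed_le_fun => // z; exact: cvg_cst.
apply: (subclosed_compact cD) (compact_setX (@segment_compact R 0 1) (@segment_compact R 0 1)) _.
by move=> p /= [/andP[? ?] ?]; rewrite !in_itv/=; split; apply/andP; split; lra.
Qed.

Definition trapezoid (R : realType) (p q m h m' h' : R) : set (R * R) :=
  [set z | p <= z.1 <= q /\ m * z.1 + h <= z.2 <= m' * z.1 + h'].

Lemma affine_continuous (R : realType) (m h : R) :
  continuous (fun x : R => m * x + h).
Proof.
by move=> x; apply: cvgD; [apply: cvgM; [exact: cvg_cst|exact: cvg_id]|exact: cvg_cst].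
Qed.

Lemma trapezoid_measurable (R : realType) (p q m h m' h' : R) :
  measurable (trapezoid p q m h m' h' : set (measurableTypeR R * measurableTypeR R)).
Proof.
apply: closed_measurable2.
exact: (@between_closed R p q (fun x => m * x + h) (fun x => m' * x + h')
  (@affine_continuous R m h) (@affine_continuous R m' h')).
Qed.

Lemma trapezoid_measure (R : realType) (p q m h m' h' : R) : p <= q ->
  (forall x, p <= x <= q -> m * x + h <= m' * x + h') ->
  (mu2 R (trapezoid p q m h m' h') <=
   ((m' - m) * (q ^+ 2 - p ^+ 2) / 2 + (h' - h) * (q - p))%:E)%E.
Proof.
rewrite le_eqVlt => /predU1P[<- _|pq mh].
  rewrite !subrr !mulr0 mul0r addr0.
  have sub : trapezoid p p m h m' h' `<=` [set p] `*` `[m * p + h, m' * p + h'].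
    move=> [x y] [/= px yb]; have {}px : x = p by apply/eqP; rewrite eq_le andbC.
    by split => //=; rewrite in_itv/= -px.
  apply: (le_trans (le_mu2 _ _ sub)).
  - exact: trapezoid_measurable.
  - by apply: measurableX => //; exact: measurable_itv.
  by rewrite product_measure1E//= lebesgue_measure_set1 mul0e.
pose F x := (m' - m) * x ^+ 2 / 2 + (h' - h) * x.
have dF x : p <= x <= q -> is_derive x 1 F ((m' * x + h') - (m * x + h)).
  move=> _.
  have -> : F = cst ((m' - m) / 2) * (@id R) ^+ 2 + cst (h' - h) * (@id R).
    apply/funext => y; rewrite /F [RHS]/=.
    change ((m' - m) * y ^+ 2 / 2 + (h' - h) * y = (m' - m) / 2 * y ^+ 2 + (h' - h) * y).
    by field.
  have dM (k : R) (f : R -> R) (df : R) : is_derive x 1 f df ->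
      is_derive x 1 (cst k * f) (k *: df + f x *: 0).
    by move=> df0; exact: (is_deriveM (is_derive_cst k x (1 : R)) df0).
  apply: (is_derive_eq (is_deriveD (dM _ _ _ (is_deriveX 2 (is_derive_id x (1 : R))))
    (dM _ _ _ (is_derive_id x (1 : R))))).
  by rewrite /GRing.scale/= !mulr0 !addr0 expr1 !mulr1; field.
have -> := @measure_between _ p q _ _ F pq (@affine_continuous _ m h) (@affine_continuous _ m' h') mh dF.
by rewrite lee_fin /F le_eqVlt; apply/orP; left; apply/eqP; field.
Qed.

(** The vertical line through the middle vertex [b] cuts the triangle into two pieces, each a
    trapezoid between [ac] and another side; their areas add up to half the cross product. *)
Lemma triangle_sorted (R : realType) (a b c : R * R) :
  a.1 <= b.1 -> b.1 <= c.1 ->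
  (mu2 R (triangle a b c) <= (`|cross (b - a) (c - a)| / 2)%:E)%E.
Proof.
move=> ab bc.
have mT : measurable (triangle a b c : set (measurableTypeR R * measurableTypeR R)).
  by apply: compact_measurable2; exact: triangle_compact.
have cover p q m h m' h' r s k l k' l' (e1 e2 : R) :
    p <= q -> (forall x, p <= x <= q -> m * x + h <= m' * x + h') ->
    r <= s -> (forall x, r <= x <= s -> k * x + l <= k' * x + l') ->
    triangle a b c `<=` trapezoid p q m h m' h' `|` trapezoid r s k l k' l' ->
    (m' - m) * (q ^+ 2 - p ^+ 2) / 2 + (h' - h) * (q - p) +
    ((k' - k) * (s ^+ 2 - r ^+ 2) / 2 + (l' - l) * (s - r)) = `|cross (b - a) (c - a)| / 2 ->
    (mu2 R (triangle a b c) <= (`|cross (b - a) (c - a)| / 2)%:E)%E.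
  move=> pq h1 rs h2 sub <-.
  have m1 := @trapezoid_measurable R p q m h m' h'.
  have m2 := @trapezoid_measurable R r s k l k' l'.
  apply: (le_trans (le_mu2 _ _ sub)) => //.
    exact: measurableU.
  apply: (le_trans (mu2U m1 m2)).
  by rewrite EFinD; apply: leeD; exact: trapezoid_measure.
(* Three vertices on one vertical line: a trapezoid of zero width, taken twice, is a cover. *)
have [ac|ac] := leP c.1 a.1.
  pose lo := Num.min a.2 (Num.min b.2 c.2).
  pose hi := Num.max a.2 (Num.max b.2 c.2).
  have lohi : [/\ lo <= a.2, lo <= b.2, lo <= c.2 & [/\ a.2 <= hi, b.2 <= hi & c.2 <= hi]].
    by rewrite /lo /hi !ge_min !le_max !lexx !orbT.
  apply: (cover a.1 a.1 0 lo 0 hi a.1 a.1 0 lo 0 hi 0 0) => //.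
  - by case: lohi => ? _ _ [? _ _] x _; lra.
  - by case: lohi => ? _ _ [? _ _] x _; lra.
  - move=> _ [s [t [s0 t0 st ->]]]; left; rewrite /trapezoid/= !mul0r !add0r.
    have -> : b.1 = a.1 by lra.
    have -> : c.1 = a.1 by lra.
    rewrite subrr !mulr0 !addr0 lexx; split => //.
    case: lohi => ? ? ? [? ? ?]; apply/andP; split; nra.
  have -> : cross (b - a) (c - a) = 0.
    rewrite /cross/=; have -> : b.1 = a.1 by lra.
    have -> : c.1 = a.1 by lra.
    by ring.
  by rewrite normr0; ring.
(* Slopes of [ac], [ab] and [bc]. A vertical side gets slope 0 from division by zero, but its
   trapezoid has zero width, so [E1] and [E2] hold without strictness. *)
pose m := (c.2 - a.2) / (c.1 - a.1).
pose m1 := (b.2 - a.2) / (b.1 - a.1).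
pose m2 := (c.2 - b.2) / (c.1 - b.1).
have c2 : c.2 = a.2 + m * (c.1 - a.1) by rewrite /m divfK ?subr_eq0 ?gt_eqF//; ring.
have b2 : a.1 < b.1 -> b.2 = a.2 + m1 * (b.1 - a.1).
  by move=> ab'; rewrite /m1 divfK ?subr_eq0 ?gt_eqF//; ring.
have b2' : b.1 < c.1 -> b.2 = c.2 - m2 * (c.1 - b.1).
  by move=> ab'; rewrite /m2 divfK ?subr_eq0 ?gt_eqF//; ring.
have crossE : cross (b - a) (c - a) = - (c.1 - a.1) * (b.2 - (a.2 + m * (b.1 - a.1))).
  by rewrite /cross/= c2; ring.
(* The signed height of [b] above the line [ac]; its sign decides whether [ac] bounds the trapezoids
   from below or from above. *)
set D := b.2 - (a.2 + m * (b.1 - a.1)) in crossE.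
have D1 : a.1 < b.1 -> D = (m1 - m) * (b.1 - a.1).
  by move=> /b2 b2E; rewrite /D b2E; ring.
have D2 : b.1 < c.1 -> D = (m - m2) * (c.1 - b.1).
  by move=> /b2' b2E; rewrite /D b2E c2; ring.
have E1 : (m1 - m) * (b.1 - a.1) ^+ 2 = D * (b.1 - a.1).
  case: (ltP a.1 b.1) => [/D1 ->|ba]; first by ring.
  have -> : b.1 = a.1 by lra.
  by ring.
have E2 : (m - m2) * (c.1 - b.1) ^+ 2 = D * (c.1 - b.1).
  case: (ltP b.1 c.1) => [/D2 ->|ba]; first by ring.
  have -> : b.1 = c.1 by lra.
  by ring.
have in12 s t : 0 <= s -> 0 <= t -> s + t <= 1 ->
    a.1 <= a.1 + s * (b.1 - a.1) + t * (c.1 - a.1) <= c.1.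
  by move=> s0 t0 st; apply/andP; split; nra.
have ca0 : 0 < c.1 - a.1 by rewrite subr_gt0.
have [D0|D0] := leP 0 D.
- have m1m : a.1 < b.1 -> m <= m1.
    by move=> ab'; rewrite -subr_ge0 -(pmulr_lge0 _ (_ : 0 < b.1 - a.1)) ?subr_gt0// -D1.
  have m2m : b.1 < c.1 -> m2 <= m.
    by move=> ab'; rewrite -subr_ge0 -(pmulr_lge0 _ (_ : 0 < c.1 - b.1)) ?subr_gt0// -D2.
  apply: (cover a.1 b.1 m (a.2 - m * a.1) m1 (a.2 - m1 * a.1)
            b.1 c.1 m (a.2 - m * a.1) m2 (c.2 - m2 * c.1) 0 0) => //.
  + move=> x /andP[x1 x2]; case: (ltP a.1 b.1) => [/m1m|ba]; first by nra.
    have -> : x = a.1 by lra.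
    by lra.
  + move=> x /andP[x1 x2]; case: (ltP b.1 c.1) => [/m2m|ba]; first by rewrite c2; nra.
    have -> : x = c.1 by lra.
    by rewrite c2; lra.
  + move=> _ [s [t [s0 t0 st ->]]]; have /andP[x1 x2] := in12 _ _ s0 t0 st.
    have sD := mulr_ge0 s0 D0; rewrite {}/D in D0 D1 D2 E1 E2 crossE sD *.
    clear cover D0 D1 D2 E1 E2 crossE in12.
    have [ab'|ab'] := boolP ((a.1 < b.1) && (a.1 + s * (b.1 - a.1) + t * (c.1 - a.1) <= b.1)).
      have {ab'} /andP[ab' xb] := ab'; left; rewrite /trapezoid/=; split; rewrite ?x1//.
      have tm : 0 <= t * ((m1 - m) * (c.1 - a.1)).
        by rewrite mulr_ge0// mulr_ge0 ?(ltW ca0)// subr_ge0 m1m.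
      by apply/andP; split; [rewrite c2 in sD *|rewrite c2 b2//]; lra.
    right; rewrite /trapezoid/= x2 andbT.
    have bx : b.1 <= a.1 + s * (b.1 - a.1) + t * (c.1 - a.1).
      by move: ab'; rewrite negb_and -leNgt -ltNge => /orP[|/ltW//]; lra.
    have bc' : b.1 < c.1.
      move: ab'; rewrite negb_and -leNgt -ltNge => /orP[|]; lra.
    have tm : 0 <= (1 - s - t) * ((m - m2) * (c.1 - a.1)).
      by rewrite mulr_ge0// ?mulr_ge0 ?(ltW ca0)// ?subr_ge0 ?m2m//; lra.
    split => //; apply/andP; split; first by rewrite c2 in sD *; lra.
    by move: tm; rewrite (b2' bc'); rewrite c2; lra.
  rewrite crossE normrM normrN (gtr0_norm ca0) (ger0_norm D0).
  have -> : (c.1 - a.1) * D = D * (b.1 - a.1) + D * (c.1 - b.1) by ring.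
  by rewrite -E1 -E2 c2; field.
have m1m : a.1 < b.1 -> m1 <= m.
  move=> ab'; rewrite -subr_ge0 -(pmulr_lge0 _ (_ : 0 < b.1 - a.1)) ?subr_gt0//.
  by rewrite -opprB mulNr -D1// oppr_ge0 ltW.
have m2m : b.1 < c.1 -> m <= m2.
  move=> ab'; rewrite -subr_ge0 -(pmulr_lge0 _ (_ : 0 < c.1 - b.1)) ?subr_gt0//.
  by rewrite -opprB mulNr -D2// oppr_ge0 ltW.
apply: (cover a.1 b.1 m1 (a.2 - m1 * a.1) m (a.2 - m * a.1)
          b.1 c.1 m2 (c.2 - m2 * c.1) m (a.2 - m * a.1) 0 0) => //.
- move=> x /andP[x1 x2]; case: (ltP a.1 b.1) => [/m1m|ba]; first by nra.
  have -> : x = a.1 by lra.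
  by lra.
- move=> x /andP[x1 x2]; case: (ltP b.1 c.1) => [/m2m|ba]; first by rewrite c2; nra.
  have -> : x = c.1 by lra.
  by rewrite c2; lra.
- move=> _ [s [t [s0 t0 st ->]]]; have /andP[x1 x2] := in12 _ _ s0 t0 st.
  have sD : 0 <= s * - D by rewrite mulr_ge0// oppr_ge0 ltW.
  rewrite {}/D in D0 D1 D2 E1 E2 crossE sD *; clear cover D0 D1 D2 E1 E2 crossE in12.
  have [ab'|ab'] := boolP ((a.1 < b.1) && (a.1 + s * (b.1 - a.1) + t * (c.1 - a.1) <= b.1)).
    have {ab'} /andP[ab' xb] := ab'; left; rewrite /trapezoid/=; split; rewrite ?x1//.
    have tm : 0 <= t * ((m - m1) * (c.1 - a.1)).
      by rewrite mulr_ge0// mulr_ge0 ?(ltW ca0)// subr_ge0 m1m.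
    by apply/andP; split; [rewrite c2 b2//|rewrite c2 in sD *]; lra.
  right; rewrite /trapezoid/= x2 andbT.
  have bx : b.1 <= a.1 + s * (b.1 - a.1) + t * (c.1 - a.1).
    by move: ab'; rewrite negb_and -leNgt -ltNge => /orP[|/ltW//]; lra.
  have bc' : b.1 < c.1.
    move: ab'; rewrite negb_and -leNgt -ltNge => /orP[|]; lra.
  have tm : 0 <= (1 - s - t) * ((m2 - m) * (c.1 - a.1)).
    by rewrite mulr_ge0// ?mulr_ge0 ?(ltW ca0)// ?subr_ge0 ?m2m//; lra.
  split => //; apply/andP; split; last by rewrite c2 in sD *; lra.
  by move: tm; rewrite (b2' bc'); rewrite c2; lra.
rewrite crossE normrM normrN (gtr0_norm ca0) (ltr0_norm D0).
have -> : (c.1 - a.1) * - D = - (D * (b.1 - a.1)) - D * (c.1 - b.1) by ring.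
by rewrite -E1 -E2 c2; field.
Qed.

Lemma triangleC (R : realType) (a b c : R * R) : triangle a b c = triangle a c b.
Proof.
by apply/seteqP; split => x [s [t [s0 t0 st ->]]]; exists t, s; split;
  rewrite // ?[t + s]addrC//; congr pair; ring.
Qed.

Lemma triangleCA (R : realType) (a b c : R * R) : triangle a b c = triangle b a c.
Proof.
by apply/seteqP; split => x [s [t [s0 t0 st ->]]]; exists (1 - s - t), t;
  (split; rewrite //; [lra|lra|congr pair; ring]).
Qed.

Lemma triangle_measure (R : realType) (a b c : R * R) :
  (mu2 R (triangle a b c) <= (`|cross (b - a) (c - a)| / 2)%:E)%E.
Proof.
have crossC (u v w : R * R) : `|cross (w - u) (v - u)| = `|cross (v - u) (w - u)|.
  by rewrite -normrN; congr `|_|; rewrite /cross/=; ring.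
have crossCA (u v w : R * R) : `|cross (u - v) (w - v)| = `|cross (v - u) (w - u)|.
  by rewrite -normrN; congr `|_|; rewrite /cross/=; ring.
have [ab|/ltW ab] := leP a.1 b.1; have [bc|/ltW bc] := leP b.1 c.1.
- exact: triangle_sorted.
- have [ac|/ltW ac] := leP a.1 c.1.
    by rewrite triangleC -crossC; exact: triangle_sorted.
  by rewrite triangleC -crossC triangleCA -crossCA; exact: triangle_sorted.
- have [ac|/ltW ac] := leP a.1 c.1.
    by rewrite triangleCA -crossCA; exact: triangle_sorted.
  by rewrite triangleCA -crossCA triangleC -crossC; exact: triangle_sorted.
- rewrite triangleC -crossC triangleCA -crossCA triangleC -crossC.
  exact: triangle_sorted.
Qed.

(** * Euclidean distance *)

Section Dist.
Variable R : realType.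
Implicit Types x y z u w : R * R.

Lemma le_of_sqr (a b : R) : 0 <= b -> a ^+ 2 <= b ^+ 2 -> a <= b.
Proof.
by move=> b0 ab; rewrite leNgt; apply/negP => ba; nra.
Qed.

Lemma dist_sqr x y : dist x y ^+ 2 = (x.1 - y.1) ^+ 2 + (x.2 - y.2) ^+ 2.
Proof. by rewrite sqr_sqrtr// addr_ge0 ?sqr_ge0. Qed.

Lemma dist_ge0 x y : 0 <= dist x y.
Proof. exact: sqrtr_ge0. Qed.

Lemma distC x y : dist x y = dist y x.
Proof. by rewrite /dist -(opprB y.1) -(opprB y.2) !sqrrN. Qed.

Lemma distxx x : dist x x = 0.
Proof. by rewrite /dist !subrr !expr0n/= addr0 sqrtr0. Qed.

Lemma dist_le x y (r : R) : 0 <= r ->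
  (dist x y <= r) = ((x.1 - y.1) ^+ 2 + (x.2 - y.2) ^+ 2 <= r ^+ 2).
Proof.
move=> r0; rewrite -dist_sqr.
by apply/idP/idP; rewrite ler_sqr ?nnegrE ?dist_ge0.
Qed.

Lemma eq_dist x y (r : R) : 0 <= r ->
  (x.1 - y.1) ^+ 2 + (x.2 - y.2) ^+ 2 = r ^+ 2 -> dist x y = r.
Proof. by move=> r0; rewrite /dist => ->; rewrite sqrtr_sqr ger0_norm. Qed.

Lemma dist_eq0 x y : dist x y = 0 -> x = y.
Proof.
move=> xy; have := dist_sqr x y; rewrite xy expr0n/=; case: x y {xy} => a b [c d] /= h.
move/esym/eqP: h; rewrite paddr_eq0 ?sqr_ge0// !sqrf_eq0 !subr_eq0.
by case/andP=> /eqP -> /eqP ->.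
Qed.

Lemma dist_triangle y x z : dist x z <= dist x y + dist y z.
Proof.
rewrite dist_le ?addr_ge0 ?dist_ge0//.
have := dist_sqr x y; have := dist_sqr y z.
have := dist_ge0 x y; have := dist_ge0 y z.
set d := dist x y; set e := dist y z => e0 d0 eE dE.
have h : (x.1 - y.1) * (y.1 - z.1) + (x.2 - y.2) * (y.2 - z.2) <= d * e.
  apply: le_of_sqr; first by rewrite mulr_ge0.
  rewrite exprMn dE eE.
  have := sqr_ge0 ((x.1 - y.1) * (y.2 - z.2) - (x.2 - y.2) * (y.1 - z.1)); lra.
have -> : (d + e) ^+ 2 = d ^+ 2 + e ^+ 2 + 2 * (d * e) by ring.
by rewrite dE eE; lra.
Qed.

Lemma cross_le_dist x y z : `|cross (y - x) (z - y)| <= dist x y * dist y z.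
Proof.
rewrite -ler_sqr ?nnegrE ?mulr_ge0 ?dist_ge0// exprMn !dist_sqr real_normK ?num_real//.
rewrite /cross/=.
have := sqr_ge0 ((x.1 - y.1) * (y.1 - z.1) + (x.2 - y.2) * (y.2 - z.2)); lra.
Qed.

(* Makes two consecutive sides of a closed polygon equal without changing its
   length or decreasing its area. *)
Lemma isosceles_apex (p v q : R * R) : exists v',
  [/\ dist p v' = (dist p v + dist v q) / 2,
      dist v' q = (dist p v + dist v q) / 2 &
      cross p v + cross v q <= cross p v' + cross v' q].
Proof.
set b := dist p q.
have [b0|b0] : b = 0 \/ 0 < b.
- have := dist_ge0 p q; rewrite le_eqVlt => /orP[/eqP/esym|]; by [left|right].
- by have pq := dist_eq0 b0; exists v; rewrite pq (distC q v); split => //; field.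
have bs := dist_triangle v p q; rewrite -/b in bs.
have := dist_sqr p q; rewrite -/b => bE.
have := dist_sqr p v; have := dist_sqr v q.
have := dist_ge0 p v; have := dist_ge0 v q.
move: (dist p v) (dist v q) bs => d e bs e0 d0 eE dE.
set s := d + e in bs *.
have sb : 0 <= s ^+ 2 - b ^+ 2 by nra.
(* Height of the isosceles triangle with base [b] and legs [s / 2]. The new apex is put on the side
   of [pq] where the triangle counts positively, whatever the side of [v]. *)
pose h := Num.sqrt (s ^+ 2 - b ^+ 2) / 2.
have h0 : 0 <= h by rewrite divr_ge0// sqrtr_ge0.
have h2 : h ^+ 2 = (s ^+ 2 - b ^+ 2) / 4 by rewrite exprMn sqr_sqrtr//; field.
have hb2 : (h * b) ^+ 2 = h ^+ 2 * b ^+ 2 by rewrite exprMn.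
pose v' := ((p.1 + q.1) / 2 + h * (q.2 - p.2) / b,
            (p.2 + q.2) / 2 - h * (q.1 - p.1) / b).
exists v'; rewrite {}/v'.
have bn0 : b != 0 by rewrite gt_eqF.
have s0 : 0 <= s / 2 by rewrite divr_ge0// addr_ge0.
have nE : (q.1 - p.1) ^+ 2 + (q.2 - p.2) ^+ 2 = b ^+ 2 by rewrite bE; ring.
have sE : (h ^+ 2 * b ^+ 2 / b ^+ 2) + b ^+ 2 / 4 = (s / 2) ^+ 2.
  by rewrite h2; field.
split.
- apply: eq_dist => //=; by rewrite -sE -{1 3}nE; field.
- apply: eq_dist => //=; by rewrite -sE -{1 3}nE; field.
rewrite /cross/=.
pose k := (v.1 - p.1) * (q.2 - p.2) - (v.2 - p.2) * (q.1 - p.1).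
suff kh : k <= h * b.
  have -> : h * (q.2 - p.2) / b = h * b * ((q.2 - p.2) / b ^+ 2) by field.
  have -> : h * (q.1 - p.1) / b = h * b * ((q.1 - p.1) / b ^+ 2) by field.
  have nE' : (q.1 - p.1) * ((q.1 - p.1) / b ^+ 2) + (q.2 - p.2) * ((q.2 - p.2) / b ^+ 2) = 1.
    have -> : (q.1 - p.1) * ((q.1 - p.1) / b ^+ 2) + (q.2 - p.2) * ((q.2 - p.2) / b ^+ 2)
      = ((q.1 - p.1) ^+ 2 + (q.2 - p.2) ^+ 2) / b ^+ 2 by field.
    by rewrite nE divff// expf_neq0.
  rewrite -subr_ge0.
  set X := (q.1 - p.1) / b ^+ 2 in nE' *; set Y := (q.2 - p.2) / b ^+ 2 in nE' *.
  set hb := h * b in kh *.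
  have -> : p.1 * ((p.2 + q.2) / 2 - hb * X) - p.2 * ((p.1 + q.1) / 2 + hb * Y)
    + (((p.1 + q.1) / 2 + hb * Y) * q.2 - ((p.2 + q.2) / 2 - hb * X) * q.1)
    - (p.1 * v.2 - p.2 * v.1 + (v.1 * q.2 - v.2 * q.1))
    = hb * ((q.1 - p.1) * X + (q.2 - p.2) * Y) - k by rewrite /k; field.
  by rewrite nE' mulr1 subr_ge0.
apply: le_of_sqr; first by rewrite mulr_ge0// ltW.
rewrite hb2 h2.
(* [k] and [l] are [b] times the coordinates of [v] across and along [pq], measured from its
   midpoint. [E1] and [E2] are Pythagoras; [E3] rests on
   [(k^2 - A B)^2 <= (k^2 + A^2) (k^2 + B^2)]. *)
pose l := (v.1 - (p.1 + q.1) / 2) * (q.1 - p.1) + (v.2 - (p.2 + q.2) / 2) * (q.2 - p.2).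
have E1 : b ^+ 2 * d ^+ 2 = k ^+ 2 + (l + b ^+ 2 / 2) ^+ 2.
  by rewrite dE -nE /k /l; field.
have E2 : b ^+ 2 * e ^+ 2 = k ^+ 2 + (l - b ^+ 2 / 2) ^+ 2.
  by rewrite eE -nE /k /l; field.
have E3 : k ^+ 2 - (l + b ^+ 2 / 2) * (l - b ^+ 2 / 2) <= b ^+ 2 * (d * e).
  apply: le_of_sqr; first by apply: mulr_ge0; [exact: sqr_ge0|exact: mulr_ge0].
  have -> : (b ^+ 2 * (d * e)) ^+ 2 = (b ^+ 2 * d ^+ 2) * (b ^+ 2 * e ^+ 2) by ring.
  rewrite E1 E2.
  have := sqr_ge0 (k * ((l + b ^+ 2 / 2) + (l - b ^+ 2 / 2))); lra.
have -> : (s ^+ 2 - b ^+ 2) / 4 * b ^+ 2 =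
   (b ^+ 2 * d ^+ 2 + b ^+ 2 * e ^+ 2 + 2 * (b ^+ 2 * (d * e)) - b ^+ 2 * b ^+ 2) / 4.
  by rewrite /s; field.
rewrite E1 E2; lra.
Qed.

End Dist.

(* q = sqrt 5 and t = tan (pi / 5).  The left-hand side is a circulant quadratic
   form, which the discrete Fourier transform diagonalizes: its eigenvalues are
   0, 0, 5 - q, 2 * q and 5 - q. *)
Lemma wirtinger5 (R : realFieldType) (q t : R) (x0 x1 x2 x3 x4 y0 y1 y2 y3 y4 : R) :
  0 < q -> q ^+ 2 = 5 -> t ^+ 2 = 5 - 2 * q ->
  2 * t * ((x0 * y1 - y0 * x1) + (x1 * y2 - y1 * x2) + (x2 * y3 - y2 * x3)
    + (x3 * y4 - y3 * x4) + (x4 * y0 - y4 * x0)) <=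
  ((x0 - x1) ^+ 2 + (y0 - y1) ^+ 2) + ((x1 - x2) ^+ 2 + (y1 - y2) ^+ 2)
  + ((x2 - x3) ^+ 2 + (y2 - y3) ^+ 2) + ((x3 - x4) ^+ 2 + (y3 - y4) ^+ 2)
  + ((x4 - x0) ^+ 2 + (y4 - y0) ^+ 2).
Proof.
move=> q0 q2 t2.
(* Cosines and sines of [2 pi / 5] and [4 pi / 5]. The pairs below are real and imaginary parts of
   the Fourier coefficients of [x_j + i y_j] at frequencies 2, 3 and 4; frequencies 0 and 1, the
   translations and the regular pentagons, span the kernel. *)
pose c1 := (q - 1) / 4; pose c2 := - (q + 1) / 4.
pose s1 := t * (3 + q) / 4; pose s2 := t * (1 + q) / 4.
pose re2 := x0 + c2 * (x1 + x4) + s2 * (y1 - y4) + c1 * (x2 + x3) + s1 * (y3 - y2).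
pose im2 := y0 + c2 * (y1 + y4) - s2 * (x1 - x4) + c1 * (y2 + y3) - s1 * (x3 - x2).
pose re3 := x0 + c2 * (x1 + x4) - s2 * (y1 - y4) + c1 * (x2 + x3) - s1 * (y3 - y2).
pose im3 := y0 + c2 * (y1 + y4) + s2 * (x1 - x4) + c1 * (y2 + y3) + s1 * (x3 - x2).
pose re4 := x0 + c1 * (x1 + x4) - s1 * (y1 - y4) + c2 * (x2 + x3) - s2 * (y2 - y3).
pose im4 := y0 + c1 * (y1 + y4) + s1 * (x1 - x4) + c2 * (y2 + y3) + s2 * (x2 - x3).
have q5 : 0 <= 5 - q by nra.
rewrite -subr_ge0 -(pmulr_rge0 _ (_ : 0 < 5))//.
set S := (X in 0 <= X).
have -> : S = (5 - q) * (re2 ^+ 2 + im2 ^+ 2) + 2 * q * (re3 ^+ 2 + im3 ^+ 2)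
   + (5 - q) * (re4 ^+ 2 + im4 ^+ 2).
  rewrite /S /re2 /im2 /re3 /im3 /re4 /im4 /c1 /c2 /s1 /s2.
  by field: q2 t2.
have sq (x y : R) : 0 <= x ^+ 2 + y ^+ 2 by rewrite addr_ge0 ?sqr_ge0.
by apply: addr_ge0; [apply: addr_ge0|]; apply: mulr_ge0; rewrite ?sq// mulr_ge0// ltW.
Qed.

(** * The isoperimetric inequality for closed pentagons *)

Section Ord5.

Lemma ord5P (P : 'I_5 -> Prop) :
  P ord0 -> (forall i, P i -> P (ordS i)) -> forall i, P i.
Proof.
move=> P0 PS.
have step n (h : (n < 5)%N) (h' : (n.+1 < 5)%N) : P (Ordinal h) -> P (Ordinal h').
  by move=> /PS; congr P; apply: val_inj; rewrite /= modn_small.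
case=> n h; elim: n h => [|n IH] h; first by have -> : Ordinal h = ord0 by exact: val_inj.
exact: (step n (ltnW h)).
Qed.

Lemma ordS5 (i : 'I_5) : ordS (ordS (ordS (ordS (ordS i)))) = i.
Proof. by apply: val_inj; case: i => -[|[|[|[|[|//]]]]]. Qed.

Lemma ordS_neq (i : 'I_5) :
  [/\ (i == ordS i) = false, (i == ordS (ordS i)) = false,
      (i == ordS (ordS (ordS i))) = false &
      (i == ordS (ordS (ordS (ordS i)))) = false].
Proof. by case: i => -[|[|[|[|[|//]]]]]. Qed.

Lemma big_ordS5 (V : nmodType) (F : 'I_5 -> V) (i : 'I_5) :
  \sum_j F j = F i + F (ordS i) + F (ordS (ordS i)) + F (ordS (ordS (ordS i)))
    + F (ordS (ordS (ordS (ordS i)))).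
Proof.
elim/ord5P: i => [|i ->].
  rewrite !big_ord_recl big_ord0 addr0 !addrA.
  by do !congr (_ + _); congr F; apply: val_inj.
by rewrite ordS5 [in RHS]addrC !addrA.
Qed.

Lemma ordS5_cases (i j : 'I_5) :
  j = i \/ [\/ j = ordS i, j = ordS (ordS i), j = ordS (ordS (ordS i)) |
      j = ordS (ordS (ordS (ordS i)))].
Proof.
have : [|| j == i, j == ordS i, j == ordS (ordS i), j == ordS (ordS (ordS i)) |
      j == ordS (ordS (ordS (ordS i)))].
  by case: i => -[|[|[|[|[|//]]]]] h; case: j => -[|[|[|[|[|//]]]]].
case/or4P => [/eqP|/eqP|/eqP|/orP[/eqP|/eqP]]; first by left.
all: by right; first [exact: Or41|exact: Or42|exact: Or43|exact: Or44].
Qed.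

End Ord5.

Section ClosedPolygons.
Variable R : realType.
Implicit Types v w : 'I_5 -> R * R.

Definition closed_length v := \sum_i dist (v i) (v (ordS i)).

(** The shoelace formula, a signed quantity that makes sense for self-crossing polygons too. *)
Definition double_area v := \sum_i cross (v i) (v (ordS i)).

(** Strictly convex in the side lengths, unlike their sum: at fixed length it singles out equal
    sides. *)
Definition edges_energy v := \sum_i dist (v i) (v (ordS i)) ^+ 2.

Lemma double_area_translate v (c : R * R) :
  double_area (fun i => v i - c) = double_area v.
Proof.
rewrite /double_area !(big_ordS5 _ ord0) !ordS5 /cross /=; ring.
Qed.

Lemma dist_translate (x y c : R * R) : dist (x - c) (y - c) = dist x y.
Proof. by rewrite /dist /=; congr Num.sqrt; ring. Qed.

Lemma dist_le_closed_length v i j : dist (v i) (v j) <= closed_length v.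
Proof.
rewrite /closed_length (big_ordS5 _ i) !ordS5.
have d0 x y := @dist_ge0 R x y.
have t1 := dist_triangle (v (ordS i)) (v i) (v (ordS (ordS i))).
have t2 := dist_triangle (v (ordS (ordS i))) (v i) (v (ordS (ordS (ordS i)))).
have a1 := d0 (v i) (v (ordS i)).
have a2 := d0 (v (ordS i)) (v (ordS (ordS i))).
have a3 := d0 (v (ordS (ordS i))) (v (ordS (ordS (ordS i)))).
have a4 := d0 (v (ordS (ordS (ordS i)))) (v (ordS (ordS (ordS (ordS i))))).
have a5 := d0 (v (ordS (ordS (ordS (ordS i))))) (v i).
have [->|[->|->|->|->]] := ordS5_cases i j; rewrite ?distxx; try lra.
rewrite distC; lra.
Qed.

Let W := prod_topology (fun _ : 'I_5 => (R * R)%type).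

Lemma proj5_continuous i : continuous (fun w : W => w i).
Proof. exact: proj_continuous. Qed.

Lemma coord_continuous i :
  continuous (fun w : W => (w i).1) /\ continuous (fun w : W => (w i).2).
Proof.
by split => w; apply: continuous_comp; try exact: proj5_continuous;
  [exact: cvg_fst|exact: cvg_snd].
Qed.

Lemma edge_continuous i j : continuous (fun w : W => dist (w i) (w j)).
Proof.
have [i1 i2] := coord_continuous i; have [j1 j2] := coord_continuous j.
exact: continuous_dist.
Qed.

Lemma sum5_continuous (F : 'I_5 -> W -> R) :
  (forall i, continuous (F i)) -> continuous (fun w : W => \sum_i F i w).
Proof.
move=> cF; have -> : (fun w : W => \sum_i F i w) =
    (fun w : W => F ord0 w + F (ordS ord0) w + F (ordS (ordS ord0)) w
       + F (ordS (ordS (ordS ord0))) w + F (ordS (ordS (ordS (ordS ord0)))) w).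
  by apply/funext => w; rewrite (big_ordS5 _ ord0).
by do 4 (apply: continuous_add; last exact: cF); exact: cF.
Qed.

Lemma closed_length_continuous : continuous (closed_length : W -> R).
Proof.
apply: (@sum5_continuous (fun i w => dist (w i) (w (ordS i)))) => i.
exact: edge_continuous.
Qed.

Lemma double_area_continuous : continuous (double_area : W -> R).
Proof.
apply: (@sum5_continuous (fun i w => cross (w i) (w (ordS i)))) => i.
have [i1 i2] := coord_continuous i; have [j1 j2] := coord_continuous (ordS i).
exact: (continuous_sub (continuous_mul i1 j2) (continuous_mul i2 j1)).
Qed.

Lemma edges_energy_continuous : continuous (edges_energy : W -> R).
Proof.
apply: (@sum5_continuous (fun i w => dist (w i) (w (ordS i)) ^+ 2)) => i.
have e := @edge_continuous i (ordS i); exact: (continuous_mul e e).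
Qed.

(** Pinning one vertex removes the translations, and a bounded length then keeps all vertices in a
    box. The product topology of [W] makes Tychonoff's theorem applicable. *)
Lemma normalized_compact (l a : R) :
  compact [set w : W | [/\ closed_length w <= l, a <= double_area w & w ord0 = 0]].
Proof.
set K := [set w : W | _].
have cK : closed K.
  have [c1 c2] := coord_continuous ord0.
  have -> : K = ([set w : W | closed_length w <= l] `&` [set w : W | a <= double_area w])
    `&` (([set w : W | (w ord0).1 <= 0] `&` [set w : W | 0 <= (w ord0).1]) `&`
         ([set w : W | (w ord0).2 <= 0] `&` [set w : W | 0 <= (w ord0).2])).
    apply/seteqP; rewrite /K; split => w /=; first by case=> -> -> ->; rewrite !lexx.
    move=> [[-> ->] [[h1 h2] [h3 h4]]]; split => //.
    by apply: injective_projections; apply/le_anti/andP.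
  apply: closedI; apply: closedI.
  - exact: (@closed_le_fun R W _ _ closed_length_continuous (@continuous_cst R W l)).
  - exact: (@closed_le_fun R W _ _ (@continuous_cst R W a) double_area_continuous).
  - apply: closedI; first exact: (@closed_le_fun R W _ _ c1 (@continuous_cst R W 0)).
    exact: (@closed_le_fun R W _ _ (@continuous_cst R W 0) c1).
  - apply: closedI; first exact: (@closed_le_fun R W _ _ c2 (@continuous_cst R W 0)).
    exact: (@closed_le_fun R W _ _ (@continuous_cst R W 0) c2).
pose B := `[- l, l]%classic `*` `[- l, l]%classic : set (R * R).
have cB : compact B.
  exact: (compact_setX (@segment_compact R (- l) l) (@segment_compact R (- l) l)).
apply: (subclosed_compact cK (tychonoff (fun _ : 'I_5 => cB))).
move=> w [Ll _ w0] i.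
have := le_trans (dist_le_closed_length w ord0 i) Ll.
have l0 : 0 <= l.
  by apply: le_trans Ll; apply: sumr_ge0 => j _; exact: dist_ge0.
rewrite dist_le// w0 /= !sub0r !sqrrN => h.
by split => /=; rewrite in_itv/=; apply/andP; split; nra.
Qed.

(** The regular pentagon attains the constant [10 t]. As the area is signed and the polygon may
    cross itself, a single vertex can be replaced without any restriction. *)
Lemma isoperimetric5 (q t : R) v :
  0 < q -> q ^+ 2 = 5 -> 0 < t -> t ^+ 2 = 5 - 2 * q ->
  10 * t * double_area v <= closed_length v ^+ 2.
Proof.
move=> q0 q2 t0 t2.
have cK := @normalized_compact (closed_length v) (double_area v).
set K := [set w : W | _] in cK.
have trK w : closed_length w <= closed_length v -> double_area v <= double_area w ->
    K (fun i => w i - w ord0).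
  move=> Lw Aw; split; rewrite ?double_area_translate ?subrr//.
  by rewrite (le_trans _ Lw)// le_eqVlt; apply/orP; left; apply/eqP;
    apply: eq_bigr => i _; exact: dist_translate.
have [|u uK umin] := compact_EVT_min (_ : K !=set0) cK (continuous_subspaceT edges_energy_continuous).
  by exists (fun i => v i - v ord0); exact: trK.
have [Lu Au _] : K u by rewrite inE in uK.
(* Otherwise an isosceles apex would decrease the energy. *)
have equi i : dist (u i) (u (ordS i)) = dist (u (ordS i)) (u (ordS (ordS i))).
  have [v' [d1 d2 cr]] := isosceles_apex (u i) (u (ordS i)) (u (ordS (ordS i))).
  pose w j := if j == ordS i then v' else u j.
  have [n1 n2 n3 n4] := ordS_neq i.
  have [m1 m2 m3 m4] := ordS_neq (ordS i).
  have wE : [/\ w i = u i, w (ordS i) = v', w (ordS (ordS i)) = u (ordS (ordS i)),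
     w (ordS (ordS (ordS i))) = u (ordS (ordS (ordS i))) &
     w (ordS (ordS (ordS (ordS i)))) = u (ordS (ordS (ordS (ordS i))))].
    by rewrite /w n1 eqxx eq_sym m1 eq_sym m2 eq_sym m3.
  have [w0 w1 w2 w3 w4] := wE.
  have Lw : closed_length w = closed_length u.
    by rewrite /closed_length !(big_ordS5 _ i) !ordS5 w0 w1 w2 w3 w4 d1 d2; field.
  have Aw : double_area u <= double_area w.
    rewrite /double_area !(big_ordS5 _ i) !ordS5 w0 w1 w2 w3 w4; lra.
  have Kw : K (fun i => w i - w ord0) by apply: trK; [rewrite Lw|exact: le_trans Aw].
  have := umin _ (mem_set Kw).
  have -> : edges_energy (fun i => w i - w ord0) = edges_energy w.
    by apply: eq_bigr => j _; rewrite dist_translate.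
  rewrite /edges_energy !(big_ordS5 _ i) !ordS5 w0 w1 w2 w3 w4 d1 d2.
  move: (dist (u i) _) (dist (u (ordS i)) _) => a b h.
  (* Minimality of the energy says [a^2 + b^2 <= (a + b)^2 / 2], that is [a = b]. *)
  apply/eqP; rewrite -subr_eq0 -sqrf_eq0 eq_le sqr_ge0 andbT; lra.
have := @wirtinger5 R q t (u ord0).1 (u (ordS ord0)).1 (u (ordS (ordS ord0))).1
  (u (ordS (ordS (ordS ord0)))).1 (u (ordS (ordS (ordS (ordS ord0))))).1
  (u ord0).2 (u (ordS ord0)).2 (u (ordS (ordS ord0))).2
  (u (ordS (ordS (ordS ord0)))).2 (u (ordS (ordS (ordS (ordS ord0))))).2 q0 q2 t2.
rewrite -!dist_sqr.
have A5 : double_area u = \sum_i cross (u i) (u (ordS i)) by [].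
rewrite (big_ordS5 _ ord0) !ordS5 /cross in A5; rewrite -A5.
have L5 : closed_length u = \sum_i dist (u i) (u (ordS i)) by [].
rewrite (big_ordS5 _ ord0) !ordS5 in L5.
have e0 := equi ord0; have e1 := equi (ordS ord0); have e2 := equi (ordS (ordS ord0)).
have e3 := equi (ordS (ordS (ordS ord0))); rewrite ordS5 in e3.
rewrite -e3 -e2 -e1 -e0 in L5 *.
have d0 := dist_ge0 (u ord0) (u (ordS ord0)).
move: (dist _ _) L5 d0 => d L5 d0 h.
have : closed_length u ^+ 2 <= closed_length v ^+ 2.
  by rewrite ler_sqr ?nnegrE// ?(le_trans _ Lu)// L5; lra.
(* For equal sides the squared length is five times the energy; this turns the inequality for the
   energy into one for the length. *)
have -> : closed_length u ^+ 2 = 5 * (d ^+ 2 + d ^+ 2 + d ^+ 2 + d ^+ 2 + d ^+ 2).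
  by rewrite L5; ring.
have : t * double_area v <= t * double_area u by rewrite ler_pM2l.
lra.
Qed.

End ClosedPolygons.

(** * Regions and convex hulls of vertices *)

Section Segments.
Variable R : realType.
Implicit Types (a b x y z : R * R) (K : set (R * R)).

Definition comb a b (t : R) : R * R :=
  ((1 - t) * a.1 + t * b.1, (1 - t) * a.2 + t * b.2).

Lemma segmentP a b x :
  segment a b x <-> exists2 t, 0 <= t <= 1 & x = comb a b t.
Proof.
split=> [[t /= + <-]|[t t01 ->]]; first by rewrite in_itv/=; exists t.
by exists t => //=; rewrite in_itv/=.
Qed.

Lemma comb0 a b : comb a b 0 = a.
Proof. by apply: injective_projections; rewrite /comb/=; ring. Qed.

Lemma comb1 a b : comb a b 1 = b.
Proof. by apply: injective_projections; rewrite /comb/=; ring. Qed.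

Lemma comb_continuous a b : continuous (comb a b).
Proof.
have i : continuous (fun t : R => t) by move=> t; exact: cvg_id.
have c k := @continuous_cst R R k.
by apply: continuous_pair; apply: continuous_add; apply: continuous_mul => //;
  apply: continuous_sub.
Qed.

Lemma segmentl a b : segment a b a.
Proof. by apply/segmentP; exists 0; rewrite ?lexx ?ler01 ?comb0. Qed.

Lemma segmentr a b : segment a b b.
Proof. by apply/segmentP; exists 1; rewrite ?lexx ?ler01 ?comb1. Qed.

Lemma dist_comb a b (t : R) : dist a (comb a b t) = `|t| * dist a b.
Proof.
apply: eq_dist; first by rewrite mulr_ge0// dist_ge0.
by rewrite exprMn real_normK ?num_real// dist_sqr /comb/=; ring.
Qed.

(** Take the last parameter at which the segment is in [K]: compactness attains it, and at an
    interior point it could still be increased. *)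
Lemma exit_segment K a z : compact K -> K a -> ~ K z ->
  exists2 t, 0 <= t <= 1 & (K `\` interior K) (comb a z t).
Proof.
move=> cK Ka Kz.
pose S := `[0, 1]%classic `&` comb a z @^-1` K.
have cS : compact S.
  apply: (subclosed_compact _ (@segment_compact R 0 1)); last by move=> t [].
  apply: closedI; first exact: interval_closed.
  have /continuous_closedP := @comb_continuous a z; apply.
  exact: compact_closed.
have S0 : S !=set0 by exists 0; split; rewrite /= ?in_itv/= ?lexx ?ler01 ?comb0.
have [|s sS smax] := @compact_EVT_max R R idfun S S0 cS.
  by apply: continuous_subspaceT => x; exact: cvg_id.
move: sS; rewrite inE => -[] /=; rewrite in_itv/= => /andP[s0 s1] Ks.
exists s; rewrite ?s0//; split => // iK.
have {}s1 : s < 1.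
  by rewrite lt_neqAle s1 andbT; apply/eqP => s1E; apply: Kz; move: Ks; rewrite s1E comb1.
have : nbhs s (comb a z @^-1` K) by apply: (comb_continuous iK).
move=> /nbhs_ballP[e /= e0 eK].
have e1 : 0 < Num.min (e / 2) (1 - s) by rewrite lt_min divr_gt0//= subr_gt0.
set d := Num.min _ _ in e1.
have [de d1] : d <= e / 2 /\ d <= 1 - s by rewrite /d !ge_min !lexx orbT.
have : S (s + d).
  split; first by rewrite /= in_itv/=; apply/andP; split; lra.
  apply: eK; rewrite /ball/= opprD addrA subrr add0r normrN gtr0_norm//.
  lra.
by move=> /mem_set/smax /=; lra.
Qed.

Lemma compact_sub_disk K x : compact K -> K x -> exists2 r, 0 <= r & K `<=` disk x r.
Proof.
move=> cK Kx.
have [||y yK ymax] := @compact_EVT_max _ R (dist x) K _ cK.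
- by exists x.
- by apply: continuous_subspaceT; exact: dist_continuous.
exists (dist x y); first exact: dist_ge0.
by move=> z Kz; apply: ymax; rewrite inE.
Qed.

(** Beyond [x] the ray leaves every bounded set, so [x] lies between [o] and a boundary point. *)
Lemma exit_ray K o x : compact K -> K x -> o <> x ->
  exists2 l, 1 <= l & (K `\` interior K) (comb o x l).
Proof.
move=> cK Kx ox; have [r r0 Kr] := compact_sub_disk cK Kx.
have d0 : 0 < dist x o.
  by rewrite lt_neqAle dist_ge0 andbT; apply/eqP => /esym/dist_eq0/esym.
pose k := (r + 1) / dist x o.
have k0 : 0 < k by rewrite divr_gt0// ltr_wpDl.
have nKz : ~ K (comb x o (- k)).
  move=> /Kr; rewrite /disk/= dist_comb normrN gtr0_norm// divfK ?gt_eqF//; lra.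
have [t /andP[t0 t1] Kt] := exit_segment cK Kx nKz.
exists (1 + t * k); first by rewrite lerDl mulr_ge0// ltW.
by congr (_ _): Kt; apply: injective_projections; rewrite /comb/=; ring.
Qed.

End Segments.

Section Hull.
Variable R : realType.
Implicit Types (S : {set 'I_5}) (v : 'I_5 -> R * R) (x y : R * R).

(** The weights are indexed by all five vertices and vanish off [S], so that discarding a vertex
    changes only [S]. *)
Definition hull S v : set (R * R) :=
  [set x | exists w : 'I_5 -> R, [/\ forall i, 0 <= w i, forall i, i \notin S -> w i = 0,
     \sum_i w i = 1 & x = (\sum_i w i * (v i).1, \sum_i w i * (v i).2)]].

Lemma hull_comb S v x y (t : R) : 0 <= t <= 1 ->
  hull S v x -> hull S v y -> hull S v (comb x y t).
Proof.
move=> /andP[t0 t1] [w [w0 wS w1 ->]] [w' [w0' wS' w1' ->]].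
exists (fun i => (1 - t) * w i + t * w' i); split.
- by move=> i; rewrite addr_ge0// mulr_ge0// subr_ge0.
- by move=> i iS; rewrite wS// wS'// !mulr0 addr0.
- by rewrite big_split/= -!mulr_sumr w1 w1'; ring.
by rewrite /comb/=; congr pair; rewrite !mulr_sumr -big_split/=;
  apply: eq_bigr => i _; ring.
Qed.

Lemma hull_vertex S v i : i \in S -> hull S v (v i).
Proof.
move=> iS; exists (fun j => (j == i)%:R); split.
- by move=> j; rewrite ler0n.
- by move=> j; case: (eqVneq j i) => [->|//]; rewrite iS.
- by rewrite (bigD1 i)//= eqxx big1 ?addr0// => j /negbTE ->.
by apply: injective_projections => /=; rewrite (bigD1 i)//= eqxx mul1r big1 ?addr0// => j /negbTE ->;
  rewrite mul0r.
Qed.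

(** Its own weight being below 1, the relation can be solved for [v i], which is then substituted
    away in every other combination. *)
Lemma hull_drop S v i (w : 'I_5 -> R) : (forall j, 0 <= w j) -> w i < 1 ->
  (forall j, j \notin S -> w j = 0) -> \sum_j w j = 1 ->
  v i = (\sum_j w j * (v j).1, \sum_j w j * (v j).2) ->
  hull S v `<=` hull (S :\ i) v.
Proof.
move=> w0 wi wS w1 vi.
have ui : 0 < 1 - w i by rewrite subr_gt0.
have hi : hull (S :\ i) v (v i).
  exists (fun j => if j == i then 0 else w j / (1 - w i)); split.
  - by move=> j; case: ifP => // _; rewrite divr_ge0// ltW.
  - move=> j; rewrite in_setD1 negb_and negbK; case: (j == i) => //= /wS ->.
    by rewrite mul0r.
  - rewrite (bigD1 i)//= eqxx add0r.
    rewrite (eq_bigr (fun j => w j / (1 - w i))); last by move=> j /negbTE ->.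
    rewrite -mulr_suml; move: w1; rewrite (bigD1 i)//= => /(canRL (addKr _)) ->.
    by rewrite addrC divff// gt_eqF.
  have dropE (f : 'I_5 -> R) : f i = \sum_j w j * f j ->
      \sum_j (if j == i then 0 else w j / (1 - w i)) * f j = f i.
    move=> fi; rewrite (bigD1 i)//= eqxx mul0r add0r.
    rewrite (eq_bigr (fun j => (w j * f j) / (1 - w i))); last by move=> j /negbTE ->; ring.
    rewrite -mulr_suml; move: fi; rewrite [in X in _ = X](bigD1 i)//= => fi.
    apply: (mulIf (lt0r_neq0 ui)); rewrite divfK ?gt_eqF//; lra.
  rewrite (dropE (fun j => (v j).1)) ?(dropE (fun j => (v j).2)).
  - exact: surjective_pairing.
  - by rewrite [in LHS]vi.
  - by rewrite [in LHS]vi.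
move=> x [u [u0 uS u1 ->]].
(* If the whole weight sits at [i], the point is [v i] itself, and renormalizing by [1 - u i] would
   divide by zero. *)
have [ui1|ui1] := eqVneq (u i) 1.
  have z j : j != i -> u j = 0.
    move=> ji; apply/eqP; rewrite eq_le u0 andbT.
    move: u1; rewrite (bigD1 i)//= (bigD1 j)//= ui1.
    have : 0 <= \sum_(k < 5 | (k != i) && (k != j)) u k by apply: sumr_ge0.
    lra.
  by congr (hull _ _ _): hi; apply: injective_projections => /=;
    rewrite (bigD1 i)//= ui1 mul1r big1 ?addr0// => j /z ->; rewrite mul0r.
have uile : u i <= 1.
  rewrite -u1 (bigD1 i)//= lerDl; exact: sumr_ge0.
have ui2 : 0 < 1 - u i by rewrite subr_gt0 lt_neqAle ui1.
pose y := (\sum_j (if j == i then 0 else u j / (1 - u i)) * (v j).1,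
           \sum_j (if j == i then 0 else u j / (1 - u i)) * (v j).2).
have hy : hull (S :\ i) v y.
  exists (fun j => if j == i then 0 else u j / (1 - u i)); split => //.
  - by move=> j; case: ifP => // _; rewrite divr_ge0// ltW.
  - move=> j; rewrite in_setD1 negb_and negbK; case: (j == i) => //= /uS ->.
    by rewrite mul0r.
  - rewrite (bigD1 i)//= eqxx add0r.
    rewrite (eq_bigr (fun j => u j / (1 - u i))); last by move=> j /negbTE ->.
    rewrite -mulr_suml; move: u1; rewrite (bigD1 i)//= => /(canRL (addKr _)) ->.
    by rewrite addrC divff// gt_eqF.
have := @hull_comb (S :\ i) v y (v i) (u i) _ hy hi; rewrite u0 uile => /(_ isT).
congr (hull _ _ _).
have splitE (f : 'I_5 -> R) :
    (1 - u i) * (\sum_j (if j == i then 0 else u j / (1 - u i)) * f j) + u i * f i = \sum_j u j * f j.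
  rewrite (bigD1 i)//= eqxx mul0r add0r [RHS](bigD1 i)//= addrC; congr (_ + _).
  rewrite mulr_sumr; apply: eq_bigr => j /negbTE ->.
  by field; rewrite gt_eqF.
by apply: injective_projections; rewrite /comb/=; rewrite splitE.
Qed.

End Hull.

(** * Regions covered by hulls and fans *)

Section Pentagon.
Variable R : realType.
Implicit Types (P : pentagon R) (x y o : R * R).

Lemma boundaryP P x :
  (region P `\` interior (region P)) x <-> exists i, edge P i x.
Proof.
by rewrite region_boundary; split => [[i _ Ei]|[i Ei]]; exists i.
Qed.

Lemma edge_sub_region P i : edge P i `<=` region P.
Proof. by move=> x Ex; have [] := (boundaryP P x).2 (ex_intro _ i Ex). Qed.

Lemma edge_sub_hull P i : edge P i `<=` hull [set: 'I_5]%SET (vertex P).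
Proof.
move=> x /segmentP[t t01 ->].
by apply: hull_comb => //; apply: hull_vertex; rewrite finset.in_setT.
Qed.

(** The horizontal line through [x] leaves the region on both sides, at points of edges, and [x]
    lies between these. *)
Lemma region_sub_hull P : region P `<=` hull [set: 'I_5]%SET (vertex P).
Proof.
move=> x Px.
have xa (e : R) : e != 0 -> (x.1 + e, x.2) <> x.
  by move=> e0 xe; move: e0; have /= := congr1 fst xe; lra.
have hb y : (region P `\` interior (region P)) y -> hull [set: 'I_5]%SET (vertex P) y.
  by move=> /boundaryP[i]; exact: edge_sub_hull.
have [|l l1 /hb hl] := exit_ray (@region_compact _ P) Px (xa (-1) _).
  by rewrite oppr_eq0 oner_eq0.
have [|m m1 /hb hm] := exit_ray (@region_compact _ P) Px (xa 1 _).
  by rewrite oner_eq0.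
have [lm|lm] := eqVneq (l + m) 2.
  congr (hull _ _ _): hl; apply: injective_projections; rewrite /comb/=; last by ring.
  have -> : l = 1 by lra.
  by ring.
have lm0 : 0 < l - 1 + (m - 1) by rewrite lt_neqAle; apply/andP; split; [move: lm; apply: contra_neq|]; lra.
have s01 : 0 <= (l - 1) / (l - 1 + (m - 1)) <= 1.
  rewrite divr_ge0 ?(ltW lm0) ?subr_ge0//= ler_pdivrMr// mul1r; lra.
have := hull_comb s01 hl hm; congr (hull _ _ _).
by apply: injective_projections; rewrite /comb/=; field; rewrite gt_eqF.
Qed.

(** The ray from [o] through [x], prolonged, ends on an edge. The triangles may overlap or stick out
    of the region; as a cover they work for any [o]. *)
Lemma region_sub_fan P o :
  region P `<=` \bigcup_i triangle o (vertex P i) (vertex P (ordS i)).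
Proof.
move=> x Px; have [ox|ox] := pselect (o = x).
  exists ord0 => //; exists 0, 0; rewrite !lexx addr0 ler01; split => //.
  by rewrite -ox; apply: injective_projections => /=; ring.
have [l l1 /boundaryP[i /segmentP[t /andP[t0 t1] xt]]] := exit_ray (@region_compact _ P) Px ox.
have l0 : 0 < l by lra.
exists i => //; exists ((1 - t) / l), (t / l); split.
- by rewrite divr_ge0 ?(ltW l0)// subr_ge0.
- by rewrite divr_ge0 ?(ltW l0).
- by rewrite -mulrDl subrK ler_pdivrMr// mul1r.
have /= x1 := congr1 fst xt; have /= x2 := congr1 snd xt.
have e (f g h k : R) : (1 - l) * f + l * g = (1 - t) * h + t * k ->
    g = f + (1 - t) / l * (h - f) + t / l * (k - f).
  move=> E; apply: (mulfI (lt0r_neq0 l0)).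
  have -> : l * (f + (1 - t) / l * (h - f) + t / l * (k - f)) =
     l * f + ((1 - t) * h + t * k) - f by field; rewrite gt_eqF.
  by rewrite -E; ring.
by apply: injective_projections => /=; apply: e.
Qed.

Lemma sector_point (c : R * R) (rho phi : R) : 0 <= rho ->
  dist c (c.1 + rho * cos phi, c.2 + rho * sin phi) = rho.
Proof.
move=> rho0; apply: eq_dist => //=.
have -> : (c.1 - (c.1 + rho * cos phi)) ^+ 2 + (c.2 - (c.2 + rho * sin phi)) ^+ 2 =
  rho ^+ 2 * (cos phi ^+ 2 + sin phi ^+ 2) by ring.
by rewrite cos2Dsin2 mulr1.
Qed.

Lemma cos_lt0 (a : R) : pi / 2 < a < pi -> cos a < 0.
Proof.
move=> /andP[a1 a2]; rewrite -(subrK pi a) cosDpi oppr_lt0.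
by rewrite cos_gt0_pihalf//; apply/andP; split; lra.
Qed.

(* A sector of opening th > pi contains three directions with a vanishing
   positive combination, so its apex is a proper convex combination of points
   of the region. *)
Lemma region_sub_hull_reflex P i (S : {set 'I_5}) : reflex P i ->
  region P `<=` hull S (vertex P) -> region P `<=` hull (S :\ i) (vertex P).
Proof.
move=> [th [[/andP[th0 th2] [alpha [eps [eps0 sector]]]] thpi]] PS x Px.
have pi0 := pi_gt0 R.
(* The unit vectors at [alpha], [alpha + th / 2] and [alpha + th] with weights 1, [k] and 1 sum to
   zero, and [k] is positive since [th / 2] lies between [pi / 2] and [pi]. *)
pose k := - (2 * cos (th / 2)).
have k0 : 0 < k.
  by rewrite oppr_gt0 pmulr_rlt0// cos_lt0//; apply/andP; split; lra.
pose c := vertex P i.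
pose pt phi := (c.1 + eps / 2 * cos phi, c.2 + eps / 2 * sin phi).
have hpt phi : alpha <= phi <= alpha + th -> hull S (vertex P) (pt phi).
  move=> aphi; apply: PS; apply/sector.
    by rewrite sector_point ?divr_ge0 ?(ltW eps0)//; lra.
  by exists (eps / 2), phi; split => //; rewrite divr_ge0// ltW.
have [|w1 [p1 s1 t1 e1]] := hpt alpha; first by apply/andP; split; lra.
have [|w2 [p2 s2 t2 e2]] := hpt (alpha + th / 2); first by apply/andP; split; lra.
have [|w3 [p3 s3 t3 e3]] := hpt (alpha + th); first by apply/andP; split; lra.
have wle w : (forall j, 0 <= w j) -> \sum_j w j = 1 -> w i <= 1 :> R.
  by move=> w0 w1'; rewrite -w1' (bigD1 i)//= lerDl; exact: sumr_ge0.
(* The sample point is at distance [eps / 2] from the vertex, so it cannot have all its weight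
   there; [hull_drop] asks for this strictness. *)
have w1i : w1 i < 1.
  rewrite lt_neqAle wle// andbT; apply/eqP => w1E.
  have z j : j != i -> w1 j = 0.
    move=> ji; apply/eqP; rewrite eq_le p1 andbT.
    move: t1; rewrite (bigD1 i)//= (bigD1 j)//= w1E.
    have : 0 <= \sum_(k < 5 | (k != i) && (k != j)) w1 k by apply: sumr_ge0.
    lra.
  have ptc : pt alpha = c.
    rewrite e1; apply: injective_projections => /=;
    by rewrite (bigD1 i)//= w1E mul1r big1 ?addr0// => j /z ->; rewrite mul0r.
  have := @sector_point c (eps / 2) alpha; rewrite -/(pt alpha) ptc distxx; lra.
have K0 : 0 < 2 + k by lra.
apply: (@hull_drop _ S (vertex P) i (fun j => (w1 j + w3 j + k * w2 j) / (2 + k))); last exact: PS.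
- by move=> j; rewrite divr_ge0 ?(ltW K0)// !addr_ge0// mulr_ge0// ltW.
- rewrite ltr_pdivrMr// mul1r.
  have := wle _ p2 t2; have := wle _ p3 t3; nra.
- by move=> j jS; rewrite s1// s2// s3// mulr0 !addr0 mul0r.
- rewrite -mulr_suml !big_split/= -mulr_sumr t1 t2 t3 mulr1.
  by rewrite (_ : 1 + 1 + k = 2 + k) ?divff ?gt_eqF//; ring.
have sumE (f : 'I_5 -> R) :
    \sum_j (w1 j + w3 j + k * w2 j) / (2 + k) * f j =
    (\sum_j w1 j * f j + \sum_j w3 j * f j + k * (\sum_j w2 j * f j)) / (2 + k).
  rewrite mulr_sumr -!big_split/= mulr_suml; apply: eq_bigr => j _; ring.
rewrite !sumE.
have := congr1 fst e1; have := congr1 snd e1.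
have := congr1 fst e2; have := congr1 snd e2.
have := congr1 fst e3; have := congr1 snd e3 => /= <- <- <- <- <- <-.
have sE : alpha + th = alpha + th / 2 + th / 2 by field.
have aE : alpha = alpha + th / 2 - th / 2 by ring.
have sumcos (b h : R) : cos (b - h) + cos (b + h) - 2 * cos h * cos b = 0.
  by rewrite cosB (cosD b h); ring.
have sumsin (b h : R) : sin (b - h) + sin (b + h) - 2 * cos h * sin b = 0.
  by rewrite sinB (sinD b h); ring.
have cosE : cos alpha + cos (alpha + th) + k * cos (alpha + th / 2) = 0.
  by rewrite sE {1}aE /k mulNr sumcos.
have sinE : sin alpha + sin (alpha + th) + k * sin (alpha + th / 2) = 0.
  by rewrite sE {1}aE /k mulNr sumsin.
apply: injective_projections => /=.
  have -> : c.1 + eps / 2 * cos alpha + (c.1 + eps / 2 * cos (alpha + th)) +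
     k * (c.1 + eps / 2 * cos (alpha + th / 2)) = c.1 * (2 + k) +
     eps / 2 * (cos alpha + cos (alpha + th) + k * cos (alpha + th / 2)) by ring.
  by rewrite cosE mulr0 addr0 mulfK ?gt_eqF.
have -> : c.2 + eps / 2 * sin alpha + (c.2 + eps / 2 * sin (alpha + th)) +
   k * (c.2 + eps / 2 * sin (alpha + th / 2)) = c.2 * (2 + k) +
   eps / 2 * (sin alpha + sin (alpha + th) + k * sin (alpha + th / 2)) by ring.
by rewrite sinE mulr0 addr0 mulfK ?gt_eqF.
Qed.

End Pentagon.

(** * Areas and perimeters of pentagonal regions *)

Section Cover.
Variable R : realType.
Implicit Types (K : set (R * R)).

Lemma mu2_cover (I : choiceType) (s : seq I) (F : I -> set (R * R)) (b : I -> R) K :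
  measurable2 K -> (forall i, measurable2 (F i)) ->
  (forall i, (mu2 R (F i) <= (b i)%:E)%E) ->
  (forall x, K x -> exists2 i, i \in s & F i x) ->
  (mu2 R K <= (\sum_(i <- s) b i)%:E)%E.
Proof.
move=> mK mF Fb Ks.
have mU : measurable2 (\big[setU/set0]_(i <- s) F i).
  by apply: bigsetU_measurable.
apply: (@le_trans _ _ (mu2 R (\big[setU/set0]_(i <- s) F i))).
  apply: le_mu2 => // x /Ks[i si Fi]; by rewrite -bigcup_seq; exists i.
elim: s {mU Ks} => [|i s IH]; first by rewrite !big_nil measure0.
rewrite !big_cons EFinD; apply: le_trans (mu2U _ _) _ => //.
  exact: bigsetU_measurable.
exact: leeD.
Qed.

(** [lift j] skips the index [j]: twice the signed area of the triangle left when one of four points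
    is omitted. *)
Definition omit_area (p : 'I_4 -> R * R) (j : 'I_4) : R :=
  cross (p (lift j (inord 1)) - p (lift j (inord 0)))
        (p (lift j (inord 2)) - p (lift j (inord 0))).

Definition omit_triangle (p : 'I_4 -> R * R) (j : 'I_4) :=
  triangle (p (lift j (inord 0))) (p (lift j (inord 1))) (p (lift j (inord 2))).

(** Caratheodory's reduction: subtract the largest multiple of the dependency [l] that keeps the
    weights nonnegative. The weight that vanishes has a positive coefficient. *)
Lemma omit_dependency (p : 'I_4 -> R * R) (w l : 'I_4 -> R) :
  (forall j, 0 <= w j) -> \sum_j w j = 1 ->
  \sum_j l j = 0 -> \sum_j l j * (p j).1 = 0 -> \sum_j l j * (p j).2 = 0 ->
  (exists j, l j != 0) ->
  exists2 j, 0 < l j & omit_triangle p j (\sum_j w j * (p j).1, \sum_j w j * (p j).2).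
Proof.
move=> w0 w1 l0 lx ly [j0 lj0].
have [j1 lj1] : exists j, 0 < l j.
  have [//|/forallNP np] := pselect (exists j, 0 < l j).
  have le0 j : l j <= 0 by rewrite leNgt; apply/negP.
  move: lj0; have : 0 <= \sum_(j | j != j0) - l j by apply: sumr_ge0 => j _; rewrite oppr_ge0.
  move: l0; rewrite (bigD1 j0)//= sumrN => l0 h.
  by have := le0 j0; rewrite le_eqVlt => /orP[->//|]; lra.
have [j lj jmin] := @arg_minP _ _ _ j1 (fun j => 0 < l j) (fun j => w j / l j) lj1.
exists j => //.
pose t := w j / l j; pose u i := w i - t * l i.
have t0 : 0 <= t by rewrite divr_ge0// ltW.
have uj : u j = 0 by rewrite /u /t divfK ?subrr// gt_eqF.
have u0 i : 0 <= u i.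
  rewrite subr_ge0; have [li|li] := ltP 0 (l i).
    by rewrite -ler_pdivlMr//; exact: jmin.
  by apply: (le_trans _ (w0 i)); rewrite mulr_ge0_le0.
have uE (f : 'I_4 -> R) : \sum_i l i * f i = 0 -> \sum_i w i * f i = \sum_i u i * f i.
  move=> lf; have -> : \sum_i w i * f i = \sum_i w i * f i - t * \sum_i l i * f i.
    by rewrite lf mulr0 subr0.
  rewrite mulr_sumr -sumrB.
  by apply: eq_bigr => i _; rewrite /u; ring.
have o3 : forall f : 'I_4 -> R, f j = 0 ->
    \sum_i f i = f (lift j (inord 0)) + f (lift j (inord 1)) + f (lift j (inord 2)).
  move=> f fj; rewrite (bigD1_ord j)//= fj add0r !big_ord_recl big_ord0 addr0 addrA.
  by do !congr (_ + _); congr f; congr lift; apply: val_inj; rewrite /= inordK.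
have u1 : \sum_i u i = 1.
  rewrite -w1; have := uE (fun=> 1); under eq_bigr do rewrite mulr1.
  rewrite l0 => /(_ erefl) E; under [RHS]eq_bigr do rewrite -[w _]mulr1.
  by rewrite E; apply: eq_bigr => i _; rewrite mulr1.
rewrite (uE _ lx) (uE _ ly).
rewrite o3// in u1; rewrite !o3 ?uj ?mul0r//.
exists (u (lift j (inord 1))), (u (lift j (inord 2))); split => //.
  by have := u0 (lift j (inord 0)); lra.
have u00 : u (lift j (inord 0)) = 1 - u (lift j (inord 1)) - u (lift j (inord 2)) by lra.
by rewrite u00; congr pair; ring.
Qed.

Lemma big_ord4 (V : nmodType) (F : 'I_4 -> V) :
  \sum_j F j = F (inord 0) + F (inord 1) + F (inord 2) + F (inord 3).
Proof.
rewrite !big_ord_recl big_ord0 addr0 !addrA.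
by do !congr (_ + _); congr F; apply: val_inj; rewrite /= inordK.
Qed.

Lemma lift4 : [/\ [/\ lift (inord 0 : 'I_4) (inord 0) = inord 1,
   lift (inord 0 : 'I_4) (inord 1) = inord 2 & lift (inord 0 : 'I_4) (inord 2) = inord 3],
   [/\ lift (inord 1 : 'I_4) (inord 0) = inord 0,
   lift (inord 1 : 'I_4) (inord 1) = inord 2 & lift (inord 1 : 'I_4) (inord 2) = inord 3],
   [/\ lift (inord 2 : 'I_4) (inord 0) = inord 0,
   lift (inord 2 : 'I_4) (inord 1) = inord 1 & lift (inord 2 : 'I_4) (inord 2) = inord 3] &
   [/\ lift (inord 3 : 'I_4) (inord 0) = inord 0,
   lift (inord 3 : 'I_4) (inord 1) = inord 1 & lift (inord 3 : 'I_4) (inord 2) = inord 2]].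
Proof. by split; split; apply: val_inj; rewrite /= /bump !inordK. Qed.

Lemma mu2_omit_le K (p : 'I_4 -> R * R) (l : 'I_4 -> R) :
  measurable2 K ->
  (forall x, K x -> exists w : 'I_4 -> R, [/\ forall j, 0 <= w j, \sum_j w j = 1 &
     x = (\sum_j w j * (p j).1, \sum_j w j * (p j).2)]) ->
  \sum_j l j = 0 -> \sum_j l j * (p j).1 = 0 -> \sum_j l j * (p j).2 = 0 ->
  (exists j, l j != 0) ->
  (mu2 R K <= (\sum_(j | (0 < l j)%R) `|omit_area p j| / 2)%:E)%E.
Proof.
move=> mK Kp l0 lx ly ln0.
rewrite -big_filter.
apply: (@mu2_cover _ _ (fun j => omit_triangle p j)) => //.
- by move=> j; apply: compact_measurable2; exact: triangle_compact.
- by move=> j; exact: triangle_measure.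
move=> x /Kp[w [w0 w1 ->]].
have [j lj jx] := omit_dependency w0 w1 l0 lx ly ln0.
by exists j => //; rewrite mem_filter lj mem_index_enum.
Qed.

(** A dependency and its negative give two covers that use disjoint sets of the four triangles, so
    the cheaper one costs at most half of their total area. *)
Lemma four_point_measure K (p : 'I_4 -> R * R) :
  measurable2 K ->
  (forall x, K x -> exists w : 'I_4 -> R, [/\ forall j, 0 <= w j, \sum_j w j = 1 &
     x = (\sum_j w j * (p j).1, \sum_j w j * (p j).2)]) ->
  (mu2 R K <= ((\sum_j `|omit_area p j|) / 4)%:E)%E.
Proof.
move=> mK Kp.
have [[a0 a1 a2] [b0 b1 b2] [c0 c1 c2] [d0 d1 d2]] := lift4.
pose A := omit_area p.
have [[j Aj]|A0] := pselect (exists j, A j != 0).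
  (* By Cramer's rule the alternating signed areas are an affine dependency of four points of the
     plane. *)
  pose l (j : 'I_4) := (-1) ^+ j * A j.
  have vals : [/\ l (inord 0) = A (inord 0), l (inord 1) = - A (inord 1),
      l (inord 2) = A (inord 2) & l (inord 3) = - A (inord 3)].
    by rewrite /l !inordK//; split; ring.
  have [l0 l1 l2 l3] := vals.
  have s0 : \sum_j l j = 0.
    rewrite big_ord4 l0 l1 l2 l3 /A /omit_area a0 a1 a2 b0 b1 b2 c0 c1 c2 d0 d1 d2 /cross/=.
    by ring.
  have sx : \sum_j l j * (p j).1 = 0.
    rewrite big_ord4 l0 l1 l2 l3 /A /omit_area a0 a1 a2 b0 b1 b2 c0 c1 c2 d0 d1 d2 /cross/=.
    by ring.
  have sy : \sum_j l j * (p j).2 = 0.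
    rewrite big_ord4 l0 l1 l2 l3 /A /omit_area a0 a1 a2 b0 b1 b2 c0 c1 c2 d0 d1 d2 /cross/=.
    by ring.
  have ln0 : exists j, l j != 0 by exists j; rewrite mulf_neq0// signr_eq0.
  have neg (f : 'I_4 -> R) : \sum_j l j * f j = 0 -> \sum_j - l j * f j = 0.
    by move=> lf; under eq_bigr do rewrite mulNr; rewrite sumrN lf oppr0.
  have h1 := mu2_omit_le mK Kp s0 sx sy ln0.
  have h2 := @mu2_omit_le K p (fun j => - l j) mK Kp.
  have {}h2 : (mu2 R K <= (\sum_(j | (0 < - l j)%R) `|omit_area p j| / 2)%:E)%E.
    apply: h2; rewrite ?sumrN ?s0 ?oppr0 ?neg//.
    by case: ln0 => k lk; exists k; rewrite oppr_eq0.
  have tot : \sum_(j | 0 < l j) `|omit_area p j| / 2 +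
     \sum_(j | 0 < - l j) `|omit_area p j| / 2 <= \sum_j `|omit_area p j| / 2.
    rewrite [leRHS](bigID (fun j => 0 < l j))/= lerD2l.
    rewrite [leRHS](bigID (fun j => 0 < - l j))/= -[leLHS]addr0 lerD//.
      rewrite le_eqVlt; apply/orP; left; apply/eqP/eq_bigl => k.
      by case: (ltgtP 0 (l k)); rewrite oppr_gt0 => h; rewrite ?h ?andbT//; apply/negbTE; rewrite -leNgt ?ltW -?h.
    by apply: sumr_ge0 => k _; rewrite divr_ge0.
  have -> : (\sum_j `|omit_area p j|) / 4 = (\sum_j `|omit_area p j| / 2) / 2.
    by rewrite -mulr_suml; field.
  move: h1 h2 tot; set s1 := (\sum_(j | _) _)%R; set s2 := (\sum_(j | _) _)%R; set s := (\sum_j _)%R => h1 h2 tot.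
  have [s12|s12] := leP s1 s2.
    by apply: (le_trans h1); rewrite lee_fin; lra.
  by apply: (le_trans h2); rewrite lee_fin; lra.
(* All omitted areas vanish, so any nontrivial dependency yields the bound 0; it is found among the
   first two or three points. *)
have {}A0 j : A j = 0 by apply/eqP; apply: contra_notT A0 => h; exists j.
have zero : \sum_j `|omit_area p j| = 0 by rewrite big1// => j _; rewrite -/(A j) A0 normr0.
suff [l [l0 lx ly ln0]] : exists l : 'I_4 -> R, [/\ \sum_j l j = 0,
    \sum_j l j * (p j).1 = 0, \sum_j l j * (p j).2 = 0 & exists j, l j != 0].
  have := mu2_omit_le mK Kp l0 lx ly ln0.
  by rewrite zero big1 ?mul0r// => j _; rewrite -/(A j) A0 normr0 mul0r.
have [ab|ab] := pselect (p (inord 0) = p (inord 1)).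
  exists (fun j => nth 0 [:: 1; -1; 0; 0] j); split; rewrite ?big_ord4 ?inordK//= ?ab; try by ring.
  by exists (inord 0); rewrite inordK//= oner_eq0.
pose D := dist (p (inord 0)) (p (inord 1)) ^+ 2.
have D0 : D != 0.
  by rewrite expf_neq0//; apply/eqP => /dist_eq0.
have DE : D = ((p (inord 1)).1 - (p (inord 0)).1) ^+ 2 + ((p (inord 1)).2 - (p (inord 0)).2) ^+ 2.
  by rewrite /D dist_sqr; ring.
pose tau := dot (p (inord 2) - p (inord 0)) (p (inord 1) - p (inord 0)) / D.
have cr := A0 (inord 3); rewrite /A /omit_area d0 d1 d2 /cross/= in cr.
exists (fun j => nth 0 [:: tau - 1; - tau; 1; 0] j).
split; rewrite ?big_ord4 ?inordK//=; try by ring.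
- apply: (mulIf D0); rewrite [RHS]mul0r.
  have -> : ((tau - 1) * (p (inord 0)).1 + - tau * (p (inord 1)).1 + 1 * (p (inord 2)).1 + 0 * (p (inord 3)).1) * D
   = (tau * D) * ((p (inord 0)).1 - (p (inord 1)).1) + D * ((p (inord 2)).1 - (p (inord 0)).1) by ring.
  rewrite /tau divfK// DE /dot/=.
  move: cr; set u := p (inord 0); set v := p (inord 1); set z := p (inord 2) => cr.
  have -> : ((z.1 - u.1) * (v.1 - u.1) + (z.2 - u.2) * (v.2 - u.2)) * (u.1 - v.1) +
    ((v.1 - u.1) ^+ 2 + (v.2 - u.2) ^+ 2) * (z.1 - u.1) =
    - (v.2 - u.2) * ((v.1 - u.1) * (z.2 - u.2) - (v.2 - u.2) * (z.1 - u.1)) by ring.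
  by rewrite cr mulr0.
- apply: (mulIf D0); rewrite [RHS]mul0r.
  have -> : ((tau - 1) * (p (inord 0)).2 + - tau * (p (inord 1)).2 + 1 * (p (inord 2)).2 + 0 * (p (inord 3)).2) * D
   = (tau * D) * ((p (inord 0)).2 - (p (inord 1)).2) + D * ((p (inord 2)).2 - (p (inord 0)).2) by ring.
  rewrite /tau divfK// DE /dot/=.
  move: cr; set u := p (inord 0); set v := p (inord 1); set z := p (inord 2) => cr.
  have -> : ((z.1 - u.1) * (v.1 - u.1) + (z.2 - u.2) * (v.2 - u.2)) * (u.2 - v.2) +
    ((v.1 - u.1) ^+ 2 + (v.2 - u.2) ^+ 2) * (z.2 - u.2) =
    (v.1 - u.1) * ((v.1 - u.1) * (z.2 - u.2) - (v.2 - u.2) * (z.1 - u.1)) by ring.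
  by rewrite cr mulr0.
by exists (inord 2); rewrite inordK//= oner_eq0.
Qed.

End Cover.

Section Bounds.
Variable R : realType.
Implicit Types (P : pentagon R) (a b c d : R * R).

Lemma region_measurable P : measurable2 (region P).
Proof. by apply: compact_measurable2; exact: region_compact. Qed.

Lemma amgm3 (x y z : R) : 0 <= x -> 0 <= y -> 0 <= z ->
  27 * (x * y * z) <= (x + y + z) ^+ 3.
Proof.
move=> x0 y0 z0; rewrite -subr_ge0.
have -> : (x + y + z) ^+ 3 - 27 * (x * y * z) =
  (x + y + z) / 2 * ((x - y) ^+ 2 + (y - z) ^+ 2 + (z - x) ^+ 2) +
  3 * (x * (y - z) ^+ 2 + y * (z - x) ^+ 2 + z * (x - y) ^+ 2) by field.
by do ?[exact: sqr_ge0|apply: addr_ge0|apply: mulr_ge0|rewrite invr_ge0].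
Qed.

(** Heron's formula writes four times the squared cross product as the perimeter times three
    factors, to which the arithmetic-geometric mean inequality applies. *)
Lemma triangle_isoperimetric a b c :
  108 * cross (b - a) (c - a) ^+ 2 <= (dist a b + dist b c + dist c a) ^+ 4.
Proof.
have := dist_sqr a b; have := dist_sqr b c; have := dist_sqr c a.
have := dist_triangle b a c; have := dist_triangle c b a; have := dist_triangle a c b.
rewrite (distC a c) (distC b a) (distC c b).
have := dist_ge0 a b; have := dist_ge0 b c; have := dist_ge0 c a.
move: (dist a b) (dist b c) (dist c a) => x y z z0 y0 x0 t1 t2 t3 zE yE xE.
have -> : 108 * cross (b - a) (c - a) ^+ 2 = 27 * ((x + y - z) * (x - y + z) * (- x + y + z)) * (x + y + z).
  have -> : 27 * ((x + y - z) * (x - y + z) * (- x + y + z)) * (x + y + z) =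
     27 * (2 * (x ^+ 2 * y ^+ 2 + y ^+ 2 * z ^+ 2 + z ^+ 2 * x ^+ 2)
       - (x ^+ 2) ^+ 2 - (y ^+ 2) ^+ 2 - (z ^+ 2) ^+ 2) by ring.
  by rewrite xE yE zE /cross/=; ring.
rewrite exprSr ler_wpM2r ?addr_ge0//.
have -> : x + y + z = (x + y - z) + (x - y + z) + (- x + y + z) by ring.
by apply: amgm3; lra.
Qed.

Lemma perimeter_ordS P i : perimeter P =
  dist (vertex P i) (vertex P (ordS i))
  + dist (vertex P (ordS i)) (vertex P (ordS (ordS i)))
  + dist (vertex P (ordS (ordS i))) (vertex P (ordS (ordS (ordS i))))
  + dist (vertex P (ordS (ordS (ordS i)))) (vertex P (ordS (ordS (ordS (ordS i)))))
  + dist (vertex P (ordS (ordS (ordS (ordS i))))) (vertex P i).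
Proof. by rewrite /perimeter (big_ordS5 _ i) ordS5. Qed.

Lemma perimeter_ge0 P : 0 <= perimeter P.
Proof. by apply: sumr_ge0 => i _; exact: dist_ge0. Qed.

Lemma cross_rot a b c : cross (b - a) (c - a) = cross (c - b) (a - b).
Proof. by rewrite /cross/=; ring. Qed.

Lemma cross_le a b c : `|cross (b - a) (c - a)| <= dist a b * dist b c.
Proof.
have -> : cross (b - a) (c - a) = cross (b - a) (c - b) by rewrite /cross/=; ring.
exact: cross_le_dist.
Qed.

(** The cross products of the four triangles are at most the products of consecutive sides, which
    sum to [(l1 + l3) (l2 + l4)]. Unit area makes this at least 4, hence the four sides sum to at
    least 4; the triangle inequality cuts off the vertex [i]. *)
Lemma perimeter_hull4 P i : area P = 1%E ->
  region P `<=` hull ([set: 'I_5] :\ i)%SET (vertex P) -> 4 <= perimeter P.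
Proof.
move=> P1 Phull.
pose p (j : 'I_4) := vertex P (iter j.+1 (@ordS 5) i).
have P4 : (mu2 R (region P) <= ((\sum_j `|omit_area p j|) / 4)%:E)%E.
  apply: four_point_measure; first exact: region_measurable.
  move=> x /Phull[w [w0 wS w1 ->]].
  have wi : w i = 0 by apply: wS; rewrite !inE eqxx.
  exists (fun j => w (iter j.+1 (@ordS 5) i)); split => //.
  - by rewrite -w1 big_ord4 !inordK//= (big_ordS5 _ i) wi add0r.
  by rewrite !big_ord4 !inordK//= !(big_ordS5 _ i) wi !mul0r !add0r /p !inordK.
move: P4; rewrite -[mu2 R _]/(area P) P1 lee_fin.
have [[a0 a1 a2] [b0 b1 b2] [c0 c1 c2] [d0 d1 d2]] := lift4.
rewrite big_ord4 /omit_area a0 a1 a2 b0 b1 b2 c0 c1 c2 d0 d1 d2 /p !inordK//=.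
rewrite (perimeter_ordS P i).
set v0 := vertex P i; set a := vertex P (ordS i); set b := vertex P (ordS (ordS i)).
set c := vertex P (ordS (ordS (ordS i))); set d := vertex P (ordS (ordS (ordS (ordS i)))).
have := dist_triangle v0 d a.
have := cross_le b c d; have := cross_le c d a; have := cross_le d a b; have := cross_le a b c.
rewrite -(cross_rot a c d) -(cross_rot b d a) -(cross_rot a b d).
have := dist_ge0 a b; have := dist_ge0 b c; have := dist_ge0 c d; have := dist_ge0 d a.
move: (dist a b) (dist b c) (dist c d) (dist d a) => l1 l2 l3 l4 p4 p3 p2 p1.
move=> h1 h2 h3 h4 tri h.
have l13 : 4 <= (l1 + l3) * (l2 + l4) by lra.
have : 16 <= (l1 + l2 + l3 + l4) ^+ 2.
  have := sqr_ge0 (l1 + l3 - l2 - l4); lra.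
have : 0 <= l1 + l2 + l3 + l4 by rewrite !addr_ge0.
have : l1 + l2 + l3 + l4 <= dist v0 a + l1 + l2 + l3 + dist d v0 by lra.
move: (l1 + l2 + l3 + l4) (_ + dist d v0) => s S; nra.
Qed.

(** Whichever two vertices are dropped, the triangle on the rest has no longer perimeter. Its cross
    product is at least 2, whence [108 * 4 = 432]; the fourth power avoids a fourth root. *)
Lemma perimeter_hull3 P i j : i != j -> area P = 1%E ->
  region P `<=` hull ([set: 'I_5] :\ i :\ j)%SET (vertex P) -> 432 <= perimeter P ^+ 4.
Proof.
move=> ij P1 Phull.
suff main a b c : dist a b + dist b c + dist c a <= perimeter P ->
    (forall w : 'I_5 -> R, w i = 0 -> w j = 0 -> \sum_k w k = 1 -> (forall k, 0 <= w k) ->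
    exists s t : R, [/\ 0 <= s, 0 <= t, s + t <= 1,
     \sum_k w k * (vertex P k).1 = a.1 + s * (b.1 - a.1) + t * (c.1 - a.1) &
     \sum_k w k * (vertex P k).2 = a.2 + s * (b.2 - a.2) + t * (c.2 - a.2)]) ->
    432 <= perimeter P ^+ 4.
  have per := perimeter_ordS P i.
  have sumE := fun f : 'I_5 -> R => big_ordS5 f i.
  set v0 := vertex P i in per; set v1 := vertex P (ordS i) in per.
  set v2 := vertex P (ordS (ordS i)) in per; set v3 := vertex P (ordS (ordS (ordS i))) in per.
  set v4 := vertex P (ordS (ordS (ordS (ordS i)))) in per.
  have t41 := dist_triangle v0 v4 v1; have t02 := dist_triangle v1 v0 v2.
  have t42 := dist_triangle v0 v4 v2; have t13 := dist_triangle v2 v1 v3.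
  have t24 := dist_triangle v3 v2 v4; have t31 := dist_triangle v4 v3 v1.
  have t30 := dist_triangle v4 v3 v0; have t31' := dist_triangle v0 v3 v1.
  have [ji|[jE|jE|jE|jE]] := ordS5_cases i j.
  - by rewrite ji eqxx in ij.
  - subst j; apply: (main v2 v3 v4); first by rewrite per; lra.
    move=> w wi wj w1 w0; exists (w (ordS (ordS (ordS i)))), (w (ordS (ordS (ordS (ordS i))))).
    have := w0 (ordS (ordS i)); have := w0 (ordS (ordS (ordS i))); have := w0 (ordS (ordS (ordS (ordS i)))).
    move: w1; rewrite !sumE wi wj !mul0r ?add0r ?addr0 -?/v1 -?/v2 -?/v3 -?/v4.
    move: (w (ordS (ordS i))) (w (ordS (ordS (ordS i)))) (w (ordS (ordS (ordS (ordS i))))) => x y z w1 z0 y0 x0.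
    have -> : x = 1 - y - z by lra.
    by split => //; [lra|ring|ring].
  - subst j; apply: (main v1 v3 v4); first by rewrite per; lra.
    move=> w wi wj w1 w0; exists (w (ordS (ordS (ordS i)))), (w (ordS (ordS (ordS (ordS i))))).
    have := w0 (ordS i); have := w0 (ordS (ordS (ordS i))); have := w0 (ordS (ordS (ordS (ordS i)))).
    move: w1; rewrite !sumE wi wj !mul0r ?add0r ?addr0 -?/v1 -?/v2 -?/v3 -?/v4.
    move: (w (ordS i)) (w (ordS (ordS (ordS i)))) (w (ordS (ordS (ordS (ordS i))))) => x y z w1 z0 y0 x0.
    have -> : x = 1 - y - z by lra.
    by split => //; [lra|ring|ring].
  - subst j; apply: (main v1 v2 v4); first by rewrite per; lra.
    move=> w wi wj w1 w0; exists (w (ordS (ordS i))), (w (ordS (ordS (ordS (ordS i))))).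
    have := w0 (ordS i); have := w0 (ordS (ordS i)); have := w0 (ordS (ordS (ordS (ordS i)))).
    move: w1; rewrite !sumE wi wj !mul0r ?add0r ?addr0 -?/v1 -?/v2 -?/v3 -?/v4.
    move: (w (ordS i)) (w (ordS (ordS i))) (w (ordS (ordS (ordS (ordS i))))) => x y z w1 z0 y0 x0.
    have -> : x = 1 - y - z by lra.
    by split => //; [lra|ring|ring].
  - subst j; apply: (main v1 v2 v3); first by rewrite per; lra.
    move=> w wi wj w1 w0; exists (w (ordS (ordS i))), (w (ordS (ordS (ordS i)))).
    have := w0 (ordS i); have := w0 (ordS (ordS i)); have := w0 (ordS (ordS (ordS i))).
    move: w1; rewrite !sumE wi wj !mul0r ?add0r ?addr0 -?/v1 -?/v2 -?/v3 -?/v4.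
    move: (w (ordS i)) (w (ordS (ordS i))) (w (ordS (ordS (ordS i)))) => x y z w1 z0 y0 x0.
    have -> : x = 1 - y - z by lra.
    by split => //; [lra|ring|ring].
move=> per main; have := triangle_isoperimetric a b c.
have mK := region_measurable P.
have sub : region P `<=` triangle a b c.
  move=> x /Phull[w [w0 wS w1 ->]].
  have wi : w i = 0 by apply: wS; rewrite !inE eqxx andbF.
  have wj : w j = 0 by apply: wS; rewrite !inE eqxx.
  have [s [t [s0 t0 st e1 e2]]] := main w wi wj w1 w0.
  by exists s, t; split => //; congr pair.
have mT : measurable2 (triangle a b c).
  by apply: compact_measurable2; exact: triangle_compact.
have := le_trans (le_mu2 mK mT sub) (triangle_measure a b c).
rewrite -[mu2 R _]/(area P) P1 lee_fin => h1 h2.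
have c4 : 4 <= cross (b - a) (c - a) ^+ 2.
  by rewrite -real_normK ?num_real//; move: h1; move: `|_| => y; nra.
have s0 : 0 <= dist a b + dist b c + dist c a by rewrite !addr_ge0// dist_ge0.
have : (dist a b + dist b c + dist c a) ^+ 4 <= perimeter P ^+ 4.
  by rewrite lerXn2r ?nnegrE ?perimeter_ge0.
lra.
Qed.

Lemma type1_perimeter P : area P = 1%E -> type1 P -> 4 <= perimeter P.
Proof.
move=> P1 [_ card1].
have : (0 < #|[pred i | `[< reflex P i >]]|)%N by rewrite card1.
case/card_gt0P => i iP; have {}iP : reflex P i by exact/asboolP.
apply: (@perimeter_hull4 P i P1); apply: region_sub_hull_reflex => //.
exact: (@region_sub_hull R P).
Qed.

Lemma type2_perimeter P : area P = 1%E -> type2 P -> 432 <= perimeter P ^+ 4.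
Proof.
move=> P1 [_ card2].
have : (1 < #|[pred i | `[< reflex P i >]]|)%N by rewrite card2.
case/card_gt1P => i [j [iP jP ij]].
have {}iP : reflex P i by exact/asboolP.
have {}jP : reflex P j by exact/asboolP.
apply: (@perimeter_hull3 P i j) => //.
by do 2 apply: region_sub_hull_reflex => //; exact: region_sub_hull.
Qed.

End Bounds.

(** * The isoperimetric inequality for pentagonal regions *)

Section PentagonIsoperimetry.
Variable R : realType.
Implicit Types (P : pentagon R) (a b c d : R * R).

Definition orient a b c : R := cross (b - a) (c - a).

Lemma collinear_comb c d x : c <> d -> orient c d x = 0 -> exists s, x = comb c d s.
Proof.
move=> cd; rewrite /orient /cross/= => col.
have D0 : dist c d ^+ 2 != 0 by rewrite expf_neq0//; apply/eqP => /dist_eq0.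
have DE : dist c d ^+ 2 = (d.1 - c.1) ^+ 2 + (d.2 - c.2) ^+ 2 by rewrite dist_sqr; ring.
move: (dist c d ^+ 2) D0 DE => D D0 DE.
exists (dot (x - c) (d - c) / D).
apply: injective_projections; rewrite /comb/=; apply: (mulIf D0).
  have -> : ((1 - dot (x - c) (d - c) / D) * c.1 +
     dot (x - c) (d - c) / D * d.1) * D =
     c.1 * D + dot (x - c) (d - c) * (d.1 - c.1) by field.
  rewrite DE /dot/=; apply/eqP; rewrite -subr_eq0; apply/eqP.
  have -> : x.1 * ((d.1 - c.1) ^+ 2 + (d.2 - c.2) ^+ 2) -
    (c.1 * ((d.1 - c.1) ^+ 2 + (d.2 - c.2) ^+ 2) +
    ((x.1 - c.1) * (d.1 - c.1) + (x.2 - c.2) * (d.2 - c.2)) * (d.1 - c.1)) =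
    - (d.2 - c.2) * ((d.1 - c.1) * (x.2 - c.2) - (d.2 - c.2) * (x.1 - c.1)) by ring.
  by rewrite col mulr0.
have -> : ((1 - dot (x - c) (d - c) / D) * c.2 +
   dot (x - c) (d - c) / D * d.2) * D =
   c.2 * D + dot (x - c) (d - c) * (d.2 - c.2) by field.
rewrite DE /dot/=; apply/eqP; rewrite -subr_eq0; apply/eqP.
have -> : x.2 * ((d.1 - c.1) ^+ 2 + (d.2 - c.2) ^+ 2) -
  (c.2 * ((d.1 - c.1) ^+ 2 + (d.2 - c.2) ^+ 2) +
  ((x.1 - c.1) * (d.1 - c.1) + (x.2 - c.2) * (d.2 - c.2)) * (d.2 - c.2)) =
  (d.1 - c.1) * ((d.1 - c.1) * (x.2 - c.2) - (d.2 - c.2) * (x.1 - c.1)) by ring.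
by rewrite col mulr0.
Qed.

(* If c and d do not see a and b on the same side of their line, then [a, b]
   meets the line cd outside [c, d], and c or d lies in a triangle spanned by
   the other points. *)
Lemma same_side a b c d : c <> d -> segment a b `&` segment c d = set0 ->
  [\/ 0 < orient a c d * orient b c d,
      exists u s, [/\ 0 <= u <= 1, 0 <= s <= 1 & c = comb (comb a b u) d s] |
      exists u s, [/\ 0 <= u <= 1, 0 <= s <= 1 & d = comb (comb a b u) c s]].
Proof.
move=> cd disj; have [h|h] := ltP 0 (orient a c d * orient b c d); first exact: Or31.
set f0 := orient a c d in h *; set f1 := orient b c d in h *.
(* The signed distance to the line [cd] is affine along [[a, b]]; the signs of [f0] and [f1] place a
   zero of it at some [u] in the unit interval. *)
have [u u01 fu] : exists2 u, 0 <= u <= 1 & (1 - u) * f0 + u * f1 = 0.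
  have [f00|f00] := eqVneq f0 0; first by exists 0; rewrite ?lexx ?ler01// f00; ring.
  have ff : f0 - f1 != 0.
    apply: contraNneq f00 => ff; rewrite -sqrf_eq0 eq_le sqr_ge0 andbT.
    have f1E : f1 = f0 by lra.
    by move: h; rewrite f1E expr2.
  exists (f0 / (f0 - f1)); last by field.
  have [p|p] := ltP 0 f0.
    have f10 : f1 <= 0 by nra.
    have p' : 0 < f0 - f1 by lra.
    by rewrite divr_ge0 ?(ltW p) ?(ltW p')//= ler_pdivrMr// mul1r; lra.
  have {}p : f0 < 0 by rewrite lt_neqAle f00.
  have f10 : 0 <= f1 by nra.
  have -> : f0 / (f0 - f1) = (- f0) / (f1 - f0) by field; rewrite ff andbT -opprB oppr_eq0.
  have p' : 0 < f1 - f0 by lra.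
  by rewrite divr_ge0 ?(ltW p') ?oppr_ge0 ?(ltW p)//= ler_pdivrMr// mul1r; lra.
pose x := comb a b u.
have [|s xs] := @collinear_comb c d x cd.
  by rewrite -fu /f0 /f1 /orient /cross /x /comb/=; ring.
have [s0|s0] := ltP s 0.
  apply: Or32; exists u, (- s / (1 - s)); rewrite u01.
  have s1 : 0 < 1 - s by lra.
  rewrite divr_ge0 ?(ltW s1) ?oppr_ge0 ?(ltW s0)//= ler_pdivrMr// mul1r.
  split => //; first by lra.
  by rewrite -/x xs; apply: injective_projections; rewrite /comb/=; field; rewrite gt_eqF.
have [s1|s1] := ltP 1 s.
  apply: Or33; exists u, ((s - 1) / s); rewrite u01.
  have s2 : 0 < s by lra.
  rewrite divr_ge0 ?(ltW s2) ?subr_ge0 ?(ltW s1)//= ler_pdivrMr// mul1r.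
  split => //; first by lra.
  by rewrite -/x xs; apply: injective_projections; rewrite /comb/=; field; rewrite gt_eqF.
exfalso; suff : (segment a b `&` segment c d) x by rewrite disj.
split; apply/segmentP; first by exists u.
by exists s => //; rewrite s0.
Qed.

Lemma vertex_neq P i : vertex P i <> vertex P (ordS i).
Proof.
move=> e; have /eqP := no_straight_angle P i; apply.
by rewrite -e subrr /cross/=; ring.
Qed.

Definition in_hull_of_others P i := hull ([set: 'I_5] :\ i)%SET (vertex P) (vertex P i).

(** The edges at [i] and two steps later are disjoint, and as no vertex is in the hull of the others
    only the first alternative of [same_side] survives. It is applied to the line of each edge in
    turn. *)
Lemma same_side_vertices P i : (forall k, ~ in_hull_of_others P k) ->
  0 < orient (vertex P i) (vertex P (ordS (ordS i))) (vertex P (ordS (ordS (ordS i)))) *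
      orient (vertex P (ordS i)) (vertex P (ordS (ordS i))) (vertex P (ordS (ordS (ordS i)))) /\
  0 < orient (vertex P i) (vertex P (ordS i)) (vertex P (ordS (ordS (ordS i)))) *
      orient (vertex P i) (vertex P (ordS i)) (vertex P (ordS (ordS i))).
Proof.
move=> ext.
have disj := nonadjacent_edges P i; rewrite /polygon_edge in disj.
have mem j k : (k == j) = false -> hull ([set: 'I_5] :\ k)%SET (vertex P) (vertex P j).
  by move=> kj; apply: hull_vertex; rewrite !inE eq_sym kj.
have [n1 n2 n3 _] := ordS_neq i.
have [m1 m2 _ _] := ordS_neq (ordS i).
have [l1 _ _ _] := ordS_neq (ordS (ordS i)).
split.
  have [//|[u [s [u01 s01 e]]]|[u [s [u01 s01 e]]]] := same_side (@vertex_neq P (ordS (ordS i))) disj.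
    case: (ext (ordS (ordS i))); rewrite /in_hull_of_others e.
    by apply: hull_comb => //; first apply: hull_comb => //; apply: mem => //; rewrite eq_sym.
  case: (ext (ordS (ordS (ordS i)))); rewrite /in_hull_of_others e.
  by apply: hull_comb => //; first apply: hull_comb => //; apply: mem => //; rewrite eq_sym.
have disj' : segment (vertex P (ordS (ordS i))) (vertex P (ordS (ordS (ordS i)))) `&`
   segment (vertex P i) (vertex P (ordS i)) = set0 by rewrite setIC.
have [h|[u [s [u01 s01 e]]]|[u [s [u01 s01 e]]]] := same_side (@vertex_neq P i) disj'.
- by congr (0 < _): h; rewrite /orient /cross/=; ring.
- case: (ext i); rewrite /in_hull_of_others e.
  by apply: hull_comb => //; first apply: hull_comb => //; apply: mem.
- case: (ext (ordS i)); rewrite /in_hull_of_others e.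
  by apply: hull_comb => //; first apply: hull_comb => //; apply: mem => //; rewrite eq_sym.
Qed.

Lemma hull_others P i : in_hull_of_others P i ->
  region P `<=` hull ([set: 'I_5] :\ i)%SET (vertex P).
Proof.
move=> [w [w0 wS w1 e]] x /region_sub_hull.
have wi : w i = 0 by apply: wS; rewrite !inE eqxx.
apply: (@hull_drop _ _ _ i w) => //; first by rewrite wi.
by move=> j; rewrite finset.in_setT.
Qed.

(** The same-side relations give the fan triangles a common orientation, so their absolute areas add
    up to the shoelace formula without cancellation. *)
Lemma convex_double_area P : (forall k, ~ in_hull_of_others P k) ->
  (area P <= (`|double_area (vertex P)| / 2)%:E)%E.
Proof.
move=> ext.
have S i := same_side_vertices i ext.
pose o := vertex P ord0.
have fan : (area P <= (\sum_(i <- index_enum 'I_5)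
    `|orient o (vertex P i) (vertex P (ordS i))| / 2)%:E)%E.
  apply: (@mu2_cover _ _ _ (fun i => triangle o (vertex P i) (vertex P (ordS i)))) => //.
  - exact: region_measurable.
  - by move=> i; apply: compact_measurable2; exact: triangle_compact.
  - by move=> i; exact: triangle_measure.
  - by move=> x /(@region_sub_fan _ P o)[i _ ?]; exists i => //; rewrite mem_index_enum.
apply: (le_trans fan); rewrite lee_fin -mulr_suml ler_pM2r//.
have Ord3 a b c : [/\ orient a b c = orient b c a & orient a b c = orient c a b].
  by split; rewrite /orient /cross/=; ring.
have [p0 q0] := S ord0; have [p1 q1] := S (ordS ord0); have [p2 q2] := S (ordS (ordS ord0)).
have [p3 q3] := S (ordS (ordS (ordS ord0))).
have [p4 q4] := S (ordS (ordS (ordS (ordS ord0)))).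
rewrite /double_area !(big_ordS5 _ ord0) !ordS5 in p0 q0 p1 q1 p2 q2 p3 q3 p4 q4 *.
rewrite /o; move: p0 q0 p1 q1 p2 q2 p3 q3 p4 q4.
set v0 := vertex P ord0; set v1 := vertex P (ordS ord0); set v2 := vertex P (ordS (ordS ord0)).
set v3 := vertex P (ordS (ordS (ordS ord0))); set v4 := vertex P (ordS (ordS (ordS (ordS ord0)))).
have z1 : orient v0 v0 v1 = 0 by rewrite /orient /cross/=; ring.
have z2 : orient v0 v4 v0 = 0 by rewrite /orient /cross/=; ring.
have -> : cross v0 v1 + cross v1 v2 + cross v2 v3 + cross v3 v4 + cross v4 v0 =
  orient v0 v1 v2 + orient v0 v2 v3 + orient v0 v3 v4 by rewrite /orient /cross/=; ring.
rewrite z1 z2 normr0 add0r addr0.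
have [_ ->] := Ord3 v2 v3 v0; have [_ ->] := Ord3 v3 v4 v0.
have [_ ->] := Ord3 v3 v4 v1; have [-> _] := Ord3 v4 v1 v2.
(* [t0] to [t3] are triples of consecutive vertices. The sign of [d0] passes to [t1] and [t2], and
   from them through [d4] and [d1] to [t0] and [t3]. *)
move: (orient v0 v1 v2) (orient v0 v2 v3) (orient v0 v3 v4) => t0 d0 t3.
move: (orient v1 v2 v3) (orient v2 v3 v4) (orient v1 v3 v4) (orient v1 v2 v4) => t1 t2 d1 d4.
move=> d0t1 _ d1t2 d4t1 _ d0t2 _ d1t3 d4t0 _.
have pos (x y : R) : 0 < x * y -> 0 < x -> 0 < y by move=> xy x0; rewrite pmulr_rgt0 in xy.
have neg (x y : R) : 0 < x * y -> x < 0 -> y < 0 by move=> xy x0; rewrite nmulr_rgt0 in xy.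
have [d0p|d0n] := ltP 0 d0.
  have t1p := pos _ _ d0t1 d0p; have t2p := pos _ _ d0t2 d0p.
  have d1p : 0 < d1 by apply: (pos t2) t2p; rewrite mulrC.
  have d4p : 0 < d4 by apply: (pos t1) t1p; rewrite mulrC.
  have t3p := pos _ _ d1t3 d1p; have t0p := pos _ _ d4t0 d4p.
  by rewrite !gtr0_norm// !addr_gt0.
have {}d0n : d0 < 0.
  by rewrite lt_neqAle d0n andbT; apply/eqP => z; rewrite z mul0r ltxx in d0t1.
have t1p := neg _ _ d0t1 d0n; have t2p := neg _ _ d0t2 d0n.
have d1p : d1 < 0 by apply: (neg t2) t2p; rewrite mulrC.
have d4p : d4 < 0 by apply: (neg t1) t1p; rewrite mulrC.
have t3p := neg _ _ d1t3 d1p; have t0p := neg _ _ d4t0 d4p.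
by rewrite !ltr0_norm ?opprD//; lra.
Qed.

Lemma isoperimetric5_abs (q t : R) (v : 'I_5 -> R * R) :
  0 < q -> q ^+ 2 = 5 -> 0 < t -> t ^+ 2 = 5 - 2 * q ->
  10 * t * `|double_area v| <= closed_length v ^+ 2.
Proof.
move=> q0 q2 t0 t2; have [a0|/ltW a0] := ger0P (double_area v).
  exact: (@isoperimetric5 R q).
pose v' i := ((v i).1, - (v i).2).
have <- : double_area v' = - double_area v.
  by rewrite -sumrN; apply: eq_bigr => i _; rewrite /cross/=; ring.
have <- : closed_length v' = closed_length v.
  by apply: eq_bigr => i _; rewrite /dist/=; congr Num.sqrt; ring.
exact: (@isoperimetric5 R q).
Qed.

(** If a vertex is in the hull of the others, the perimeter is at least 4 and [20 t <= 16];
    otherwise the shoelace formula bounds the area. *)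
Lemma pentagon_isoperimetric (q t : R) P :
  0 < q -> q ^+ 2 = 5 -> 0 < t -> t ^+ 2 = 5 - 2 * q ->
  area P = 1%E -> 20 * t <= perimeter P ^+ 2.
Proof.
move=> q0 q2 t0 t2 P1.
have [[k kP]|next] := pselect (exists k, in_hull_of_others P k).
  have := perimeter_hull4 P1 (hull_others kP).
  have q22 : 22 / 10 <= q by nra.
  have t08 : t <= 8 / 10 by nra.
  nra.
have ext k : ~ in_hull_of_others P k by move=> kP; apply: next; exists k.
have := convex_double_area ext; rewrite P1 lee_fin => A1.
have := isoperimetric5_abs (vertex P) q0 q2 t0 t2; rewrite -[closed_length _]/(perimeter P).
nra.
Qed.

End PentagonIsoperimetry.

(** * Edges of a tiling *)

Section EdgeLengths.
Variable R : realType.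
Implicit Types (x y a b m : R * R) (S : set (R * R)).

Lemma segment_length_ge S r x y :
  S x -> S y -> dist 0 x <= r -> dist 0 y <= r ->
  dist x y <= segment_length (S `&` disk 0 r).
Proof.
move=> Sx Sy xr yr; apply: sup_upper_bound; last by exists x, y.
split; first by exists (dist x y), x, y.
exists (r + r) => _ [x' [y' [[_ x'r] [_ y'r] ->]]].
apply: (le_trans (dist_triangle 0 x' y')).
by rewrite distC; apply: lerD.
Qed.

Lemma segment_length_ge0 S (r : R) : 0 <= segment_length (S `&` disk 0 r).
Proof.
have [->|/set0P[x [Sx xr]]] := eqVneq (S `&` disk 0 r) set0.
  rewrite /segment_length (_ : [set _ | _] = set0) ?sup0//.
  by rewrite -subset0 => d [x [y []]].
by rewrite -(distxx x); exact: segment_length_ge.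
Qed.

Lemma segment_comb a b x y (t : R) : 0 <= t <= 1 ->
  segment a b x -> segment a b y -> segment a b (comb x y t).
Proof.
move=> /andP[t0 t1] /segmentP[u /andP[u0 u1] ->] /segmentP[v /andP[v0 v1] ->].
apply/segmentP; exists ((1 - t) * u + t * v).
  by apply/andP; split; nra.
by apply: injective_projections; rewrite /comb/=; ring.
Qed.

Lemma disk_comb m x y (r t : R) : 0 <= t <= 1 ->
  dist m x <= r -> dist m y <= r -> dist m (comb x y t) <= r.
Proof.
move=> /andP[t0 t1] xr yr; have r0 : 0 <= r := le_trans (dist_ge0 _ _) xr.
rewrite !dist_le// in xr yr *; rewrite /comb/=; move: xr yr; move: (r ^+ 2) => N xN yN.
have -> : (m.1 - ((1 - t) * x.1 + t * y.1)) ^+ 2 + (m.2 - ((1 - t) * x.2 + t * y.2)) ^+ 2 =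
  (1 - t) * ((m.1 - x.1) ^+ 2 + (m.2 - x.2) ^+ 2) + t * ((m.1 - y.1) ^+ 2 + (m.2 - y.2) ^+ 2)
  - t * (1 - t) * ((x.1 - y.1) ^+ 2 + (x.2 - y.2) ^+ 2) by ring.
have : 0 <= t * (1 - t) * ((x.1 - y.1) ^+ 2 + (x.2 - y.2) ^+ 2).
  by rewrite mulr_ge0 ?addr_ge0 ?sqr_ge0// mulr_ge0// subr_ge0.
nra.
Qed.

(** The distance to the origin truncated at [r] is 1-Lipschitz and constant outside the disk, so its
    change is paid for by the part of the segment inside. *)
Lemma segment_length_radial a b x y (r : R) : 0 <= r ->
  segment a b x -> segment a b y ->
  `|Num.min r (dist 0 x) - Num.min r (dist 0 y)| <=
  segment_length (segment a b `&` disk 0 r).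
Proof.
move=> r0; wlog xy : x y / dist 0 x <= dist 0 y.
  move=> H Sx Sy; have [|/ltW] := leP (dist 0 x) (dist 0 y); first by move=> /H; exact.
  by move=> /H; rewrite distrC; exact.
move=> Sx Sy.
have [rx|xr] := leP r (dist 0 x).
  rewrite (min_idPl (le_trans rx xy)) subrr normr0.
  exact: segment_length_ge0.
have [yr|ry] := leP (dist 0 y) r.
  apply: (le_trans _ (segment_length_ge Sx Sy (ltW xr) yr)).
  have := dist_triangle x 0 y.
  rewrite ler_norml; have := dist_ge0 x y => d0 d1; apply/andP; split; lra.
have [t] : exists2 t, t \in `[0, 1] & dist 0 (comb x y t) = r.
  apply: (@IVT _ (fun t => dist 0 (comb x y t)) 0 1 r) => //.
    apply: continuous_subspaceT => t.
    by apply: continuous_comp; [exact: comb_continuous|exact: dist_continuous].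
  by rewrite comb0 comb1 (min_idPl xy) (max_idPr xy) (ltW xr) (ltW ry).
rewrite in_itv/= => t01 tr.
have Sw := segment_comb t01 Sx Sy.
apply: (le_trans _ (segment_length_ge Sx Sw (ltW xr) _)); last by rewrite tr.
have := dist_triangle x 0 (comb x y t); rewrite tr => h.
by rewrite distrC ger0_norm; lra.
Qed.

Lemma segment_compact2 a b : compact (segment a b).
Proof.
have -> : segment a b = comb a b @` `[0, 1] by [].
apply: continuous_compact; last exact: segment_compact.
by apply: continuous_subspaceT; exact: comb_continuous.
Qed.

Lemma segment_closed a b : closed (segment a b).
Proof. by apply: compact_closed => //; exact: segment_compact2. Qed.

Lemma nbhs_dist m (U : set (R * R)) :
  nbhs m U -> exists2 e, 0 < e & forall x, dist m x < e -> U x.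
Proof.
move=> /nbhs_ballP[e /= e0 eU]; exists e => // x mx; apply: eU.
have h (p q : R) : (p ^+ 2 <= (q ^+ 2) -> 0 <= q -> `|p| <= q).
  by move=> pq q0; apply: le_of_sqr => //; rewrite real_normK ?num_real.
have := dist_sqr m x => E.
by split; apply: le_lt_trans mx; apply: h; rewrite ?dist_ge0// E /= ?lerDl ?lerDr sqr_ge0.
Qed.

Lemma dist_nbhs m (e : R) : 0 < e -> nbhs m [set x | dist m x < e].
Proof.
move=> e0; have := @dist_continuous R m m [set y : R | y < e]; rewrite distxx.
by apply; apply: open_nbhs_nbhs; split => //; exact: open_lt.
Qed.

Lemma midpoint_neq a b c d : a <> b -> segment a b = segment c d ->
  comb a b 2^-1 <> c /\ comb a b 2^-1 <> d.
Proof.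
move=> ab abcd.
have := segmentl a b; rewrite abcd => /segmentP[s /andP[s0 s1] aE].
have := segmentr a b; rewrite abcd => /segmentP[t /andP[t0 t1] bE].
have mE : comb a b 2^-1 = comb c d ((s + t) / 2).
  by rewrite aE bE; apply: injective_projections; rewrite /comb/=; field.
have cd : c <> d.
  by move=> cd; apply: ab; rewrite aE bE cd; apply: injective_projections; rewrite /comb/=; ring.
have d0 : 0 < dist c d.
  by rewrite lt_neqAle dist_ge0 andbT; apply/eqP => /esym/dist_eq0.
have st : s <> t by move=> st; apply: ab; rewrite aE bE st.
rewrite mE; split => m.
  have := dist_comb c d ((s + t) / 2); rewrite m distxx => /esym/eqP.
  rewrite mulf_eq0 (gt_eqF d0) orbF normr_eq0 => /eqP h; apply: st; lra.
have := dist_comb c d ((s + t) / 2); rewrite m ger0_norm ?divr_ge0 ?addr_ge0// => h.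
apply: st; have : (s + t) / 2 = 1 by apply: (mulIf (lt0r_neq0 d0)); lra.
lra.
Qed.

Lemma edge_inj (P : pentagon R) i j : edge P i = edge P j -> i = j.
Proof.
move=> ij.
have li : edge P j (vertex P i) by rewrite -ij; exact: segmentl.
have ri : edge P j (vertex P (ordS i)) by rewrite -ij; exact: segmentr.
have mi : edge P i (vertex P i) by exact: segmentl.
have [//|[jE|jE|jE|jE]] := ordS5_cases i j; rewrite jE in li ri; exfalso.
- have : (edge P i `&` edge P (ordS i)) (vertex P i) by [].
  by rewrite [_ `&` _](adjacent_edges P i) => /(@vertex_neq _ P i).
- have : (edge P i `&` edge P (ordS (ordS i))) (vertex P i) by [].
  by rewrite [_ `&` _](nonadjacent_edges P i).
- have := nonadjacent_edges P (ordS (ordS (ordS i))); rewrite ordS5 => h.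
  have : (edge P (ordS (ordS (ordS i))) `&` edge P i) (vertex P i) by [].
  by rewrite [_ `&` _]h.
- have := adjacent_edges P (ordS (ordS (ordS (ordS i)))); rewrite ordS5 => h.
  have : (edge P (ordS (ordS (ordS (ordS i)))) `&` edge P i) (vertex P (ordS i)).
    by split => //; exact: segmentr.
  by rewrite [_ `&` _]h => /esym/(@vertex_neq _ P i).
Qed.

End EdgeLengths.

(** * At most two tiles along an edge *)

Section EdgeMultiplicity.
Variable R : realType.
Implicit Types (x y m u : R * R) (P Q : pentagon R).

(** With [m] the midpoint of an edge and [u] its direction, the half disks for [u] and [- u] are the
    two sides of the edge. *)
Definition half_disk m u (e : R) : set (R * R) :=
  [set x | dist m x < e /\ 0 < cross u (x - m)].

Lemma half_disk_open m u (e : R) : open (half_disk m u e).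
Proof.
have c1 := @continuous_fst R; have c2 := @continuous_snd R.
have k (z : R) := @continuous_cst R (R * R)%type z.
have -> : half_disk m u e = ~` ([set x | e <= dist m x] `|` [set x | cross u (x - m) <= 0]).
  apply/seteqP; split => x /=.
    by move=> [h1 h2] [|]; rewrite leNgt ?h1 ?h2.
  by move=> /not_orP[/negP + /negP]; rewrite -!ltNge.
apply: closed_openC; apply: closedU.
  exact: (@closed_le_fun _ _ (fun=> e) (dist m) (k e) (@dist_continuous R m)).
apply: (@closed_le_fun _ _ (fun x => cross u (x - m)) (fun=> 0)) => //.
apply: continuous_sub; apply: continuous_mul; try exact: k.
  by apply: continuous_sub; [exact: c2|exact: k].
by apply: continuous_sub; [exact: c1|exact: k].
Qed.

Lemma half_disk_comb m u (e : R) x y (t : R) : 0 <= t <= 1 ->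
  half_disk m u e x -> half_disk m u e y -> half_disk m u e (comb x y t).
Proof.
move=> /andP[t0 t1] [xe xu] [ye yu]; split; last first.
  have -> : cross u (comb x y t - m) = (1 - t) * cross u (x - m) + t * cross u (y - m).
    by rewrite /cross /comb/=; ring.
  have [->|tn] := eqVneq t 0; first by rewrite subr0 mul1r mul0r addr0.
  have t' : 0 < t by rewrite lt_neqAle eq_sym tn.
  by apply: ltr_wpDl; [apply: mulr_ge0; [rewrite subr_ge0|exact: ltW]|exact: mulr_gt0].
set M := Num.max (dist m x) (dist m y).
have Me : M < e by rewrite gt_max xe ye.
apply: le_lt_trans Me; apply: disk_comb; first by rewrite t0 t1.
  by rewrite le_max lexx.
by rewrite le_max lexx orbT.
Qed.

Lemma half_disk_nonempty m u (e : R) : 0 < e -> u <> 0 -> half_disk m u e !=set0.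
Proof.
move=> e0 u0.
have n0 : 0 < dist 0 u.
  by rewrite lt_neqAle dist_ge0 andbT; apply/eqP => /esym/dist_eq0/esym.
pose k := e / (2 * dist 0 u).
have k0 : 0 < k by rewrite divr_gt0// mulr_gt0.
exists (m.1 - k * u.2, m.2 + k * u.1); split.
  rewrite (@eq_dist _ _ _ (k * dist 0 u)).
  - by rewrite /k invfM mulrA mulfVK ?gt_eqF//; lra.
  - by rewrite mulr_ge0// ltW.
  - by rewrite exprMn dist_sqr/=; ring.
rewrite /cross/=.
have -> : u.1 * (m.2 + k * u.1 - m.2) - u.2 * (m.1 - k * u.2 - m.1) = k * dist 0 u ^+ 2.
  by rewrite dist_sqr/=; ring.
by rewrite mulr_gt0// exprn_gt0.
Qed.

Lemma edge_local P i : exists2 e, 0 < e & forall x,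
  dist (comb (vertex P i) (vertex P (ordS i)) 2^-1) x < e ->
  (region P `\` interior (region P)) x -> edge P i x.
Proof.
set m := comb _ _ _.
have mi : edge P i m by apply/segmentP; exists 2^-1 => //; apply/andP; split; lra.
have [n1 n2] := midpoint_neq (@vertex_neq _ P i) erefl.
have mk k : k <> i -> ~ edge P k m.
  move=> ki mk; have [//|[kE|kE|kE|kE]] := ordS5_cases i k; rewrite kE in mk.
  - have : (edge P i `&` edge P (ordS i)) m by [].
    by rewrite [_ `&` _](adjacent_edges P i).
  - have : (edge P i `&` edge P (ordS (ordS i))) m by [].
    by rewrite [_ `&` _](nonadjacent_edges P i).
  - have := nonadjacent_edges P (ordS (ordS (ordS i))); rewrite ordS5 => h.
    have : (edge P (ordS (ordS (ordS i))) `&` edge P i) m by [].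
    by rewrite [_ `&` _]h.
  - have := adjacent_edges P (ordS (ordS (ordS (ordS i)))); rewrite ordS5 => h.
    have : (edge P (ordS (ordS (ordS (ordS i)))) `&` edge P i) m by [].
    by rewrite [_ `&` _]h.
have : nbhs m [set x | forall k, k <> i -> ~ edge P k x].
  apply: (@filter_forall _ _ (fun k => [set x | k <> i -> ~ edge P k x]) (nbhs m)) => k.
  have [->|/eqP ki] := eqVneq k i.
    by apply: (@filterS _ (nbhs m) _ setT) => [x _ /(_ erefl)|] //; exact: filterT.
  have : nbhs m (~` edge P k).
    apply: open_nbhs_nbhs; split; last exact: mk.
    by apply: closed_openC; exact: segment_closed.
  by apply: filterS => x nx _.
move=> /nbhs_dist[e e0 eU]; exists e => // x mx /boundaryP[k Ek].
have [<-//|/eqP ki] := eqVneq k i.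
by case: (eU x mx k ki).
Qed.

(** A half disk is convex and avoids the boundary, which near [m] lies on the line; a segment in it
    cannot leave the region. *)
Lemma half_disk_sub P m u (e : R) :
  (forall x, dist m x < e -> (region P `\` interior (region P)) x -> cross u (x - m) = 0) ->
  half_disk m u e `&` region P !=set0 -> half_disk m u e `<=` interior (region P).
Proof.
move=> bd [y [yH yP]].
suff sub : half_disk m u e `<=` region P.
  by rewrite -open_subsetE//; exact: half_disk_open.
move=> z zH; apply: contrapT => zP.
have [t t01 bt] := exit_segment (@region_compact _ P) yP zP.
have [d c] := half_disk_comb t01 yH zH.
by rewrite (bd _ d bt) ltxx in c.
Qed.

(** Regularity supplies interior points arbitrarily near the midpoint, and one of them off the line
    fills its whole side. *)
Lemma edge_one_side P i m u (e : R) : 0 < e -> u <> 0 ->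
  comb (vertex P i) (vertex P (ordS i)) 2^-1 = m ->
  (forall x, dist m x < e -> (region P `\` interior (region P)) x -> cross u (x - m) = 0) ->
  half_disk m u e `<=` interior (region P) \/ half_disk m (- u) e `<=` interior (region P).
Proof.
move=> e0 u0 mE bd.
have bd' x : dist m x < e -> (region P `\` interior (region P)) x -> cross (- u) (x - m) = 0.
  by move=> mx /(bd x mx) h; rewrite -[LHS]opprK -[RHS]oppr0 -h /cross/=; ring.
have mP : closure (interior (region P)) m.
  rewrite region_regular; apply: (@edge_sub_region _ P i).
  by apply/segmentP; exists 2^-1 => //; apply/andP; split; lra.
have [y [yi ym]] := mP _ (dist_nbhs m e0).
have yP := interior_subset yi.
have [c|c|c] := ltgtP 0 (cross u (y - m)).
- by left; apply: half_disk_sub => //; exists y.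
- right; apply: half_disk_sub => //; exists y; split => //; split => //.
  by move: c; rewrite -oppr_gt0; congr (0 < _); rewrite /cross/=; ring.
(* The interior point found lies on the line; a nearby point of the region lies strictly to the
   left. *)
have [d d0 dU] : exists2 d, 0 < d & forall x, dist y x < d -> (interior (region P) `&` [set x | dist m x < e]) x.
  apply: nbhs_dist; apply: filterI.
    by apply: open_nbhs_nbhs; split => //; exact: open_interior.
  have em : 0 < e - dist m y by rewrite subr_gt0.
  apply: filterS (dist_nbhs y em) => x /= yx.
  by have := dist_triangle y m x; lra.
have [z [zd zc]] := half_disk_nonempty y d0 u0.
have [zP zm] := dU _ zd.
left; apply: half_disk_sub => //; exists z; split; last exact: interior_subset.
split => //; rewrite (_ : cross u (z - m) = cross u (z - y) + cross u (y - m)).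
  by rewrite -c addr0.
by rewrite /cross/=; ring.
Qed.

Lemma tiling_eq (T : set (pentagon R)) P Q (U : set (R * R)) : tiling T -> T P -> T Q ->
  U !=set0 -> U `<=` interior (region P) -> U `<=` interior (region Q) -> P = Q.
Proof.
move=> [_ disj] TP TQ [x Ux] UP UQ; apply: contrapT => PQ.
have : (interior (region P) `&` interior (region Q)) x by split; [exact: UP|exact: UQ].
by rewrite disj.
Qed.

(** Near the common midpoint each tile fills one of two half disks. By pigeonhole two of the three
    fill the same one, and disjoint interiors make them equal. *)
Lemma edge_at_most_two (T : set (pentagon R)) P1 P2 P3 i1 i2 i3 : tiling T ->
  T P1 -> T P2 -> T P3 -> edge P1 i1 = edge P2 i2 -> edge P1 i1 = edge P3 i3 ->
  [\/ (P1, i1) = (P2, i2), (P1, i1) = (P3, i3) | (P2, i2) = (P3, i3)].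
Proof.
move=> tT T1 T2 T3 e12 e13.
pose a := vertex P1 i1; pose b := vertex P1 (ordS i1); pose m := comb a b 2^-1.
have ab : a <> b := @vertex_neq _ P1 i1.
pose u := b - a.
have u0 : u <> 0 by move=> /eqP; rewrite subr_eq0 => /eqP/esym.
(* Edges are equal as sets, possibly with exchanged endpoints; the midpoint is the same either
   way. *)
have mid c d : segment a b = segment c d -> c <> d -> comb c d 2^-1 = m.
  move=> abcd cd.
  have := segmentl a b; rewrite abcd => /segmentP[s /andP[s0 s1] aE].
  have := segmentr a b; rewrite abcd => /segmentP[t /andP[t0 t1] bE].
  have := segmentl c d; rewrite -abcd => /segmentP[s' /andP[s'0 s'1] cE].
  have := segmentr c d; rewrite -abcd => /segmentP[t' /andP[t'0 t'1] dE].
  have d0 : 0 < dist c d.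
    by rewrite lt_neqAle dist_ge0 andbT; apply/eqP => /esym/dist_eq0.
  have ab' : dist a b = `|t - s| * dist c d.
    rewrite aE bE; apply: eq_dist; first by rewrite mulr_ge0// dist_ge0.
    by rewrite exprMn real_normK ?num_real// dist_sqr /comb/=; ring.
  have cd' : dist c d = `|t' - s'| * dist a b.
    rewrite cE dE; apply: eq_dist; first by rewrite mulr_ge0// dist_ge0.
    by rewrite exprMn real_normK ?num_real// dist_sqr /comb/=; ring.
  have ts : `|t - s| = 1.
    have h1 : `|t - s| <= 1 by rewrite ler_norml; apply/andP; split; lra.
    have h2 : `|t' - s'| <= 1 by rewrite ler_norml; apply/andP; split; lra.
    have h : `|t' - s'| * `|t - s| = 1.
      by apply: (mulIf (lt0r_neq0 d0)); rewrite mul1r -mulrA -ab' -cd'.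
    have := normr_ge0 (t - s); have := normr_ge0 (t' - s'); nra.
  have st : s + t = 1 by move: ts; case: ger0P => _ ts; lra.
  have t1s : t = 1 - s by lra.
  by rewrite /m aE bE t1s; apply: injective_projections; rewrite /comb/=; field.
have line x : segment a b x -> cross u (x - m) = 0.
  by move=> /segmentP[t _ ->]; rewrite /cross /comb/= /m /comb/= -/a -/b; field.
have side P i : edge P1 i1 = edge P i -> exists2 e, 0 < e & forall e', 0 < e' <= e ->
    half_disk m u e' `<=` interior (region P) \/ half_disk m (- u) e' `<=` interior (region P).
  move=> eP; have mE := mid _ _ eP (@vertex_neq _ P i).
  have [e e0 eU] := edge_local P i; exists e => // e' /andP[e'0 e'e].
  apply: (@edge_one_side P i) => // x mx bx; apply: line.
  change (edge P1 i1 x); rewrite eP; apply: eU => //; rewrite mE.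
  exact: lt_le_trans e'e.
have [e1 e10 s1] := side _ _ (erefl (edge P1 i1)).
have [e2 e20 s2] := side _ _ e12; have [e3 e30 s3] := side _ _ e13.
pose e := Num.min e1 (Num.min e2 e3).
have e0 : 0 < e by rewrite !lt_min e10 e20 e30.
have [l1 l2 l3] : [/\ e <= e1, e <= e2 & e <= e3] by rewrite !ge_min !lexx !orbT.
have nu : - u <> 0 by move=> h; apply: u0; rewrite -[u]opprK h oppr0.
have H1 := half_disk_nonempty m e0 u0; have H2 := half_disk_nonempty m e0 nu.
have same P Q i j : T P -> T Q -> edge P i = edge Q j ->
    half_disk m u e `<=` interior (region P) /\ half_disk m u e `<=` interior (region Q) \/
    half_disk m (- u) e `<=` interior (region P) /\ half_disk m (- u) e `<=` interior (region Q) ->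
    (P, i) = (Q, j).
  move=> TP TQ PQ h; have e' : P = Q.
    by case: h => -[hP hQ]; [exact: (tiling_eq tT TP TQ H1)|exact: (tiling_eq tT TP TQ H2)].
  by rewrite -e' in PQ *; rewrite (edge_inj PQ).
have e23 : edge P2 i2 = edge P3 i3 by rewrite -e12.
have := s1 e; have := s2 e; have := s3 e; rewrite e0 l1 l2 l3 => /(_ isT) h3 /(_ isT) h2 /(_ isT) h1.
case: h1 h2 h3 => h1 [] h2 [] h3.
- by apply: Or31; apply: same => //; left.
- by apply: Or31; apply: same => //; left.
- by apply: Or32; apply: same => //; left.
- by apply: Or33; apply: same => //; right.
- by apply: Or33; apply: same => //; left.
- by apply: Or32; apply: same => //; right.
- by apply: Or31; apply: same => //; right.
- by apply: Or31; apply: same => //; right.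
Qed.

End EdgeMultiplicity.

(** * Edge length inside a disk *)

Section Counting.
Variable R : realType.
Implicit Types (P : pentagon R) (T : set (pentagon R)).

Definition inside_length (r : R) P : R :=
  \sum_i segment_length (edge P i `&` disk 0 r).

(** Since the tile meets the small disk without containing it, some boundary point is in there. From
    it the boundary is followed to a vertex beyond [r], and the growth of the truncated distance to
    the origin is charged edge by edge. *)
Lemma crossing_length (rho r : R) P : 0 <= rho -> rho <= r ->
  region P `&` disk 0 rho !=set0 -> ~ (disk 0 rho `<=` region P) ->
  ~ (region P `<=` disk 0 r) -> r - rho <= inside_length r P.
Proof.
move=> rho0 rhor [a [Pa a_rho]] /existsNP[z /not_implyP[z_rho Pz]] /existsNP[y /not_implyP[Py yr]].
have r0 : 0 <= r by exact: le_trans rhor.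
have [t t01 /boundaryP[k bk]] := exit_segment (@region_compact _ P) Pa Pz.
set b := comb a z t in bk.
have b_rho : dist 0 b <= rho by exact: disk_comb.
have {}yr : r < dist 0 y by rewrite ltNge; apply/negP.
have y0 : 0 <> y by move=> y0; rewrite -y0 distxx in yr; lra.
have [l l1 /boundaryP[i /segmentP[u u01 yE]]] := exit_ray (@region_compact _ P) Py y0.
(* A disk is convex, so an edge with a point outside it has an endpoint outside. *)
have [j jr] : exists j, r < dist 0 (vertex P j).
  have [h1|h1] := ltP r (dist 0 (vertex P i)); first by exists i.
  have [h2|h2] := ltP r (dist 0 (vertex P (ordS i))); first by exists (ordS i).
  have := disk_comb u01 h1 h2; rewrite -yE dist_comb ger0_norm; last by lra.
  have := dist_ge0 0 y; nra.
pose h x := Num.min r (dist 0 x).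
have Lh m : h (vertex P (ordS m)) - h (vertex P m) <= segment_length (edge P m `&` disk 0 r).
  apply: (le_trans (ler_norm _)).
  by apply: segment_length_radial => //; [exact: segmentr|exact: segmentl].
have Lb : h (vertex P (ordS k)) - h b <= segment_length (edge P k `&` disk 0 r).
  apply: (le_trans (ler_norm _)).
  by apply: segment_length_radial => //; exact: segmentr.
have hb : h b <= rho by rewrite /h ge_min b_rho orbT.
have hj : h (vertex P j) = r by rewrite /h; apply/min_idPl; exact: ltW.
have L0 m : 0 <= segment_length (edge P m `&` disk 0 r) by exact: segment_length_ge0.
rewrite /inside_length (big_ordS5 _ k).
have := Lh (ordS k); have := Lh (ordS (ordS k)); have := Lh (ordS (ordS (ordS k))).
have := Lh (ordS (ordS (ordS (ordS k)))); rewrite ordS5.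
have := L0 k; have := L0 (ordS k); have := L0 (ordS (ordS k)); have := L0 (ordS (ordS (ordS k))).
have := L0 (ordS (ordS (ordS (ordS k)))).
by have [jE|[jE|jE|jE|jE]] := ordS5_cases k j; rewrite jE in hj; lra.
Qed.

Lemma perimeter_inside_length (r : R) P : region P `<=` disk 0 r ->
  perimeter P <= inside_length r P.
Proof.
move=> Pr; apply: ler_sum => i _.
by apply: segment_length_ge; [exact: segmentl|exact: segmentr| |];
  apply: Pr; apply: (@edge_sub_region _ P i); [exact: segmentl|exact: segmentr].
Qed.

Lemma sum_undup_le (I : eqType) (l : seq I) (g : I -> R) (n : nat) :
  (forall x, 0 <= g x) -> (forall x, (count_mem x l <= n)%N) ->
  \sum_(x <- l) g x <= n%:R * \sum_(x <- undup l) g x.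
Proof.
move=> g0 ln; rewrite -big_undup_iterop_count mulr_sumr.
apply: ler_sum => x _; rewrite -[iterop _ _ _ _]/(g x *+ count_mem x l).
by rewrite -[g x *+ _]mulr_natl ler_wpM2r// ler_nat.
Qed.

(** Among all pairs of a tile and an index each edge occurs at most twice; removing duplicates costs
    a factor 2 and leaves a finite partial sum of the edge length. *)
Lemma inside_length_sum T (r : R) (s : seq (pentagon R)) :
  tiling T -> uniq s -> (forall P, P \in s -> T P) ->
  ((\sum_(P <- s) inside_length r P)%:E <= 2%:E * perimeter_inside T r)%E.
Proof.
move=> tT us sT.
pose pairs := [seq (P, i) | P <- s, i <- index_enum 'I_5].
pose f (p : pentagon R * 'I_5) := edge p.1 p.2.
pose g (S : set (R * R)) := segment_length (S `&` disk 0 r).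
have g0 S : 0 <= g S by exact: segment_length_ge0.
have -> : \sum_(P <- s) inside_length r P = \sum_(S <- map f pairs) g S.
  by rewrite big_map big_allpairs.
have up : uniq pairs by apply: allpairs_uniq => //; [exact: index_enum_uniq|move=> [? ?] [? ?]].
have count2 S : (count_mem S (map f pairs) <= 2)%N.
  rewrite count_map leqNgt; apply/negP.
  set p := preim f (pred1 S); rewrite -size_filter.
  have uf : uniq (seq.filter p pairs) by rewrite filter_uniq.
  have mf q : q \in seq.filter p pairs -> T q.1 /\ f q = S.
    rewrite mem_filter => /andP[/eqP fq /allpairsP[[P i] /= [Ps _ qE]]].
    by split => //; rewrite qE; exact: sT.
  case: (seq.filter p pairs) uf mf => [|[P1 i1] [|[P2 i2] [|[P3 i3] l]]]//= uf mf _.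
  have [T1 E1] := mf (P1, i1) (mem_head _ _).
  have [|T2 E2] := mf (P2, i2); first by rewrite !inE eqxx orbT.
  have [|T3 E3] := mf (P3, i3); first by rewrite !inE eqxx !orbT.
  move: uf; rewrite /f/= in E1 E2 E3.
  have := edge_at_most_two tT T1 T2 T3 (etrans E1 (esym E2)) (etrans E1 (esym E3)).
  by case=> ->; rewrite !inE eqxx ?orbT//= ?andbF.
apply: (@le_trans _ _ (2 * \sum_(S <- undup (map f pairs)) g S)%:E).
  by rewrite lee_fin; exact: sum_undup_le.
rewrite EFinM lee_wpmul2l//.
apply: esum_ge; exists [set` undup (map f pairs)].
  split; first exact: finite_seq.
  move=> S /=; rewrite mem_undup => /mapP[q qp ->].
  move: qp => /allpairsP[[P i] /= [Ps _ ->]].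
  by exists P, i; split => //; exact: sT.
by rewrite -fsbig_seq ?undup_uniq// sumEFin.
Qed.

End Counting.

(** * Pentagons cut out by half-planes *)

Section ConvexPentagon.
Variables (R : realType) (v : 'I_5 -> R * R).
Hypothesis convex_v : forall i k, k != i -> k != ordS i ->
  0 < orient (v i) (v (ordS i)) (v k).
Implicit Types (i k : 'I_5) (x y : R * R).

Let f i x := orient (v i) (v (ordS i)) x.

Lemma orient_comb a b x y (t : R) :
  orient a b (comb x y t) = (1 - t) * orient a b x + t * orient a b y.
Proof. by rewrite /orient /cross /comb/=; ring. Qed.

Lemma orient_l (a b : R * R) : orient a b a = 0.
Proof. by rewrite /orient /cross/=; ring. Qed.

Lemma orient_r (a b : R * R) : orient a b b = 0.
Proof. by rewrite /orient /cross/=; ring. Qed.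

Lemma orient_continuous (a b : R * R) : continuous (orient a b).
Proof.
have c1 := @continuous_fst R; have c2 := @continuous_snd R.
have k (z : R) := @continuous_cst R (R * R)%type z.
apply: continuous_sub; apply: continuous_mul; try exact: k.
  by apply: continuous_sub; [exact: c2|exact: k].
by apply: continuous_sub; [exact: c1|exact: k].
Qed.

(** For vertices in counterclockwise convex position, linear inequalities describe the region, and
    each field of [pentagon] becomes a matter of signs. *)
Definition half_planes : set (R * R) := [set x | forall i, 0 <= f i x].

Definition open_half_planes : set (R * R) := [set x | forall i, 0 < f i x].

Lemma orient_vertex_ge0 i k : 0 <= f i (v k).
Proof.
have [->|ki] := eqVneq k i; first by rewrite /f orient_l.
have [->|kSi] := eqVneq k (ordS i); first by rewrite /f orient_r.
by rewrite ltW// convex_v.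
Qed.

Lemma polygon_edge_half_planes i : polygon_edge v i `<=` half_planes.
Proof.
move=> x /segmentP[t /andP[t0 t1] ->] k.
have t1' : 0 <= 1 - t by rewrite subr_ge0.
rewrite /f orient_comb.
by apply: addr_ge0; apply: mulr_ge0 => //; exact: orient_vertex_ge0.
Qed.

Lemma ordS_neqs i : [/\ i != ordS i, ordS (ordS i) != i, ordS (ordS i) != ordS i,
  ordS (ordS (ordS i)) != i & ordS (ordS (ordS i)) != ordS i].
Proof. by case: i => -[|[|[|[|[|//]]]]]. Qed.

Lemma convex_adjacent i : polygon_edge v i `&` polygon_edge v (ordS i) = [set v (ordS i)].
Proof.
apply/seteqP; split => [x [/segmentP[t /andP[t0 t1] xE] /segmentP[u _ xE']]|x ->]; last first.
  by split; [exact: segmentr|exact: segmentl].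
have h : f (ordS i) x = 0 by rewrite xE' /f orient_comb orient_l orient_r !mulr0 addr0.
move: h; rewrite xE /f orient_comb orient_l mulr0 addr0 => /eqP.
have [n1 n2 n3 n4 n5] := ordS_neqs i.
rewrite mulf_eq0 (gt_eqF (convex_v _ _)) ?orbF//; last by rewrite eq_sym.
by rewrite subr_eq0 => /eqP <-; rewrite comb1.
Qed.

Lemma convex_nonadjacent i : polygon_edge v i `&` polygon_edge v (ordS (ordS i)) = set0.
Proof.
rewrite -subset0 => x [/segmentP[t _ xE] /segmentP[u /andP[u0 u1] xE']].
have h : f i x = 0 by rewrite xE /f orient_comb orient_l orient_r !mulr0 addr0.
have [n1 n2 n3 n4 n5] := ordS_neqs i.
have p1 := convex_v n2 n3; have p2 := convex_v n4 n5.
move: h; rewrite xE' /f orient_comb => h.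
suff : 0 < (1 - u) * orient (v i) (v (ordS i)) (v (ordS (ordS i))) +
   u * orient (v i) (v (ordS i)) (v (ordS (ordS (ordS i)))) by rewrite h ltxx.
have [->|un] := eqVneq u 0; first by rewrite subr0 mul1r mul0r addr0.
have u' : 0 < u by rewrite lt_neqAle eq_sym un.
by apply: ltr_wpDl; [apply: mulr_ge0; [rewrite subr_ge0|exact: ltW]|exact: mulr_gt0].
Qed.

Lemma convex_not_straight i :
  cross (v (ordS i) - v i) (v (ordS (ordS i)) - v (ordS i)) != 0.
Proof.
have [n1 n2 n3 n4 n5] := ordS_neqs i.
have := convex_v n2 n3; rewrite /orient.
have -> : cross (v (ordS i) - v i) (v (ordS (ordS i)) - v i) =
  cross (v (ordS i) - v i) (v (ordS (ordS i)) - v (ordS i)) by rewrite /cross/=; ring.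
by move=> h; rewrite gt_eqF.
Qed.

(** The barycentric coordinates are the ratios of signed areas. *)
Lemma orient_triangle (a b c x : R * R) : 0 < orient a b c ->
  0 <= orient a b x -> 0 <= orient b c x -> 0 <= orient c a x -> triangle a b c x.
Proof.
move=> abc abx bcx cax.
exists (orient c a x / orient a b c), (orient a b x / orient a b c).
have D0 : orient a b c != 0 by rewrite gt_eqF.
have s1 : orient a b x + orient b c x + orient c a x = orient a b c.
  by rewrite /orient /cross/=; ring.
split; rewrite ?divr_ge0 ?(ltW abc)//.
  by rewrite -mulrDl ler_pdivrMr// mul1r -s1; lra.
apply: injective_projections => /=; apply: (mulIf D0).
  have -> : (a.1 + orient c a x / orient a b c * (b.1 - a.1) + orient a b x / orient a b c * (c.1 - a.1)) * orient a b c =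
    a.1 * orient a b c + orient c a x * (b.1 - a.1) + orient a b x * (c.1 - a.1) by field.
  by rewrite /orient /cross/=; ring.
have -> : (a.2 + orient c a x / orient a b c * (b.2 - a.2) + orient a b x / orient a b c * (c.2 - a.2)) * orient a b c =
  a.2 * orient a b c + orient c a x * (b.2 - a.2) + orient a b x * (c.2 - a.2) by field.
by rewrite /orient /cross/=; ring.
Qed.

Let v0 := v ord0.
Let v1 := v (ordS ord0).
Let v2 := v (ordS (ordS ord0)).
Let v3 := v (ordS (ordS (ordS ord0))).
Let v4 := v (ordS (ordS (ordS (ordS ord0)))).

(** The diagonals from [v0] sort the points into three triangles. This gives boundedness, and later
    the upper bound on the area. *)
Lemma half_planes_sub_triangles :
  half_planes `<=` triangle v0 v1 v2 `|` (triangle v0 v2 v3 `|` triangle v0 v3 v4).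
Proof.
move=> x Hx.
have h0 := Hx ord0; have h1 := Hx (ordS ord0); have h2 := Hx (ordS (ordS ord0)).
have h3 := Hx (ordS (ordS (ordS ord0))); have h4 := Hx (ordS (ordS (ordS (ordS ord0)))).
rewrite /f ordS5 -/v0 -/v1 -/v2 -/v3 -/v4 in h0 h1 h2 h3 h4.
have c012 : 0 < orient v0 v1 v2 by exact: convex_v.
have c034 : 0 < orient v0 v3 v4.
  have -> : orient v0 v3 v4 = orient v3 v4 v0 by rewrite /orient /cross/=; ring.
  exact: convex_v.
have c023 : 0 < orient v0 v2 v3.
  have -> : orient v0 v2 v3 = orient v2 v3 v0 by rewrite /orient /cross/=; ring.
  exact: convex_v.
have flip a b : orient b a x = - orient a b x by rewrite /orient /cross/=; ring.
have [s2|s2] := ltP (orient v0 v2 x) 0.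
  by left; apply: orient_triangle => //; rewrite flip oppr_ge0 ltW.
right; have [s3|s3] := ltP (orient v0 v3 x) 0.
  by left; apply: orient_triangle => //; rewrite flip oppr_ge0 ltW.
by right; apply: orient_triangle.
Qed.

Lemma half_planes_closed : closed half_planes.
Proof.
have -> : half_planes = \bigcap_i [set x | 0 <= f i x].
  by apply/seteqP; split => x Hx i; [move=> _|]; apply: Hx.
apply: closed_bigI => i _.
exact: (@closed_le_fun _ _ (fun=> 0) (f i) (@continuous_cst R _ 0) (@orient_continuous _ _)).
Qed.

Lemma half_planes_compact : compact half_planes.
Proof.
apply: (subclosed_compact half_planes_closed _ half_planes_sub_triangles).
by do 2?(apply: compactU; first exact: triangle_compact); exact: triangle_compact.
Qed.

Lemma open_half_planes_open : open open_half_planes.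
Proof.
have -> : open_half_planes = ~` (\bigcup_(i in [set: 'I_5]) [set x | f i x <= 0]).
  apply/seteqP; split => x /= Hx; first by move=> [i _ /=]; rewrite leNgt Hx.
  by move=> i; rewrite ltNge; apply/negP => h; apply: Hx; exists i.
apply: closed_openC; apply: closed_bigcup => [|i _]; first exact: finite_finset.
exact: (@closed_le_fun _ _ (f i) (fun=> 0) (@orient_continuous _ _) (@continuous_cst R _ 0)).
Qed.

Lemma half_planes_interior : interior half_planes = open_half_planes.
Proof.
apply/seteqP; split; last first.
  rewrite -open_subsetE; last exact: open_half_planes_open.
  by move=> x Hx i; exact: ltW.
move=> x xi i; have Hx := interior_subset xi.
rewrite lt_neqAle Hx andbT; apply/eqP => /esym fx0.
have [n1 n2 n3 n4 n5] := ordS_neqs i.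
have fk : 0 < f i (v (ordS (ordS i))) by exact: convex_v.
(* From a point with [f i x = 0], moving away from a vertex where [f i] is positive makes [f i]
   negative. *)
have : nbhs (0 : R) (comb x (v (ordS (ordS i))) @^-1` half_planes).
  by apply: comb_continuous; rewrite comb0.
move=> /nbhs_ballP[e /= e0 eH].
have : half_planes (comb x (v (ordS (ordS i))) (- (e / 2))).
  apply: eH; rewrite /ball/= sub0r opprK gtr0_norm ?divr_gt0//; lra.
move=> /(_ i); rewrite /f orient_comb -/(f i x) fx0 mulr0 add0r -/(f i _).
by have := mulr_gt0 (divr_gt0 e0 (ltr0n R 2)) fk; rewrite mulNr; lra.
Qed.

Lemma half_planes_regular : closure (interior half_planes) = half_planes.
Proof.
apply/seteqP; split => x.
  by move=> /(closure_subset (@interior_subset _ _)); exact: half_planes_closed.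
move=> Hx B Bx.
(* The centroid of the vertices satisfies all inequalities strictly, so [x] is approached from the
   interior along the segment to it. *)
pose c : R * R := ((\sum_k (v k).1) / 5, (\sum_k (v k).2) / 5).
have fc i : 0 < f i c.
  have -> : f i c = (\sum_k f i (v k)) / 5.
    by rewrite /c !(big_ordS5 _ i) /f /orient /cross/=; field.
  rewrite divr_gt0// (big_ordS5 _ i).
  have [n1 n2 n3 n4 n5] := ordS_neqs i.
  have p1 : 0 < f i (v (ordS (ordS i))) by exact: convex_v.
  have p2 : 0 < f i (v (ordS (ordS (ordS i)))) by exact: convex_v.
  have := orient_vertex_ge0 i i; have := orient_vertex_ge0 i (ordS i).
  have := orient_vertex_ge0 i (ordS (ordS (ordS (ordS i)))); lra.
have : nbhs (0 : R) (comb x c @^-1` B) by apply: comb_continuous; rewrite comb0.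
move=> /nbhs_ballP[e /= e0 eB].
pose d := Num.min (e / 2) 2^-1.
have d0 : 0 < d by rewrite lt_min divr_gt0//=.
have de : d <= e / 2 by rewrite /d ge_min lexx.
have d1 : d <= 2^-1 by rewrite /d ge_min lexx orbT.
exists (comb x c d); split; last first.
  by apply: eB; rewrite /ball/= sub0r normrN gtr0_norm//; lra.
rewrite half_planes_interior => i; rewrite /f orient_comb.
apply: ltr_wpDl; last by apply: mulr_gt0 => //; exact: fc.
by apply: mulr_ge0; [lra|exact: Hx].
Qed.

Lemma half_planes_boundary :
  half_planes `\` interior half_planes = \bigcup_i polygon_edge v i.
Proof.
rewrite half_planes_interior; apply/seteqP; split => x; last first.
  move=> [i _ Ei]; split; first exact: (polygon_edge_half_planes Ei).
  move=> /(_ i); case/segmentP: Ei => t _ ->.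
  by rewrite /f orient_comb orient_l orient_r !mulr0 addr0 ltxx.
move=> [Hx /existsNP[i /negP]]; rewrite -leNgt => fi.
have {}fi : f i x = 0 by apply/eqP; rewrite eq_le fi Hx.
have [n1 n2 n3 n4 n5] := ordS_neqs i.
have vi : v i <> v (ordS i).
  by move=> e; have := convex_v n2 n3; rewrite -e /orient subrr /cross/= !mul0r subrr ltxx.
have [s xs] := collinear_comb vi fi.
(* The half-plane of the previous edge gives [0 <= s], that of the next edge [s <= 1]. *)
exists i => //; apply/segmentP; exists s => //; apply/andP; split.
  have p : 0 < orient (v (ordS (ordS (ordS (ordS i))))) (v i) (v (ordS i)).
    have := @convex_v (ordS (ordS (ordS (ordS i)))) (ordS i); rewrite ordS5; apply.
      by case: (i) => -[|[|[|[|[|//]]]]].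
    by rewrite eq_sym.
  have := Hx (ordS (ordS (ordS (ordS i)))).
  by rewrite /f xs orient_comb ordS5 orient_r mulr0 add0r pmulr_lge0.
have := Hx (ordS i); rewrite /f xs orient_comb orient_l mulr0 addr0 pmulr_lge0 ?subr_ge0//.
by apply: convex_v => //; rewrite eq_sym.
Qed.

End ConvexPentagon.

(** * Cones in polar coordinates and trigonometric values *)

Section Angles.
Variable R : realType.
Implicit Types (a b : R) (x y u w : R * R).

Lemma unit_vector_angle a b : a ^+ 2 + b ^+ 2 = 1 -> exists t, cos t = a /\ sin t = b.
Proof.
move=> ab1.
have a1 : -1 <= a <= 1 by apply/andP; split; nra.
have := sqr_ge0 b => b2.
have sb : Num.sqrt (1 - a ^+ 2) = `|b|.
  have -> : 1 - a ^+ 2 = b ^+ 2 by lra.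
  by rewrite sqrtr_sqr.
have [b0|b0] := leP 0 b.
  exists (acos a); split; first by rewrite acosK// in_itv.
  by rewrite sin_acos// sb ger0_norm.
exists (- acos a); split; first by rewrite cosN acosK// in_itv.
by rewrite sinN sin_acos// sb ltr0_norm// opprK.
Qed.

(** At radius [rho] and angle [phi] the two cross products are [rho sin (phi - alpha)] and
    [rho sin (alpha + th - phi)]. *)
Lemma coneP (alpha th : R) y : 0 < th < pi ->
  (0 <= cross (cos alpha, sin alpha) y /\ 0 <= cross y (cos (alpha + th), sin (alpha + th))) <->
  exists rho phi, [/\ 0 <= rho, alpha <= phi <= alpha + th & y = (rho * cos phi, rho * sin phi)].
Proof.
move=> /andP[th0 thpi]; have pi0 := pi_gt0 R.
split=> [[c1 c2]|[rho [phi [rho0 /andP[p1 p2] ->]]]]; last first.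
  have -> : cross (cos alpha, sin alpha) (rho * cos phi, rho * sin phi) = rho * sin (phi - alpha).
    by rewrite /cross/= sinB; ring.
  have -> : cross (rho * cos phi, rho * sin phi) (cos (alpha + th), sin (alpha + th)) =
    rho * sin (alpha + th - phi) by rewrite /cross/= (sinB (alpha + th)); ring.
  by split; apply: mulr_ge0 => //; apply: sin_ge0_pi; apply/andP; split; lra.
pose rho := dist 0 y.
have [r0|r0] := eqVneq rho 0.
  exists 0, alpha; split; rewrite ?lexx ?lerDl ?(ltW th0)//.
  by rewrite -(dist_eq0 r0) !mul0r.
have rp : 0 < rho by rewrite lt_neqAle eq_sym r0 dist_ge0.
pose p := dot (cos alpha, sin alpha) y; pose q := cross (cos alpha, sin alpha) y.
have cs := cos2Dsin2 alpha.
have pq : (p / rho) ^+ 2 + (q / rho) ^+ 2 = 1.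
  have -> : (p / rho) ^+ 2 + (q / rho) ^+ 2 = (p ^+ 2 + q ^+ 2) / rho ^+ 2 by field.
  have -> : p ^+ 2 + q ^+ 2 = (cos alpha ^+ 2 + sin alpha ^+ 2) * rho ^+ 2.
    by rewrite /p /q /rho dist_sqr /dot /cross/=; ring.
  by rewrite cs mul1r divff// sqrf_eq0.
have p1 : -1 <= p / rho <= 1 by apply/andP; split; nra.
have q0 : 0 <= q / rho by rewrite divr_ge0// ltW.
pose psi := acos (p / rho).
have cpsi : cos psi = p / rho by rewrite acosK// in_itv.
have spsi : sin psi = q / rho.
  have e : 1 - (p / rho) ^+ 2 = (q / rho) ^+ 2 by lra.
  by rewrite sin_acos// e sqrtr_sqr ger0_norm.
have psi0 : 0 <= psi by exact: acos_ge0.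
have psipi : psi <= pi by exact: acos_lepi.
have yE : y = (rho * cos (alpha + psi), rho * sin (alpha + psi)).
  rewrite cosD sinD cpsi spsi.
  have -> : rho * (cos alpha * (p / rho) - sin alpha * (q / rho)) = cos alpha * p - sin alpha * q by field.
  have -> : rho * (sin alpha * (p / rho) + cos alpha * (q / rho)) = sin alpha * p + cos alpha * q by field.
  apply: injective_projections; rewrite /p /q /dot /cross/=.
    have -> : cos alpha * (cos alpha * y.1 + sin alpha * y.2) - sin alpha * (cos alpha * y.2 - sin alpha * y.1) =
      (cos alpha ^+ 2 + sin alpha ^+ 2) * y.1 by ring.
    by rewrite cs mul1r.
  have -> : sin alpha * (cos alpha * y.1 + sin alpha * y.2) + cos alpha * (cos alpha * y.2 - sin alpha * y.1) =
    (cos alpha ^+ 2 + sin alpha ^+ 2) * y.2 by ring.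
  by rewrite cs mul1r.
exists rho, (alpha + psi); split => //; first exact: ltW.
rewrite lerDl psi0/= lerD2l leNgt; apply/negP => thpsi.
move: c2; rewrite yE.
have -> : cross (rho * cos (alpha + psi), rho * sin (alpha + psi)) (cos (alpha + th), sin (alpha + th)) =
    - (rho * sin (psi - th)).
  have -> : psi - th = alpha + psi - (alpha + th) by ring.
  by rewrite /cross/= (sinB (alpha + psi)); ring.
rewrite oppr_ge0 leNgt => /negP; apply; apply: mulr_gt0 => //.
by apply: sin_gt0_pi; apply/andP; split; lra.
Qed.

Lemma cos_pi3 : cos (pi / 3) = 2^-1 :> R.
Proof.
have pi0 := pi_gt0 R.
have c0 : 0 < cos (pi / 3 : R) by apply: cos_gt0_pihalf; apply/andP; split; lra.
have h : cos (pi / 3 + (pi / 3 + pi / 3)) = -1 :> R.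
  by rewrite -cospi; congr cos; field.
have cs := cos2Dsin2 (pi / 3 : R).
rewrite !(cosD, sinD) in h; move: c0 cs h.
move: (cos (pi / 3)) (sin (pi / 3)) => c s c0 cs h.
(* The triple-angle formula for [cos pi = -1], factored. *)
have h' : (c + 1) * (2 * c - 1) ^+ 2 = 0.
  have s2 : s ^+ 2 = 1 - c ^+ 2 by lra.
  have : c ^+ 3 - 3 * c * s ^+ 2 = -1 by rewrite -h; ring.
  rewrite s2 => h2.
  have -> : (c + 1) * (2 * c - 1) ^+ 2 = c ^+ 3 - 3 * c * (1 - c ^+ 2) + 1 by ring.
  by rewrite h2; ring.
move/eqP: h'; rewrite mulf_eq0 sqrf_eq0 gt_eqF ?addr_gt0//= => /eqP; lra.
Qed.

Lemma sin_pi3 : sin (pi / 3) = Num.sqrt 3 / 2 :> R.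
Proof.
have pi0 := pi_gt0 R.
have s0 : 0 < sin (pi / 3 : R) by apply: sin_gt0_pi; apply/andP; split; lra.
have cs := cos2Dsin2 (pi / 3 : R); rewrite cos_pi3 in cs.
have s3 : 0 <= Num.sqrt 3 :> R by exact: sqrtr_ge0.
have s32 : Num.sqrt 3 ^+ 2 = 3 :> R by rewrite sqr_sqrtr.
move: (Num.sqrt 3) (sin (pi / 3)) s0 cs s3 s32 => r s s0 cs r0 r2.
apply/eqP; rewrite -subr_eq0; apply/eqP.
have : (s - r / 2) * (s + r / 2) = 0.
  have -> : (s - r / 2) * (s + r / 2) = s ^+ 2 - r ^+ 2 / 4 by field.
  by lra.
by move/eqP; rewrite mulf_eq0 => /orP[/eqP//|/eqP]; lra.
Qed.

Lemma cos_2pi3 : cos (2 * pi / 3) = - 2^-1 :> R.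
Proof.
have -> : 2 * pi / 3 = pi - pi / 3 :> R by field.
by rewrite cosB cospi sinpi cos_pi3; ring.
Qed.

Lemma sin_2pi3 : sin (2 * pi / 3) = Num.sqrt 3 / 2 :> R.
Proof.
have -> : 2 * pi / 3 = pi - pi / 3 :> R by field.
by rewrite sinB cospi sinpi sin_pi3; ring.
Qed.

End Angles.

Section MakePentagon.
Variables (R : realType) (v : 'I_5 -> R * R).
Hypothesis cv : forall i k, k != i -> k != ordS i ->
  0 < orient (v i) (v (ordS i)) (v k).

Definition convex_pentagon : pentagon R :=
  Pentagon (convex_adjacent cv) (convex_nonadjacent cv) (convex_not_straight cv)
    (half_planes_compact cv) (half_planes_regular cv) (half_planes_boundary cv).

(** Close to a vertex only the half-planes of its two sides matter, and they cut out a cone; the dot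
    and cross products of the sides determine its opening. *)
Lemma convex_pentagon_angle i (th a b : R) : 0 < th < pi ->
  dist (v (ordS i)) (v (ordS (ordS i))) = a -> dist (v i) (v (ordS i)) = b ->
  dot (v (ordS (ordS i)) - v (ordS i)) (v i - v (ordS i)) = a * b * cos th ->
  cross (v (ordS (ordS i)) - v (ordS i)) (v i - v (ordS i)) = a * b * sin th ->
  interior_angle convex_pentagon (ordS i) th.
Proof.
move=> /andP[th0 thpi] aE bE dotE crossE; have pi0 := pi_gt0 R.
split; first by rewrite th0/=; lra.
set c := v (ordS i) in aE bE dotE crossE *.
set u := v (ordS (ordS i)) - c in dotE crossE; set w := v i - c in dotE crossE.
have pos x y : x <> y -> 0 < dist x y.
  by move=> xy; rewrite lt_neqAle dist_ge0 andbT; apply/eqP => /esym/dist_eq0.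
have a0 : 0 < a by rewrite -aE; apply: pos; exact: (@vertex_neq _ convex_pentagon (ordS i)).
have b0 : 0 < b by rewrite -bE; apply: pos; exact: (@vertex_neq _ convex_pentagon i).
have a2 : u.1 ^+ 2 + u.2 ^+ 2 = a ^+ 2 by rewrite -aE dist_sqr /u/=; ring.
have b2 : w.1 ^+ 2 + w.2 ^+ 2 = b ^+ 2 by rewrite -bE dist_sqr /w/=; ring.
have [|alpha [ca sa]] := @unit_vector_angle R (u.1 / a) (u.2 / a).
  have -> : (u.1 / a) ^+ 2 + (u.2 / a) ^+ 2 = (u.1 ^+ 2 + u.2 ^+ 2) / a ^+ 2 by field; rewrite gt_eqF.
  by rewrite a2 divff// sqrf_eq0 gt_eqF.
have uE : u = (a * cos alpha, a * sin alpha).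
  by rewrite ca sa; apply: injective_projections => /=; field; rewrite gt_eqF.
have wE : w = (b * cos (alpha + th), b * sin (alpha + th)).
  have ab0 : a * b != 0 by rewrite mulf_neq0 ?gt_eqF.
  have cth : cos th = dot u w / (a * b) by rewrite dotE; field; rewrite !gt_eqF.
  have sth : sin th = cross u w / (a * b) by rewrite crossE; field; rewrite !gt_eqF.
  rewrite cosD sinD ca sa cth sth.
  apply: injective_projections; rewrite /dot /cross/=.
    have -> : b * (u.1 / a * ((u.1 * w.1 + u.2 * w.2) / (a * b)) - u.2 / a * ((u.1 * w.2 - u.2 * w.1) / (a * b))) =
      (u.1 ^+ 2 + u.2 ^+ 2) * w.1 / a ^+ 2 by field; rewrite !gt_eqF.
    by rewrite a2 -[LHS]/(w.1); field; rewrite gt_eqF.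
  have -> : b * (u.2 / a * ((u.1 * w.1 + u.2 * w.2) / (a * b)) + u.1 / a * ((u.1 * w.2 - u.2 * w.1) / (a * b))) =
    (u.1 ^+ 2 + u.2 ^+ 2) * w.2 / a ^+ 2 by field; rewrite !gt_eqF.
  by rewrite a2 -[LHS]/(w.2); field; rewrite gt_eqF.
have : nbhs c [set x | forall k, k != i -> k != ordS i -> 0 < orient (v k) (v (ordS k)) x].
  apply: (@filter_forall _ _ (fun k => [set x | k != i -> k != ordS i -> 0 < orient (v k) (v (ordS k)) x]) (nbhs c)) => k.
  have [->|ki] := eqVneq k i.
    by apply: (@filterS _ (nbhs c) _ setT) => [x _|] //; exact: filterT.
  have [->|kSi] := eqVneq k (ordS i).
    by apply: (@filterS _ (nbhs c) _ setT) => [x _ _|] //; exact: filterT.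
  have op : open [set x : R * R | 0 < orient (v k) (v (ordS k)) x].
    have -> : [set x : R * R | 0 < orient (v k) (v (ordS k)) x] = ~` [set x | orient (v k) (v (ordS k)) x <= 0].
      by apply/seteqP; split => x /=; rewrite ltNge => /negP.
    apply: closed_openC.
    exact: (@closed_le_fun _ _ (orient (v k) (v (ordS k))) (fun=> 0) (@orient_continuous _ _ _) (@continuous_cst R _ 0)).
  have : nbhs c [set x : R * R | 0 < orient (v k) (v (ordS k)) x].
    apply: open_nbhs_nbhs; split => //=; apply: cv; first by rewrite eq_sym.
    by apply: contraNneq ki => h; apply/eqP; move: h => /(can_inj (@ordSK _))/esym.
  by apply: filterS => x h _ _.
move=> /nbhs_dist[eps eps0 epsU].
exists alpha, eps; split => // x cx.
have cx' : dist c x < eps by [].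
have loc := epsU x cx'.
have side1 : orient (v (ordS i)) (v (ordS (ordS i))) x = a * cross (cos alpha, sin alpha) (x - c).
  have -> : orient (v (ordS i)) (v (ordS (ordS i))) x = cross u (x - c) by [].
  by rewrite uE /cross/=; ring.
have side2 : orient (v i) (v (ordS i)) x = b * cross (x - c) (cos (alpha + th), sin (alpha + th)).
  have -> : orient (v i) (v (ordS i)) x = cross (x - c) w by rewrite /orient /cross /w /c/=; ring.
  by rewrite wE /cross/=; ring.
have P1 : half_planes v x <-> 0 <= orient (v i) (v (ordS i)) x /\ 0 <= orient (v (ordS i)) (v (ordS (ordS i))) x.
  split; first by move=> Hx; split; exact: Hx.
  move=> [h1 h2] k; have [->//|ki] := eqVneq k i; have [->//|kSi] := eqVneq k (ordS i).
  by rewrite ltW// loc.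
rewrite [region _ x]P1 side1 side2 !pmulr_rge0//.
have := coneP alpha (x - c) (_ : 0 < th < pi); rewrite th0 thpi => /(_ isT) cone.
split.
  move=> [h1 h2]; have [rho [phi [r0 ap xE]]] := cone.1 (conj h2 h1).
  exists rho, phi; split => //.
  have := congr1 fst xE; have := congr1 snd xE => /= x2 x1.
  by apply: injective_projections => /=; rewrite -?x1 -?x2 -/c; ring.
move=> [rho [phi [r0 ap xE]]].
have [|h1 h2] := cone.2 _; last by [].
exists rho, phi; split => //.
by rewrite xE -/c; apply: injective_projections => /=; ring.
Qed.

End MakePentagon.

(** * Scaled convex pentagons and their areas *)

Section Scaled.
Variables (R : realType) (k : R).
Hypothesis k0 : 0 < k.
Implicit Types (a b c y : R * R) (w : 'I_5 -> R * R).

(** Unit area calls for a nested radical. Kept apart as [k], it leaves coordinates in the field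
    generated by the square root of 3. *)
Definition scale a : R * R := (k * a.1, k * a.2).

Lemma orient_scale a b y : orient (scale a) (scale b) (scale y) = k ^+ 2 * orient a b y.
Proof. by rewrite /orient /cross/=; ring. Qed.

Lemma dist_scale a b : dist (scale a) (scale b) = k * dist a b.
Proof.
apply: eq_dist; first by rewrite mulr_ge0 ?(ltW k0)// dist_ge0.
by rewrite exprMn dist_sqr/=; ring.
Qed.

Lemma scale_inv a : a = scale (a.1 / k, a.2 / k).
Proof. by apply: injective_projections => /=; field; rewrite gt_eqF. Qed.

Lemma triangle_scale a b c y : 0 < orient a b c ->
  0 <= orient a b y -> 0 <= orient b c y -> 0 <= orient c a y ->
  triangle (scale a) (scale b) (scale c) (scale y).
Proof.
move=> abc aby bcy cay; have k2 : 0 < k ^+ 2 by rewrite exprn_gt0.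
by apply: orient_triangle; rewrite orient_scale ?pmulr_rgt0 ?pmulr_rge0.
Qed.

Lemma triangle_scale_measure a b c : 0 <= orient a b c ->
  (mu2 R (triangle (scale a) (scale b) (scale c)) <= (k ^+ 2 * orient a b c / 2)%:E)%E.
Proof.
move=> abc; apply: (le_trans (triangle_measure _ _ _)).
rewrite -[cross _ _]/(orient (scale a) (scale b) (scale c)) orient_scale.
by rewrite ger0_norm// mulr_ge0// sqr_ge0.
Qed.

Lemma box_measure (p q p' q' : R) : p <= q -> p' <= q' ->
  mu2 R (`[p, q] `*` `[p', q']) = ((q - p) * (q' - p'))%:E.
Proof.
move=> pq pq'; rewrite product_measure1E; try exact: measurable_itv.
have len (u u' : R) : u <= u' -> (if u < u' then (u' - u)%:E else 0%E) = (u' - u)%:E.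
  move=> uu; case: ltP => // h; have -> : u' = u by lra.
  by rewrite subrr.
rewrite [X in (X * _)%E]lebesgue_measure_itv [X in (_ * X)%E]lebesgue_measure_itv/= !lte_fin.
by rewrite -!EFinB !len.
Qed.

Section Tangential.
Variable w : 'I_5 -> R * R.
Hypothesis convex_w : forall i j, j != i -> j != ordS i ->
  0 < orient (w i) (w (ordS i)) (w j).

Lemma convex_scale i j : j != i -> j != ordS i ->
  0 < orient (scale (w i)) (scale (w (ordS i))) (scale (w j)).
Proof. by move=> ji jSi; rewrite orient_scale mulr_gt0 ?exprn_gt0// convex_w. Qed.

Definition scaled_pentagon : pentagon R := @convex_pentagon _ (scale \o w) convex_scale.

Lemma scaled_pentagon_angle i (th a b : R) : 0 < th < pi ->
  dist (w (ordS i)) (w (ordS (ordS i))) = a -> dist (w i) (w (ordS i)) = b ->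
  dot (w (ordS (ordS i)) - w (ordS i)) (w i - w (ordS i)) = a * b * cos th ->
  cross (w (ordS (ordS i)) - w (ordS i)) (w i - w (ordS i)) = a * b * sin th ->
  interior_angle scaled_pentagon (ordS i) th.
Proof.
move=> thpi aE bE dE cE.
apply: (@convex_pentagon_angle _ _ convex_scale i th (k * a) (k * b)) => //=.
- by rewrite dist_scale aE.
- by rewrite dist_scale bE.
- have -> : k * a * (k * b) * cos th = k ^+ 2 * (a * b * cos th) by ring.
  by rewrite -dE /dot/=; ring.
have -> : k * a * (k * b) * sin th = k ^+ 2 * (a * b * sin th) by ring.
by rewrite -cE /cross/=; ring.
Qed.

Lemma scaled_pentagon_circumscribed (r : R) : 0 < r ->
  (forall i, exists t, [/\ 0 <= t <= 1, dist 0 (comb (w i) (w (ordS i)) t) = r &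
     dot (comb (w i) (w (ordS i)) t) (w (ordS i) - w i) = 0]) ->
  circumscribed scaled_pentagon.
Proof.
move=> r0 foot; exists 0, (k * r); split; first exact: mulr_gt0.
move=> i; have [t [t01 dE oE]] := foot i.
have cE : comb (scale (w i)) (scale (w (ordS i))) t = scale (comb (w i) (w (ordS i)) t).
  by apply: injective_projections; rewrite /comb/=; ring.
exists (scale (comb (w i) (w (ordS i)) t)); split.
- by rewrite -cE; apply/segmentP; exists t.
- by rewrite -dE -dist_scale; congr dist; apply: injective_projections; rewrite /= mulr0.
rewrite subr0; apply: (@eq_trans _ _ (k ^+ 2 * dot (comb (w i) (w (ordS i)) t) (w (ordS i) - w i))).
  by rewrite /dot/=; ring.
by rewrite oE mulr0.
Qed.

Lemma scaled_pentagon_perimeter : perimeter scaled_pentagon = k * \sum_i dist (w i) (w (ordS i)).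
Proof. by rewrite mulr_sumr; apply: eq_bigr => i _; exact: dist_scale. Qed.

Lemma scaled_pentagon_region y : region scaled_pentagon (scale y) <->
  forall i, 0 <= orient (w i) (w (ordS i)) y.
Proof.
have k2 : 0 < k ^+ 2 by rewrite exprn_gt0.
by split => H i; have := H i; rewrite /= orient_scale pmulr_rge0.
Qed.

Let w0 := w ord0.
Let w1 := w (ordS ord0).
Let w2 := w (ordS (ordS ord0)).
Let w3 := w (ordS (ordS (ordS ord0))).
Let w4 := w (ordS (ordS (ordS (ordS ord0)))).

Lemma scaled_pentagon_area_le :
  (area scaled_pentagon <=
   (k ^+ 2 * (orient w0 w1 w2 + orient w0 w2 w3 + orient w0 w3 w4) / 2)%:E)%E.
Proof.
have o012 : 0 <= orient w0 w1 w2 by rewrite ltW// convex_w.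
have o023 : 0 <= orient w0 w2 w3.
  have -> : orient w0 w2 w3 = orient w2 w3 w0 by rewrite /orient /cross/=; ring.
  by rewrite ltW// convex_w.
have o034 : 0 <= orient w0 w3 w4.
  have -> : orient w0 w3 w4 = orient w3 w4 w0 by rewrite /orient /cross/=; ring.
  by rewrite ltW// convex_w.
have mT a b c : measurable2 (triangle a b c).
  by apply: compact_measurable2; exact: triangle_compact.
have := half_planes_sub_triangles convex_scale => sub.
have m1 := mT (scale w0) (scale w1) (scale w2).
have m2 := mT (scale w0) (scale w2) (scale w3).
have m3 := mT (scale w0) (scale w3) (scale w4).
apply: (le_trans (le_mu2 _ _ sub)).
- by apply: compact_measurable2; exact: (@region_compact _ scaled_pentagon).
- by apply: measurableU => //; exact: measurableU.
apply: (le_trans (mu2U _ _)) => //; first exact: measurableU.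
have -> : k ^+ 2 * (orient w0 w1 w2 + orient w0 w2 w3 + orient w0 w3 w4) / 2 =
  k ^+ 2 * orient w0 w1 w2 / 2 + (k ^+ 2 * orient w0 w2 w3 / 2 + k ^+ 2 * orient w0 w3 w4 / 2) by field.
rewrite EFinD; apply: leeD; first exact: triangle_scale_measure.
apply: (le_trans (mu2U m2 m3)).
by rewrite EFinD; apply: leeD; exact: triangle_scale_measure.
Qed.

(* [s] lists triangles that cover the part of the bounding box outside the
   pentagon. *)
Lemma scaled_pentagon_area_ge (p q p' q' : R) (s : seq ((R * R) * (R * R) * (R * R))) :
  p <= q -> p' <= q' ->
  (forall t, t \in s -> 0 < orient t.1.1 t.1.2 t.2) ->
  (forall y, p <= y.1 <= q -> p' <= y.2 <= q' ->
    (forall i, 0 <= orient (w i) (w (ordS i)) y) \/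
    exists2 t, t \in s & [/\ 0 <= orient t.1.1 t.1.2 y, 0 <= orient t.1.2 t.2 y &
       0 <= orient t.2 t.1.1 y]) ->
  ((k ^+ 2 * ((q - p) * (q' - p')) - \sum_(t <- s) k ^+ 2 * orient t.1.1 t.1.2 t.2 / 2)%:E
    <= area scaled_pentagon)%E.
Proof.
move=> pq pq' s0 cover.
have mP : measurable2 (region scaled_pentagon).
  by apply: compact_measurable2; exact: region_compact.
pose box := `[k * p, k * q]%classic `*` `[k * p', k * q']%classic : set (R * R).
have mbox : measurable2 box by apply: measurableX; exact: measurable_itv.
(* The orientation of a triple is known only for members of [s], whereas the covering lemma wants a
   bound for every index. *)
pose F t := if t \in s then triangle (scale t.1.1) (scale t.1.2) (scale t.2) else set0.
have mF t : measurable2 (F t).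
  rewrite /F; case: ifP => _; last exact: measurable0.
  by apply: compact_measurable2; exact: triangle_compact.
have K : (mu2 R (box `\` region scaled_pentagon) <=
    (\sum_(t <- s) k ^+ 2 * `|orient t.1.1 t.1.2 t.2| / 2)%:E)%E.
  apply: (@mu2_cover _ _ s F) => //; first exact: measurableD.
    move=> t; rewrite /F; case: ifP => ts.
      by rewrite gtr0_norm ?s0//; apply: triangle_scale_measure; rewrite ltW// s0.
    by rewrite measure0 lee_fin divr_ge0// mulr_ge0 ?sqr_ge0.
  move=> x; rewrite (scale_inv x); move: (_, _) => y [[]] /=.
  rewrite !in_itv/= !ler_pM2l// => y1 y2 yP.
  have [yin|[t ts [h1 h2 h3]]] := cover y y1 y2.
    by case: yP; exact/scaled_pentagon_region.
  by exists t => //; rewrite /F ts; apply: triangle_scale => //; exact: s0.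
have kbox : mu2 R box = (k ^+ 2 * ((q - p) * (q' - p')))%:E.
  by rewrite box_measure ?ler_pM2l//; congr (_%:E); ring.
rewrite EFinB leeBlDr// -kbox.
apply: (@le_trans _ _ (mu2 R (region scaled_pentagon `|` (box `\` region scaled_pentagon)))).
  apply: le_mu2 => //; first by apply: measurableU => //; exact: measurableD.
  by move=> x bx; have [?|?] := pselect (region scaled_pentagon x); [left|right].
apply: (le_trans (mu2U _ _)) => //; first exact: measurableD.
apply: leeD => //; apply: (le_trans K); rewrite lee_fin big_seq [leRHS]big_seq.
by apply: ler_sum => t ts; rewrite gtr0_norm ?s0.
Qed.

End Tangential.
End Scaled.

(** * The unit-area Prismatic and Cairo pentagons *)

Section Concrete.
Variable R : realType.
Let s : R := Num.sqrt 3.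

Lemma sqrt3_bounds : [/\ s ^+ 2 = 3, 173 / 100 < s & s < 174 / 100].
Proof.
have s0 : 0 <= s by exact: sqrtr_ge0.
have s2 : s ^+ 2 = 3 by rewrite sqr_sqrtr.
by split => //; nra.
Qed.

Let k : R := (Num.sqrt (6 + 3 * s))^-1.

Lemma unit_scale : 0 < k /\ k ^+ 2 * (6 + 3 * s) = 1.
Proof.
have [s2 s1 _] := sqrt3_bounds.
have p : 0 < 6 + 3 * s by lra.
split; first by rewrite invr_gt0 sqrtr_gt0.
by rewrite exprVn sqr_sqrtr ?(ltW p)// mulVf// gt_eqF.
Qed.

(* Both pentagons are circumscribed about the circle of centre 0 and radius
   [s], and have area [6 + 3 * s]. *)
Definition prismatic_vertex (i : 'I_5) : R * R :=
  nth 0 [:: (- s, - s); (s, - s); (s, 1); (0, 2); (- s, 1)] i.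

Definition cairo_vertex (i : 'I_5) : R * R :=
  nth 0 [:: (- 1, - s); (1, - s); ((3 + s) / 2, (3 - s) / 2); (0, 2);
    (- ((3 + s) / 2), (3 - s) / 2)] i.

Lemma prismatic_convex i j : j != i -> j != ordS i ->
  0 < orient (prismatic_vertex i) (prismatic_vertex (ordS i)) (prismatic_vertex j).
Proof.
have [s2 s1 s1'] := sqrt3_bounds.
case: i => -[|[|[|[|[|//]]]]] hi; case: j => -[|[|[|[|[|//]]]]] hj //= _ _;
  rewrite /orient /cross /prismatic_vertex/=; nra.
Qed.

Lemma cairo_convex i j : j != i -> j != ordS i ->
  0 < orient (cairo_vertex i) (cairo_vertex (ordS i)) (cairo_vertex j).
Proof.
have [s2 s1 s1'] := sqrt3_bounds.
case: i => -[|[|[|[|[|//]]]]] hi; case: j => -[|[|[|[|[|//]]]]] hj //= _ _;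
  rewrite /orient /cross /cairo_vertex/=; nra.
Qed.

Lemma forall_ord5 (P : 'I_5 -> Prop) :
  P ord0 -> P (ordS ord0) -> P (ordS (ordS ord0)) -> P (ordS (ordS (ordS ord0))) ->
  P (ordS (ordS (ordS (ordS ord0)))) -> forall i, P i.
Proof.
by move=> P0 P1 P2 P3 P4 i; have [->|[->|->|->|->]] := ordS5_cases ord0 i.
Qed.

(** The tangents to the circle of radius [s] have length [s] from a right angle and 1 from an angle
    [2 pi / 3]; a side is the sum of the tangents from its ends. *)
Definition prismatic_length (i : 'I_5) : R := nth 0 [:: 2 * s; 1 + s; 2; 2; 1 + s] i.

Definition cairo_length (i : 'I_5) : R := nth 0 [:: 2; 1 + s; 1 + s; 1 + s; 1 + s] i.

Lemma prismatic_dist i :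
  dist (prismatic_vertex i) (prismatic_vertex (ordS i)) = prismatic_length i.
Proof.
have [s2 s1 s1'] := sqrt3_bounds.
by case: i => -[|[|[|[|[|//]]]]] hi; rewrite /prismatic_vertex /prismatic_length/=;
  apply: eq_dist => /=; try lra; ring: s2.
Qed.

Lemma cairo_dist i : dist (cairo_vertex i) (cairo_vertex (ordS i)) = cairo_length i.
Proof.
have [s2 s1 s1'] := sqrt3_bounds.
by case: i => -[|[|[|[|[|//]]]]] hi; rewrite /cairo_vertex /cairo_length/=;
  apply: eq_dist => /=; try lra; field: s2.
Qed.

Lemma cairo_angle_values : [/\ 0 < (pi / 2 : R) < pi, 0 < (2 * pi / 3 : R) < pi,
  cos (pi / 2 : R) = 0 /\ sin (pi / 2 : R) = 1 &
  cos (2 * pi / 3 : R) = - 2^-1 /\ sin (2 * pi / 3 : R) = s / 2].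
Proof.
have pi0 := pi_gt0 R.
by split; [apply/andP; split; lra|apply/andP; split; lra|
  rewrite cos_pihalf sin_pihalf|rewrite cos_2pi3 sin_2pi3].
Qed.

Let k0 : 0 < k. Proof. by case: unit_scale. Qed.

Definition prismatic_pentagon : pentagon R := scaled_pentagon k0 prismatic_convex.

Definition cairo_pentagon : pentagon R := scaled_pentagon k0 cairo_convex.

Lemma prismatic_angle i : interior_angle prismatic_pentagon i
  (if (i < 2)%N then pi / 2 else 2 * pi / 3).
Proof.
have [h1 h2 [c1 s1] [c2 s2]] := cairo_angle_values; have [ss _ _] := sqrt3_bounds.
have A j th : 0 < th < pi ->
  dot (prismatic_vertex (ordS (ordS j)) - prismatic_vertex (ordS j))
      (prismatic_vertex j - prismatic_vertex (ordS j)) =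
    prismatic_length (ordS j) * prismatic_length j * cos th ->
  cross (prismatic_vertex (ordS (ordS j)) - prismatic_vertex (ordS j))
      (prismatic_vertex j - prismatic_vertex (ordS j)) =
    prismatic_length (ordS j) * prismatic_length j * sin th ->
  interior_angle prismatic_pentagon (ordS j) th.
  by move=> th0; apply: scaled_pentagon_angle => //; exact: prismatic_dist.
rewrite -[i]ordS5; move: (ordS (ordS (ordS (ordS i)))) => j {i}.
by case: j => -[|[|[|[|[|//]]]]] hj; apply: A => //; rewrite ?c1 ?s1 ?c2 ?s2
  /prismatic_vertex /prismatic_length /dot /cross/=; field: ss.
Qed.

Lemma cairo_angle i : interior_angle cairo_pentagon i
  (if (i == 2 :> nat) || (i == 4 :> nat) then pi / 2 else 2 * pi / 3).
Proof.
have [h1 h2 [c1 s1] [c2 s2]] := cairo_angle_values; have [ss _ _] := sqrt3_bounds.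
have A j th : 0 < th < pi ->
  dot (cairo_vertex (ordS (ordS j)) - cairo_vertex (ordS j))
      (cairo_vertex j - cairo_vertex (ordS j)) =
    cairo_length (ordS j) * cairo_length j * cos th ->
  cross (cairo_vertex (ordS (ordS j)) - cairo_vertex (ordS j))
      (cairo_vertex j - cairo_vertex (ordS j)) =
    cairo_length (ordS j) * cairo_length j * sin th ->
  interior_angle cairo_pentagon (ordS j) th.
  by move=> th0; apply: scaled_pentagon_angle => //; exact: cairo_dist.
rewrite -[i]ordS5; move: (ordS (ordS (ordS (ordS i)))) => j {i}.
by case: j => -[|[|[|[|[|//]]]]] hj; apply: A => //; rewrite ?c1 ?s1 ?c2 ?s2
  /cairo_vertex /cairo_length /dot /cross/=; field: ss.
Qed.

Lemma prismatic_circumscribed : circumscribed prismatic_pentagon.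
Proof.
have [s2 s1 s1'] := sqrt3_bounds.
apply: (@scaled_pentagon_circumscribed _ _ _ _ _ s); first by lra.
(* The contact point divides a side in the ratio of the tangents: [s / (1 + s) = (3 - s) / 2] and
   [1 / (1 + s) = (s - 1) / 2]. *)
move=> i; exists (nth 0 [:: 2^-1; (3 - s) / 2; 2^-1; 2^-1; (s - 1) / 2] i).
by case: i => -[|[|[|[|[|//]]]]] hi; rewrite /prismatic_vertex /comb /dot/=;
  (split; [apply/andP; split; lra|apply: eq_dist => /=; [lra|field: s2]|field: s2]).
Qed.

Lemma cairo_circumscribed : circumscribed cairo_pentagon.
Proof.
have [s2 s1 s1'] := sqrt3_bounds.
apply: (@scaled_pentagon_circumscribed _ _ _ _ _ s); first by lra.
move=> i; exists (nth 0 [:: 2^-1; (s - 1) / 2; (3 - s) / 2; (s - 1) / 2; (3 - s) / 2] i).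
by case: i => -[|[|[|[|[|//]]]]] hi; rewrite /cairo_vertex /comb /dot/=;
  (split; [apply/andP; split; lra|apply: eq_dist => /=; [lra|field: s2]|field: s2]).
Qed.

Lemma prismatic_pentagonP : prismatic prismatic_pentagon.
Proof.
split; last exact: prismatic_circumscribed.
exists ord0, (ordS ord0); split => //; split => //.
- exact: (prismatic_angle ord0).
- exact: (prismatic_angle (ordS ord0)).
move=> j; case: j => -[|[|[|[|[|//]]]]] hj //= _ _; exact: (prismatic_angle (Ordinal hj)).
Qed.

Lemma cairo_pentagonP : cairo cairo_pentagon.
Proof.
split; last exact: cairo_circumscribed.
exists (ordS (ordS ord0)), (ordS (ordS (ordS (ordS ord0)))); split => //; split => //.
- exact: (cairo_angle (ordS (ordS ord0))).
- exact: (cairo_angle (ordS (ordS (ordS (ordS ord0))))).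
move=> j; case: j => -[|[|[|[|[|//]]]]] hj //= _ _; exact: (cairo_angle (Ordinal hj)).
Qed.

Lemma prismatic_perimeter : perimeter prismatic_pentagon = k * (6 + 4 * s).
Proof.
rewrite scaled_pentagon_perimeter; congr (_ * _).
by rewrite (big_ordS5 _ ord0) !prismatic_dist /prismatic_length/=; ring.
Qed.

Lemma cairo_perimeter : perimeter cairo_pentagon = k * (6 + 4 * s).
Proof.
rewrite scaled_pentagon_perimeter; congr (_ * _).
by rewrite (big_ordS5 _ ord0) !cairo_dist /cairo_length/=; ring.
Qed.

(** Identifies the common perimeter as [2 sqrt (2 + sqrt 3)]. *)
Lemma unit_perimeter_sqr : (k * (6 + 4 * s)) ^+ 2 = 4 * (2 + s).
Proof.
have [s2 s1 s1'] := sqrt3_bounds; have [_ k1] := unit_scale.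
have -> : (k * (6 + 4 * s)) ^+ 2 = k ^+ 2 * (6 + 3 * s) * (4 * (2 + s)).
  have -> : k ^+ 2 * (6 + 3 * s) * (4 * (2 + s)) = k ^+ 2 * (48 + 48 * s + 12 * s ^+ 2) by ring.
  have -> : (k * (6 + 4 * s)) ^+ 2 = k ^+ 2 * (36 + 48 * s + 16 * s ^+ 2) by ring.
  by rewrite s2; ring.
by rewrite k1 mul1r.
Qed.

Lemma prismatic_area : area prismatic_pentagon = 1%E.
Proof.
have [s2 s1 s1'] := sqrt3_bounds; have [_ k1] := unit_scale.
apply/eqP; rewrite eq_le; apply/andP; split.
  apply: (le_trans (scaled_pentagon_area_le _ _)); rewrite lee_fin -[leRHS]k1 le_eqVlt.
  by apply/orP; left; apply/eqP; rewrite /orient /cross /prismatic_vertex/=; field: s2.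
(* The lower corners of the bounding box are vertices; a triangle is cut off at each upper one. *)
apply: le_trans (scaled_pentagon_area_ge (p := - s) (q := s) (p' := - s) (q' := 2)
  (s := [:: ((0, 2), (s, 1), (s, 2)); ((- s, 1), (0, 2), (- s, 2))]) k0 prismatic_convex _ _ _ _).
- rewrite !big_cons big_nil lee_fin -[leLHS]k1 le_eqVlt; apply/orP; left; apply/eqP.
  by rewrite /orient /cross/=; field: s2.
- lra.
- lra.
- by move=> t; rewrite !inE => /orP[|] /eqP ->; rewrite /orient /cross/=; nra.
move=> [y1 y2] /= /andP[a1 a2] /andP[b1 b2].
have [c1|c1] := leP 0 (orient (s, 1) (0, 2) (y1, y2)); last first.
  right; exists ((0, 2), (s, 1), (s, 2)); first by rewrite !inE eqxx.
  by move: c1; rewrite /orient /cross/= => c1; split; nra.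
have [c2|c2] := leP 0 (orient (0, 2) (- s, 1) (y1, y2)); last first.
  right; exists ((- s, 1), (0, 2), (- s, 2)); first by rewrite !inE eqxx orbT.
  by move: c2; rewrite /orient /cross/= => c2; split; nra.
left; apply: forall_ord5; rewrite // /orient /cross /prismatic_vertex/=; nra.
Qed.

Lemma cairo_area : area cairo_pentagon = 1%E.
Proof.
have [s2 s1 s1'] := sqrt3_bounds; have [_ k1] := unit_scale.
pose X := (3 + s) / 2; pose Y := (3 - s) / 2.
apply/eqP; rewrite eq_le; apply/andP; split.
  apply: (le_trans (scaled_pentagon_area_le _ _)); rewrite lee_fin -[leRHS]k1 le_eqVlt.
  by apply/orP; left; apply/eqP; rewrite /orient /cross /cairo_vertex/=; field: s2.
pose t1 : (R * R) * (R * R) * (R * R) := ((X, Y), (1, - s), (X, - s)).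
pose t2 : (R * R) * (R * R) * (R * R) := ((0, 2), (X, Y), (X, 2)).
pose t3 : (R * R) * (R * R) * (R * R) := ((- X, Y), (0, 2), (- X, 2)).
pose t4 : (R * R) * (R * R) * (R * R) := ((- 1, - s), (- X, Y), (- X, - s)).
apply: le_trans (scaled_pentagon_area_ge (p := - X) (q := X) (p' := - s) (q' := 2)
  (s := [:: t1; t2; t3; t4]) k0 cairo_convex _ _ _ _).
- rewrite !big_cons big_nil lee_fin -[leLHS]k1 le_eqVlt; apply/orP; left; apply/eqP.
  by rewrite /orient /cross/= /X /Y; field: s2.
- rewrite /X; lra.
- lra.
- by move=> t; rewrite !inE => /or4P[] /eqP ->; rewrite /orient /cross/= /X /Y; nra.
move=> [y1 y2] /= /andP[a1 a2] /andP[b1 b2].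
have [c1|c1] := leP 0 (orient (1, - s) (X, Y) (y1, y2)); last first.
  right; exists t1; first by rewrite !inE eqxx.
  by move: c1 a1 a2; rewrite /orient /cross/= /X /Y => c1 a1 a2; split; nra.
have [c2|c2] := leP 0 (orient (X, Y) (0, 2) (y1, y2)); last first.
  right; exists t2; first by rewrite !inE eqxx orbT.
  by move: c2 a1 a2; rewrite /orient /cross/= /X /Y => c2 a1 a2; split; nra.
have [c3|c3] := leP 0 (orient (0, 2) (- X, Y) (y1, y2)); last first.
  right; exists t3; first by rewrite !inE eqxx !orbT.
  by move: c3 a1 a2; rewrite /orient /cross/= /X /Y => c3 a1 a2; split; nra.
have [c4|c4] := leP 0 (orient (- X, Y) (- 1, - s) (y1, y2)); last first.
  right; exists t4; first by rewrite !inE eqxx !orbT.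
  by move: c4 a1 a2; rewrite /orient /cross/= /X /Y => c4 a1 a2; split; nra.
left; apply: forall_ord5; rewrite //.
rewrite /orient /cross /cairo_vertex/=; nra.
Qed.

End Concrete.

(** * Averaging over the tiles *)

Section TileWeight.
Variable R : realType.
Implicit Types P : pentagon R.

Definition cairo_perimeter_value : R := perimeter (cairo_pentagon R).
Let c := cairo_perimeter_value.
(* [delta] must exceed [c] minus the perimeter of the regular pentagon, which is
   0.0517..., and (432^(1/4) - c) / 13.4 = 0.0518... must exceed [delta]; hence the
   tight rational bounds on square roots below. *)
Let delta : R := 7 / 135.

Lemma cairo_value_le : c <= 3091 / 800.
Proof.
have [k0 _] := unit_scale R; have [s2 s1 _] := sqrt3_bounds R.
have c2 : c ^+ 2 = 4 * (2 + Num.sqrt 3).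
  by rewrite /c /cairo_perimeter_value cairo_perimeter unit_perimeter_sqr.
(* A convergent of the continued fraction of the square root of 3. *)
have s3 : Num.sqrt 3 <= 362 / 209 :> R by nra.
nra.
Qed.

Lemma unit_pentagon_perimeter P : area P = 1%E -> c - delta <= perimeter P.
Proof.
move=> P1; have c2 := cairo_value_le.
pose q : R := Num.sqrt 5; pose t : R := Num.sqrt (5 - 2 * q).
have q0 : 0 < q by rewrite sqrtr_gt0.
have q2 : q ^+ 2 = 5 by rewrite sqr_sqrtr.
(* A Lucas number over a Fibonacci number, just above the square root of 5; it yields [178 / 245]
   just below [t]. *)
have q3 : q <= 843 / 377 by nra.
have tp : 0 < 5 - 2 * q by lra.
have t0 : 0 < t by rewrite sqrtr_gt0.
have t2 : t ^+ 2 = 5 - 2 * q by rewrite sqr_sqrtr// ltW.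
have t3 : 178 / 245 <= t by nra.
have := pentagon_isoperimetric q0 q2 t0 t2 P1; have := perimeter_ge0 P.
rewrite /delta; nra.
Qed.

(** [661 / 145] lies between [3091 / 800 + 13.4 * 7 / 135], which [tile_weight] requires, and the
    fourth root of 432; [478 / 23] separates the squares. *)
Lemma type2_perimeter_ge P : area P = 1%E -> type2 P -> 661 / 145 <= perimeter P.
Proof.
move=> P1 /(type2_perimeter P1) h; rewrite leNgt; apply/negP => pl.
have p0 := perimeter_ge0 P.
have : perimeter P ^+ 2 <= 478 / 23 by nra.
move: h (sqr_ge0 (perimeter P)); rewrite -[4%N]/(2 * 2)%N exprM.
move: (perimeter P ^+ 2) => x h x0 x1.
have : x * x <= 478 / 23 * (478 / 23) by apply: ler_pM.
lra.
Qed.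

Definition weight P : R := (`[< efficient P >])%:R - 26 / 10 * (`[< type1 P >])%:R
   - 134 / 10 * (`[< type2 P >])%:R.

Lemma tile_weight P : area P = 1%E -> c - perimeter P <= delta * weight P.
Proof.
move=> P1; have c2 := cairo_value_le.
have p5 := unit_pentagon_perimeter P1.
have peff : ~ efficient P -> c <= perimeter P.
  move=> neff; rewrite leNgt; apply/negP => pc; apply: neff.
  by exists (cairo_pentagon R); split; [exact: cairo_pentagonP|exact: cairo_area|exact: ltW].
have excl : type1 P -> type2 P -> False by move=> [_ n1] [_]; rewrite n1.
rewrite /weight /delta in p5 *.
case: asboolP => eff; case: asboolP => t1; case: asboolP => t2; rewrite /= ?mulr1n ?mulr0n.
- by case: (excl t1 t2).
- have := type1_perimeter P1 t1; lra.
- have := type2_perimeter_ge P1 t2; lra.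
- lra.
- by case: (excl t1 t2).
- have := type1_perimeter P1 t1; lra.
- have := type2_perimeter_ge P1 t2; lra.
- have := peff eff; lra.
Qed.

Lemma fraction_sum (T : set (pentagon R)) (A : pentagon R -> Prop) (r : R) :
  finite_set (tiles_inside T r) ->
  fraction T A r =
  (\sum_(P <- fset_set (tiles_inside T r)) (`[< A P >])%:R) /
  #|` fset_set (tiles_inside T r) |%:R.
Proof.
move=> finI; rewrite /fraction; congr (_ / _).
set I := tiles_inside T r in finI *.
have -> : \sum_(P <- fset_set I) (`[< A P >])%:R =
    (size (seq.filter (fun P => `[< A P >]) (fset_set I)))%:R :> R.
  rewrite size_filter -sum1_count natr_sum [RHS]big_mkcond.
  by apply: eq_bigr => P _; case: asboolP.
congr _%:R; apply: perm_size; apply: uniq_perm.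
- exact: fset_uniq.
- by rewrite filter_uniq// fset_uniq.
have finIA : finite_set (I `&` [set P | A P]) by exact: finite_setIl.
move=> P; rewrite mem_filter !in_fset_set//; apply/idP/idP.
  by rewrite inE => -[IP AP]; apply/andP; split; [exact/asboolP|rewrite inE].
by move=> /andP[/asboolP AP]; rewrite !inE => IP; split.
Qed.

End TileWeight.

(** Here [A] and [L] are [pi r^2] and [pi r], [N] and [m] count inside and crossing tiles, [p] and
    [V] are total perimeter and weight. Then [c N - p >= (8 - c) m - 16 c L - 2 eps A], and [8 > c]
    discards [m]. *)
Lemma average_estimate (R : realFieldType) (c eps L p m A N V : R) :
  0 <= c -> c <= 3091 / 800 -> 0 <= eps -> eps <= 1 / 10 ->
  0 <= L -> 0 <= p -> 0 <= m -> 0 < A -> 250 * L <= eps * A -> 100 * L <= A ->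
  p + 8 * m <= (c + 2 * eps) * A -> A - 16 * L <= N + m ->
  c * N - p <= 7 / 135 * V ->
  0 < N /\ - (180 * eps) * N <= V.
Proof.
move=> c0 cU e0 e1 L0 p0 m0 A0 LA LA' pm AN W.
have m8 : 8 * m <= 41 / 10 * A by nra.
have NA : A / 4 <= N by lra.
split; first by lra.
have main : - (16 * c * L) - 2 * eps * A <= 7 / 135 * V by nra.
(* As [16 c <= 64] and [64 L <= 64 / 250 eps A], the loss is at most [2.256 eps A]; times [135 / 7],
   and with [A <= 4 N], it stays below [180 eps N]. *)
have : - (64 * L) - 2 * eps * A <= 7 / 135 * V by nra.
have : eps * A / 4 <= eps * N by nra.
lra.
Qed.

(** * Tiles in large disks *)

Section Asymptotics.
Variables (R : realType) (T : set (pentagon R)).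
Hypothesis T_tiling : tiling T.
Hypothesis T_area : forall P, T P -> area P = 1%E.

Let c : R := cairo_perimeter_value R.

Definition tiles_crossing (rho r : R) : set (pentagon R) :=
  [set P | [/\ T P, region P `&` disk 0 rho !=set0 & ~ (region P `<=` disk 0 r)]].

Lemma sum1_sizeR (I : Type) (l : seq I) : \sum_(i <- l) (1 : R) = (size l)%:R.
Proof. by rewrite -sum1_size natr_sum. Qed.

(** A uniform positive bound, by which finite edge length in a disk leaves room for finitely many
    tiles. *)
Lemma unit_perimeter_ge3 (P : pentagon R) : area P = 1%E -> 3 <= perimeter P.
Proof.
move=> P1.
have [[k kP]|ext] := pselect (exists k, in_hull_of_others P k).
  have := perimeter_hull4 P1 (hull_others kP); lra.
have up : c - 7 / 135 <= perimeter P := unit_pentagon_perimeter P1.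
have [k0 k1] := unit_scale R; have [s2 s1 s1'] := sqrt3_bounds R.
have c0 : 0 < c.
  by rewrite /c /cairo_perimeter_value cairo_perimeter; apply: mulr_gt0; [exact: k0|lra].
have c2 : c ^+ 2 = 4 * (2 + Num.sqrt 3 : R).
  by rewrite /c /cairo_perimeter_value cairo_perimeter unit_perimeter_sqr.
have : 19 / 5 <= c by nra.
lra.
Qed.

(** A tile of unit area cannot contain the disk of radius [r - 8 >= 2], so [crossing_length]
    applies. *)
Lemma crossing_length8 (r : R) P : 10 <= r -> tiles_crossing (r - 8) r P ->
  8 <= inside_length r P.
Proof.
move=> r10 [TP meet out].
have -> : 8 = r - (r - 8) by ring.
apply: crossing_length => //; [lra|lra|].
move=> DP; have rho0 : 0 < r - 8 by lra.
have := disk_measure_ge rho0.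
have mD : measurable2 (disk (0 : R * R) (r - 8)).
  by apply: closed_measurable2; exact: disk_closed.
move=> /le_trans/(_ (le_mu2 mD (region_measurable P) DP)).
rewrite -[mu2 R (region P)]/(area P) T_area// lee_fin.
have := pi_ge2 R; have : 4 <= (r - 8) ^+ 2 by nra.
nra.
Qed.

Lemma local_count (r B : R) : 10 <= r ->
  (2%:E * perimeter_inside T r <= B%:E)%E ->
  finite_set (tiles_inside T r) /\
  exists m : nat,
    \sum_(P <- fset_set (tiles_inside T r)) perimeter P + 8 * m%:R <= B /\
    pi * (r - 8) ^+ 2 <= #|` fset_set (tiles_inside T r) |%:R + m%:R.
Proof.
move=> r10 PB.
set I := tiles_inside T r; set C := tiles_crossing (r - 8) r.
have sumB (s : seq (pentagon R)) : uniq s -> (forall P, P \in s -> T P) ->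
    \sum_(P <- s) inside_length r P <= B.
  move=> us sT; rewrite -lee_fin.
  exact: le_trans (inside_length_sum r T_tiling us sT) PB.
have IT P : I P -> T P by case.
have CT P : C P -> T P by case.
have inI P : I P -> perimeter P <= inside_length r P.
  by move=> [_]; exact: perimeter_inside_length.
have inC P : C P -> 8 <= inside_length r P by exact: crossing_length8.
have fin (A : set (pentagon R)) : A `<=` T -> (forall P, A P -> 3 <= inside_length r P) -> finite_set A.
  (* An infinite family has finite subfamilies of every size, and each tile uses up at least 1 of
     the budget [B]. *)
  move=> AT A3; apply: contrapT => /infinite_set_fset inf.
  have [F FA Fn] := inf (Num.truncn B).+1.
  have := sumB F (fset_uniq F) (fun P PF => AT _ (FA _ PF)).
  have : \sum_(P <- F) (1 : R) <= \sum_(P <- F) inside_length r P.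
    rewrite big_seq [leRHS]big_seq; apply: ler_sum => P PF.
    by have := A3 _ (FA _ PF); lra.
  rewrite sum1_sizeR => h1 h2.
  have := le_trans h1 h2; rewrite leNgt => /negP; apply.
  by apply: (lt_le_trans (truncnS_gt B)); rewrite ler_nat.
have finI : finite_set I.
  by apply: fin => // P IP; apply: (le_trans _ (inI _ IP)); apply: unit_perimeter_ge3; exact/T_area/IT.
have finC : finite_set C.
  by apply: fin => // P CP; apply: (le_trans _ (inC _ CP)); lra.
split => //; exists #|` fset_set C |.
have memI P : (P \in fset_set I) = (P \in I) by rewrite in_fset_set.
have memC P : (P \in fset_set C) = (P \in C) by rewrite in_fset_set.
(* Inside and crossing tiles are distinct, so one list is charged to the budget and also covers the
   smaller disk. *)
pose s := fset_set I ++ fset_set C.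
have us : uniq s.
  rewrite cat_uniq !fset_uniq/= andbT; apply/hasPn => P.
  rewrite memC => /set_mem[_ _ out]; rewrite memI.
  by apply/negP => /set_mem[].
have sT P : P \in s -> T P.
  by rewrite mem_cat memI memC => /orP[/set_mem/IT|/set_mem/CT].
split.
  apply: (le_trans _ (sumB s us sT)); rewrite big_cat/=; apply: lerD.
    rewrite big_seq [leRHS]big_seq; apply: ler_sum => P.
    by rewrite memI => /set_mem; exact: inI.
  have -> : 8 * #|` fset_set C|%:R = \sum_(P <- fset_set C) 8 :> R.
    by rewrite big_const_seq count_predT iter_addr_0 mulr_natr.
  rewrite big_seq [leRHS]big_seq; apply: ler_sum => P.
  by rewrite memC => /set_mem; exact: inC.
rewrite -lee_fin; have rho0 : 0 < r - 8 by lra.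
apply: (le_trans (disk_measure_ge rho0)).
have mD : measurable2 (disk (0 : R * R) (r - 8)).
  by apply: closed_measurable2; exact: disk_closed.
have -> : #|` fset_set I|%:R + #|` fset_set C|%:R = \sum_(P <- s) 1 :> R.
  by rewrite sum1_sizeR size_cat natrD.
apply: (@mu2_cover _ _ s (fun P => if P \in s then region P else set0)) => //.
- by move=> P; case: ifP => _; [exact: region_measurable|exact: measurable0].
- move=> P; case: ifP => Ps; last by rewrite measure0 lee_fin.
  by rewrite -[mu2 R _]/(area P) T_area//; exact: sT.
move=> x xD.
have [P TP Px] : (\bigcup_(P in T) region P) x by case: T_tiling => ->.
have Ps : P \in s.
  rewrite mem_cat memI memC.
  have [Pr|Pr] := pselect (region P `<=` disk 0 r); first by apply/orP; left; exact/mem_set.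
  by apply/orP; right; apply/mem_set; split => //; exists x.
by exists P; rewrite ?Ps.
Qed.

(** The threshold [250 / eps] makes the terms linear in [r] small against [eps * (pi * r ^+ 2)]. *)
Lemma fraction_ge (r eps : R) : 0 < eps -> eps <= 1 / 10 -> 250 / eps <= r ->
  (perimeter_inside T r <= ((c / 2 + eps) * (pi * r ^+ 2))%:E)%E ->
  - (180 * eps) <= fraction T (@efficient R) r - 26 / 10 * fraction T (@type1 R) r
             - 134 / 10 * fraction T (@type2 R) r.
Proof.
move=> e0 e1 re Pr.
have er : 250 <= eps * r by rewrite mulrC -ler_pdivrMr.
have r100 : 100 <= r by nra.
have r10 : 10 <= r by lra.
have pi0 := pi_gt0 R.
pose B := (c + 2 * eps) * (pi * r ^+ 2).
have PB : (2%:E * perimeter_inside T r <= B%:E)%E.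
  have -> : B%:E = (2%:E * ((c / 2 + eps) * (pi * r ^+ 2))%:E)%E.
    by rewrite -EFinM /B; congr (_%:E); field.
  by rewrite lee_wpmul2l.
have [finI [m [sumB cover]]] := local_count r10 PB.
rewrite !fraction_sum//.
set s := fset_set (tiles_inside T r) in sumB cover *.
set N := #|` s|%:R in cover *.
have cU : c <= 3091 / 800 by exact: cairo_value_le.
have c0 : 0 <= c by exact: perimeter_ge0.
have area1 P : P \in s -> area P = 1%E.
  by rewrite in_fset_set// => /set_mem[TP _]; exact: T_area.
have NE : N = \sum_(P <- s) 1 :> R by rewrite sum1_sizeR.
have W : c * N - \sum_(P <- s) perimeter P <= 7 / 135 * \sum_(P <- s) weight P.
  rewrite NE !mulr_sumr -sumrB big_seq [leRHS]big_seq; apply: ler_sum => P Ps.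
  by rewrite mulr1; apply: tile_weight; exact: area1.
have -> : (\sum_(P <- s) (`[< efficient P >])%:R) / N - 26 / 10 * ((\sum_(P <- s) (`[< type1 P >])%:R) / N)
   - 134 / 10 * ((\sum_(P <- s) (`[< type2 P >])%:R) / N) = (\sum_(P <- s) weight P) / N.
  by rewrite /weight !sumrB -!mulr_sumr; ring.
set V := \sum_(P <- s) weight P in W *.
set p := \sum_(P <- s) perimeter P in W sumB.
set A := pi * r ^+ 2 in B PB sumB *.
have A0 : 0 < A by rewrite mulr_gt0// exprn_gt0//; lra.
have pr0 : 0 <= pi * r by rewrite mulr_ge0 ?(ltW pi0)//; lra.
have rA : 250 * (pi * r) <= eps * A.
  have -> : eps * A = (eps * r) * (pi * r) by rewrite /A; ring.
  exact: ler_wpM2r.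
have rA' : 100 * (pi * r) <= A.
  have -> : A = r * (pi * r) by rewrite /A; ring.
  exact: ler_wpM2r.
have cover' : A - 16 * (pi * r) <= N + m%:R.
  apply: le_trans cover.
  have -> : pi * (r - 8) ^+ 2 = A - 16 * (pi * r) + 64 * pi by rewrite /A; ring.
  lra.
have p0 : 0 <= p by apply: sumr_ge0 => P _; exact: perimeter_ge0.
have [N0 VN] := average_estimate c0 cU (ltW e0) e1 pr0 p0 (ler0n R m) A0 rA rA' sumB cover' W.
by rewrite ler_pdivlMr.
Qed.

End Asymptotics.

Theorem proposition5p3 (R : realType) (T : set (pentagon R))
  (T_tiling : tiling T) (T_edge_to_edge : edge_to_edge T)
  (T_area : forall P, T P -> area P = 1%E)
  (T_ratio : forall Q : pentagon R, prismatic Q -> area Q = 1%E ->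
     (perimeter_ratio T <= (perimeter Q / 2)%:E)%E) :
  (0 <= limf_einf (fun r : R =>
          (fraction T (@efficient R) r - 26 / 10 * fraction T (@type1 R) r
             - 134 / 10 * fraction T (@type2 R) r)%:E) +oo%R)%E.
Proof.
have := T_ratio _ (prismatic_pentagonP R) (prismatic_area R).
have -> : perimeter (prismatic_pentagon R) = cairo_perimeter_value R.
  by rewrite prismatic_perimeter /cairo_perimeter_value cairo_perimeter.
set c := cairo_perimeter_value R => ratio {T_ratio}.
apply/lee_addgt0Pr => e e0; rewrite -leeBlDr// sub0e.
(* Makes the loss [180 eps] at most [e], within the range where [fraction_ge] holds. *)
pose eps := Num.min (1 / 10) (e / 180).
have eps0 : 0 < eps by rewrite lt_min !divr_gt0.
have eps1 : eps <= 1 / 10 by rewrite /eps ge_min lexx.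
have epse : 180 * eps <= e by rewrite mulrC -ler_pdivlMr// /eps ge_min lexx orbT.
have : (perimeter_ratio T < (c / 2 + eps)%:E)%E.
  by apply: (le_lt_trans ratio); rewrite lte_fin ltrDl.
(* The upper limit is an infimum of suprema over neighbourhoods of infinity; [V] is one whose
   supremum is already below the bound, and it serves again for the lower limit. *)
move=> /ereal_inf_lt[_ [V /= Voo <-] Vlt].
rewrite limf_einfE; apply: le_ereal_sup_tmp.
exists (ereal_inf [set (fraction T (@efficient R) r - 26 / 10 * fraction T (@type1 R) r
             - 134 / 10 * fraction T (@type2 R) r)%:E | r in V `&` [set r | 250 / eps < r]]).
  exists (V `&` [set r | 250 / eps < r]) => //.
  by apply: filterI => //; apply: nbhs_pinfty_gt; exact: num_real.
apply: le_ereal_inf_tmp => _ [r [Vr /= rbig] <-].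
rewrite lee_fin; apply: (@le_trans _ _ (- (180 * eps))); first by rewrite lerN2.
apply: (fraction_ge T_tiling T_area) => //; first exact: ltW.
have r0 : 0 < r by exact: (lt_trans (divr_gt0 (ltr0n R 250) eps0) rbig).
have pr : 0 < pi * r ^+ 2 by rewrite mulr_gt0 ?pi_gt0// exprn_gt0.
have : (perimeter_inside T r * ((pi * r ^+ 2)^-1)%:E <= (c / 2 + eps)%:E)%E.
  by apply/ltW/(le_lt_trans _ Vlt); apply: ereal_sup_ubound; exists r.
by rewrite lee_pdivrMr// -EFinM.
Qed.
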